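(* For every $\gamma>0$ there exist constants $C$ and $r$ (with $r$ a positive integer) such that for every function $p=p(n)\in(0,1]$ the random graph $\Gamma=G(n,p)$ asymptotically almost surely has the following property: every triangle-free spanning subgraph $H\subseteq\Gamma$ with minimum degree $\delta(H)\ge\left(\frac13+\gamma\right)pn$ can be made $r$-partite by removing at most $$\min\left(Cp^{-1}n,\ \left(\tfrac1{2r}+\gamma\right)pn^2\right)$$ edges.
   Context: $G(n,p)$ is the binomial random graph on vertex set $[n]=\{1,\dots,n\}$, in which each pair of vertices is an edge independently with probability $p$. ''Asymptotically almost surely'' means with probability tending to $1$ as $n\to\infty$. A spanning subgraph of $\Gamma$ is a subgraph with the same vertex set as $\Gamma$. A graph is $r$-partite if it is properly $r$-colourable. *)

(* Defs.v *)
From HB Require Import structures.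
From mathcomp Require Import all_boot all_order all_algebra.
From mathcomp Require Import all_classical all_reals all_analysis.
Set Implicit Arguments.
Unset Strict Implicit.
Unset Printing Implicit Defensive.
Import Order.TTheory GRing.Theory Num.Theory.
Import numFieldNormedType.Exports.
Local Open Scope ring_scope.

(* A simple graph with vertex set V is given by its edge set E, a set of      *)
(* two-element subsets of V.  In particular [set x; x] is never an edge, and  *)
(* the spanning subgraphs of G are exactly the subsets of its edge set.       *)
Definition pairs (V : finType) : {set {set V}} := [set e : {set V} | #|e| == 2].

Definition is_graph (V : finType) (E : {set {set V}}) : bool := E \subset pairs V.

Definition degree (V : finType) (E : {set {set V}}) (v : V) : nat :=
  #|[set e in E | v \in e]|.

(* For a simple graph every degree is less than #|V|, so the initial value is *)
(* immaterial as soon as V is nonempty.                                       *)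
Definition min_degree (V : finType) (E : {set {set V}}) : nat :=
  \big[minn/#|V|]_(v : V) degree E v.

Definition triangle_free (V : finType) (E : {set {set V}}) : Prop :=
  forall x y z : V,
    ~ [/\ [set x; y] \in E, [set y; z] \in E & [set x; z] \in E].

Definition partite (V : finType) (r : nat) (E : {set {set V}}) : Prop :=
  exists f : V -> 'I_r, forall x y : V, [set x; y] \in E -> f x != f y.

(* The probability that G(n,p) is the graph G: the events e \in G, for e      *)
(* ranging over all pairs, are independent and each has probability p.        *)
Definition gnp_mass (R : realType) (n : nat) (p : R) (G : {set {set 'I_n}}) : R :=
  \prod_(e in pairs 'I_n) (if e \in G then p else 1 - p).

Definition gnp_prob (R : realType) (n : nat) (p : R)
    (A : {set {set 'I_n}} -> Prop) : R :=
  \sum_(G : {set {set 'I_n}} | is_graph G && `[< A G >]) gnp_mass p G.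

Definition gnp_aas (R : realType) (p : nat -> R)
    (A : forall n : nat, {set {set 'I_n}} -> Prop) : Prop :=
  (gnp_prob (p n) (@A n) @[n --> \oo] --> (1 : R))%classic.

(* Main.v *)
Require Import Defs.
From HB Require Import structures.
From mathcomp Require Import all_boot all_order all_algebra.
From mathcomp Require Import all_classical all_reals all_analysis.
From mathcomp Require Import fintype finset ring lra.
Set Implicit Arguments.
Unset Strict Implicit.
Unset Printing Implicit Defensive.
Import Order.TTheory GRing.Theory Num.Theory.
Import numFieldNormedType.Exports.
Local Open Scope ring_scope.

(* Let q = p^2 n. If q is bounded, a uniformly random r-colouring of H loses at most e(H)/r
   edges, and C n/p exceeds p n^2. So let q be large, where it is enough to delete O(n/p) edges.

   Weak (Frieze-Kannan) regularity in L^2(G) approximates H, in cut norm, by a weight D on pairs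
   of boundedly many cells. Vertices are coloured by the rounded densities of their
   neighbourhoods N_H(u) in the cells. This profile predicts, through D, the normalised codegree
   s_u(w) of u with every w; let Z be the set of w where it is not tiny, and Y its complement.

   (1) Since every degree is at least (1/3+gamma)pn, either |Y| < 2n/3 or the class has size
   O(1/p).
   (2) As H is triangle-free, N_H(u) misses the vertices having a positive codegree with u, so it
   should essentially lie in Y. This holds for all but O(1/p^2) vertices u of the class: if it
   fails for u, a random set of O(1/p^2) vertices exposes O(n/p) edges of H that determine a
   small set in which the neighbourhood of u in G is too dense, and a union bound over these few
   edges shows that this cannot happen for too many u. All edges at such u can be lost.
   (3) If uv is an edge inside the class, a vertex w of Y adjacent in G to u and v is adjacent in
   H to at most one of them. With the edge distribution of G inside neighbourhoods, this gives
   2(1/3+gamma) <= |Y|/n up to small errors, unless the class spans only O(n/p) edges. *)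

(** * Exponential moments in the binomial random graph *)

(** [H] is chosen after [G], among up to exp(O(p n^2)) subgraphs, far too many for a union bound. So
    all that is recorded about [H] must have at most exp(O(n/p)) weighted outcomes. The cells, the
    weights (on a finite grid) and the set [Z] cost exp(O(n)). The relevant codegrees have order p^2
    n, so a sample needs about 1/p^2 vertices to meet the common neighbourhoods; it touches O(n/p^2)
    pairs, and summing p^|J| over sets J of such pairs gives at most exp(O(n/p)). That N vertices
    all have too many neighbours in prescribed sets has probability exp(-c p n N), which also pays
    for choosing the N vertices because p n >= sqrt n. This wins once N is a large multiple of
    1/p^2. Each such vertex costs at most 2 p n edges of [H], O(n/p) altogether: the order of the
    bound is the break-even point of this union bound. *)

Ltac goal_lra := repeat match goal with H : ?P |- _ => match type of P with Prop => clear H end end; lra.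

Lemma sum_prod_subset (R : comNzRingType) (T : finType) (S : {set T}) (F F' : T -> R) :
  \sum_(G : {set T} | G \subset S) \prod_(e in S) (if e \in G then F e else F' e) =
  \prod_(e in S) (F e + F' e).
Proof.
rewrite big_mkcond /= [RHS]big_mkcond /=.
(* Outside [S] the two terms are 0 and 1, so in the expansion over all sets only those contained in
   [S] survive. *)
transitivity (\prod_e ((if e \in S then F e else 0) + (if e \in S then F' e else 1))).
  rewrite bigA_distr; apply: eq_bigr => G _.
  case: ifPn => [sGS|/fintype.subsetPn[e eG eS]].
    rewrite big_mkcond; apply: eq_bigr => e _.
    by case: ifPn => eS; case: ifPn => eG //; rewrite (fintype.subsetP sGS) in eS.
  by rewrite (bigD1 e) //= eG (negbTE eS) mul0r.
by apply: eq_bigr => e _; case: ifP; rewrite ?add0r.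
Qed.

Definition gnp_exp (R : realType) (n : nat) (p : R) (f : {set {set 'I_n}} -> R) : R :=
  \sum_(G : {set {set 'I_n}} | is_graph G) gnp_mass p G * f G.

Section Gnp.
Variables (R : realType) (n : nat) (p : R).
Hypotheses (p0 : 0 <= p) (p1 : p <= 1).
Local Notation graph := {set {set 'I_n}}.
Implicit Types (A B : graph -> Prop) (f g : graph -> R).

Lemma gnp_mass_ge0 (G : graph) : 0 <= gnp_mass p G.
Proof. by apply: prodr_ge0 => e _; case: ifP; rewrite ?subr_ge0. Qed.

Lemma gnp_exp_prod (g h : {set 'I_n} -> R) :
  gnp_exp p (fun G => \prod_(e in pairs 'I_n) (if e \in G then g e else h e)) =
  \prod_(e in pairs 'I_n) (p * g e + (1 - p) * h e).
Proof.
rewrite -sum_prod_subset; apply: eq_bigr => G _.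
by rewrite -big_split; apply: eq_bigr => e _ /=; case: ifP.
Qed.

Lemma gnp_prob_exp A : gnp_prob p A = gnp_exp p (fun G => (`[< A G >])%:R).
Proof.
rewrite /gnp_prob /gnp_exp big_mkcondr; apply: eq_bigr => G _.
by case: ifP => _; rewrite ?mulr1 ?mulr0.
Qed.

Lemma gnp_exp_le f g : (forall G, is_graph G -> f G <= g G) -> gnp_exp p f <= gnp_exp p g.
Proof.
move=> H; apply: ler_sum => G gG; apply: ler_wpM2l; first exact: gnp_mass_ge0.
exact: H.
Qed.

Lemma gnp_exp_sum (I : finType) (P : pred I) (f : I -> graph -> R) :
  gnp_exp p (fun G => \sum_(i | P i) f i G) = \sum_(i | P i) gnp_exp p (f i).
Proof.
rewrite /gnp_exp exchange_big /=; apply: eq_bigr => G _.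
by rewrite mulr_sumr.
Qed.

Lemma gnp_expZ c f : gnp_exp p (fun G => c * f G) = c * gnp_exp p f.
Proof. by rewrite /gnp_exp mulr_sumr; apply: eq_bigr => G _; rewrite mulrCA. Qed.

Lemma gnp_exp1 : gnp_exp p (fun _ : graph => 1) = 1.
Proof.
transitivity (gnp_exp p (fun G => \prod_(e in pairs 'I_n) (if e \in G then 1 else 1 : R))).
  by apply: eq_bigr => G _; rewrite big1 // => e _; case: ifP.
by rewrite gnp_exp_prod big1 // => e _; rewrite !mulr1 addrC subrK.
Qed.

Lemma le_gnp_prob A B : (forall G, is_graph G -> A G -> B G) -> gnp_prob p A <= gnp_prob p B.
Proof.
move=> AB; rewrite !gnp_prob_exp; apply: gnp_exp_le => G gG.
by rewrite ler_nat; case: asboolP => // /(AB _ gG) BG; case: asboolP.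
Qed.

Lemma gnp_prob_le1 A : gnp_prob p A <= 1.
Proof.
rewrite gnp_prob_exp -[leRHS]gnp_exp1; apply: gnp_exp_le => G _.
by case: asboolP => _ /=; rewrite ?lexx ?ler01.
Qed.

Lemma gnp_probU A B : gnp_prob p (fun G => A G \/ B G) <= gnp_prob p A + gnp_prob p B.
Proof.
rewrite !gnp_prob_exp /gnp_exp -big_split /=; apply: ler_sum => G _.
rewrite -mulrDr; apply: ler_wpM2l; first exact: gnp_mass_ge0.
rewrite -natrD ler_nat.
by case: (asboolP (A G)) => a; case: (asboolP (B G)) => b; case: asboolP => // -[].
Qed.

(** The bound [b] is summed over the whole index type: it may be taken to vanish where [P] fails,
    and is then summed coordinate by coordinate. *)
Lemma gnp_prob_bigU (I : finType) (P : I -> Prop) (A : I -> graph -> Prop) (b : I -> R) :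
  (forall i, 0 <= b i) ->
  (forall i, P i -> gnp_prob p (A i) <= b i) ->
  gnp_prob p (fun G => exists2 i, P i & A i G) <= \sum_i b i.
Proof.
move=> b0 Ab.
apply: (@le_trans _ _ (\sum_(i | `[< P i >]) gnp_prob p (A i))); last first.
  rewrite [leRHS](bigID (fun i => `[< P i >])) /= -[leLHS]addr0.
  apply: lerD; last exact: sumr_ge0.
  by apply: ler_sum => i /asboolP; exact: Ab.
under eq_bigr do rewrite gnp_prob_exp.
rewrite gnp_prob_exp -gnp_exp_sum; apply: gnp_exp_le => G _.
case: asboolP => [[i /asboolP Pi AG]|_]; last exact: sumr_ge0.
rewrite (bigD1 i) //=; case: asboolP => // _.
by rewrite lerDl; apply: sumr_ge0.
Qed.

Lemma gnp_probC A : gnp_prob p A = 1 - gnp_prob p (fun G => ~ A G).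
Proof.
rewrite -gnp_exp1 !gnp_prob_exp /gnp_exp -sumrB; apply: eq_bigr => G _.
rewrite -mulrBr; congr (_ * _).
by case: (asboolP (A G)) => a; case: asboolP => //; rewrite ?subr0 ?subrr.
Qed.

(** Counting ordered pairs makes the count over a product of [U] and [B] equal to the sum of the
    degrees into [B]. An edge then has weight 0, 1 or 2, its [mult] below. *)
Definition ordcount (P : {set 'I_n * 'I_n}) (G : graph) : nat :=
  #|[set xy in P | [set xy.1; xy.2] \in G]|.

Definition offdiag (P : {set 'I_n * 'I_n}) : {set 'I_n * 'I_n} :=
  [set xy in P | xy.1 != xy.2].

Let mult (P : {set 'I_n * 'I_n}) (e : {set 'I_n}) : nat :=
  #|[set xy in P | [set xy.1; xy.2] == e]|.

Let mult_le2 P e : e \in pairs 'I_n -> (mult P e <= 2)%N.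
Proof.
rewrite inE => /cards2P[x [y [xy ->]]].
apply: (@leq_trans #|[set (x, y); (y, x)]|); last by rewrite cards2; case: eqP.
apply/subset_leq_card/fintype.subsetP => -[a b]; rewrite !inE /= => /andP[_ /eqP ab].
have: a \in [set x; y] by rewrite -ab !inE eqxx.
have: b \in [set x; y] by rewrite -ab !inE eqxx orbT.
rewrite !inE => /orP[] /eqP Eb /orP[] /eqP Ea; subst a b; rewrite ?eqxx ?orbT //.
- have : y \in [set x; x] by rewrite ab !inE eqxx orbT.
  by rewrite !inE orbb eq_sym (negbTE xy).
- have : x \in [set y; y] by rewrite ab !inE eqxx.
  by rewrite !inE orbb (negbTE xy).
Qed.

Let ordcountE P (G : graph) : is_graph G ->
  ordcount P G = (\sum_(e in pairs 'I_n) (if e \in G then mult P e else 0))%N.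
Proof.
move=> gG; rewrite -big_mkcondr /ordcount /mult.
rewrite -sum1_card (partition_big (fun xy : 'I_n * 'I_n => [set xy.1; xy.2])
  (fun e => (e \in pairs 'I_n) && (e \in G))) /=.
  apply: eq_bigr => e /andP[_ eG]; rewrite sum1_card; apply: eq_card => xy.
  by rewrite unfold_in !inE; case: eqP => [->|]; rewrite ?eG ?andbF ?andbT.
by move=> xy; rewrite inE => /andP[_ xyG]; rewrite xyG (fintype.subsetP gG).
Qed.

Let offdiagE P : #|offdiag P| = (\sum_(e in pairs 'I_n) mult P e)%N.
Proof.
rewrite /offdiag -sum1_card.
rewrite (partition_big (fun xy : 'I_n * 'I_n => [set xy.1; xy.2])
  (fun e => e \in pairs 'I_n)) /=; last first.
  by move=> xy; rewrite !inE cards2 => /andP[_ ->].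
apply: eq_bigr => e; rewrite inE => e2; rewrite sum1_card; apply: eq_card => xy.
rewrite unfold_in !inE; case: (_ =P e) => [E|]; rewrite ?andbF ?andbT //.
by move: e2; rewrite -E cards2; case: (xy.1 == xy.2); rewrite /= ?andbT.
Qed.

(** Squaring [expR (y / 2) <= (1 - y / 2)^-1] leaves a polynomial inequality. The range fits an [l]
    of modulus at most 1/8 times a multiplicity at most 2. *)
Lemma expR_le_quad (y : R) : y <= 4^-1 -> expR y <= 1 + y + y ^+ 2.
Proof.
move=> y4.
have h1 : 0 < 1 - y / 2 by lra.
have h2 : expR (y / 2) <= (1 - y / 2)^-1.
  have h3 : 1 - y / 2 <= expR (- (y / 2)) by exact: expR_ge1Dx.
  rewrite -[leLHS]invrK -expRN lef_pV2 ?posrE ?expR_gt0 //. 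
have -> : expR y = expR (y / 2) ^+ 2.
  by rewrite expr2 -expRD -splitr.
apply: (@le_trans _ _ ((1 - y / 2)^-1 ^+ 2)).
  by rewrite lerXn2r // nnegrE ?expR_ge0 // invr_ge0 ltW.
have h4 : 0 < (1 - y / 2) ^+ 2 by rewrite exprn_gt0.
rewrite exprVn -[leLHS]mul1r ler_pdivrMr //.
rewrite -subr_ge0.
have -> : (1 + y + y ^+ 2) * (1 - y / 2) ^+ 2 - 1 = y ^+ 2 / 4 * (1 - 3 * y + y ^+ 2).
  by field.
apply: mulr_ge0; first by rewrite divr_ge0 ?sqr_ge0.
by have := sqr_ge0 y; lra.
Qed.

(** The pairs of [P] avoid [S], so the expectation factorises: each pair of [S] contributes [p],
    every other one the centred exponential moment of a Bernoulli variable of weight [mult P e].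
    Keeping the event [S \subset G] inside the expectation yields the factor [p ^+ #|S|], which
    makes later union bounds over exposed edge sets summable. *)
Lemma gnp_exp_moment (S : graph) (P : {set 'I_n * 'I_n}) (l : R) :
  S \subset pairs 'I_n ->
  (forall xy, xy \in P -> [set xy.1; xy.2] \notin S) -> `|l| <= 8^-1 ->
  gnp_exp p (fun G => (S \subset G)%:R *
     expR (l * ((ordcount P G)%:R - p * #|offdiag P|%:R))) <=
  p ^+ #|S| * expR (2 * l ^+ 2 * p * #|P|%:R).
Proof.
move=> SP PS l8.
have c0 : 0 <= 2 * l ^+ 2 * p.
  by apply: mulr_ge0 => //; apply: mulr_ge0 => //; exact: sqr_ge0.
have multS e : e \in S -> mult P e = 0%N.
  move=> eS; apply/eqP; rewrite cards_eq0; apply/eqP/setP => xy; rewrite !inE.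
  by apply/negP => /andP[/PS xyS /eqP E]; rewrite E eS in xyS.
pose h e : R := expR (- (l * p * (mult P e)%:R)).
pose g e : R := expR (l * (mult P e)%:R - l * p * (mult P e)%:R).
apply: (@le_trans _ _ (gnp_exp p (fun G => \prod_(e in pairs 'I_n)
   (if e \in G then g e else (e \notin S)%:R * h e)))).
  apply: gnp_exp_le => G gG.
  case: (boolP (S \subset G)) => [SG|_]; last first.
    by rewrite mul0r; apply: prodr_ge0 => e _; case: ifP => _; rewrite ?mulr_ge0 ?expR_ge0.
  rewrite mul1r ordcountE // offdiagE !natr_sum mulr_sumr -sumrB mulr_sumr expR_sum.
  apply: ler_prod => e eP; rewrite expR_ge0 /=.
  case: ifPn => eG; first by rewrite /g mulrBr -!mulrA.
  rewrite (contraNN (fintype.subsetP SG e)) // mul1r /h mulrBr mulr0 sub0r.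
  by rewrite mulrA.
rewrite gnp_exp_prod.
rewrite (bigID (mem S)) /=; apply: ler_pM.
- by apply: prodr_ge0 => e _; rewrite addr_ge0 // !mulr_ge0 ?expR_ge0 ?subr_ge0.
- by apply: prodr_ge0 => e _; rewrite addr_ge0 // !mulr_ge0 ?expR_ge0 ?subr_ge0.
- under eq_bigr => e /andP[eP eS].
    rewrite /g (multS e eS) eS /= mul0r !mulr0 subr0 expR0 mulr1 addr0.
    over.
  rewrite prodr_const /=.
  have -> : #|[pred e in pairs 'I_n | e \in S]| = #|S|.
    by apply: eq_card => e; rewrite !inE; apply: andb_idl => /(fintype.subsetP SP); rewrite inE.
  by [].
- apply: (@le_trans _ _ (\prod_(e in pairs 'I_n) expR (2 * l ^+ 2 * p * (mult P e)%:R))).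
    rewrite [leRHS](bigID (mem S)) /= -[leLHS]mul1r; apply: ler_pM => //.
    + by apply: prodr_ge0 => e _; rewrite addr_ge0 // !mulr_ge0 ?expR_ge0 ?subr_ge0.
    + apply: (big_ind (fun x => 1 <= x)) => // [x y|e _]; first exact: mulr_ege1.
      apply: le_trans (expR_ge1Dx _); rewrite lerDl.
      exact: mulr_ge0.
    apply: ler_prod => e /andP[eP eS].
    rewrite addr_ge0 ?mulr_ge0 ?expR_ge0 ?subr_ge0 //= eS mul1r.
    have: (mult P e)%:R <= 2 :> R by rewrite ler_nat mult_le2.
    have: 0 <= (mult P e)%:R :> R by [].
    rewrite /g /h; move: (mult P e)%:R => m m0 m2.
    move: l8; rewrite ler_norml => /andP[l8n l8].
    have lm1 : l * m <= 4^-1 by nra.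
    have lm2 : - 4^-1 <= l * m by nra.
    rewrite -[l * m - _]/(l * m - l * p * m).
    have b1 : expR (l * m - l * p * m) <= 1 + (l * m - l * p * m) + (l * m - l * p * m) ^+ 2.
      apply: expR_le_quad.
      have : 0 <= (4^-1 - l * m) * (1 - p) by rewrite mulr_ge0 // subr_ge0.
      have -> : (4^-1 - l * m) * (1 - p) = 4^-1 * (1 - p) - (l * m - l * p * m) by ring.
      by rewrite subr_ge0 => /le_trans; apply; rewrite ler_piMr // gerBl.
    have b2 : expR (- (l * p * m)) <= 1 + (- (l * p * m)) + (- (l * p * m)) ^+ 2.
      apply: expR_le_quad.
      have : 0 <= (4^-1 + l * m) * p by rewrite mulr_ge0 // addrC -lerBlDr sub0r.
      have -> : (4^-1 + l * m) * p = 4^-1 * p - - (l * p * m) by ring.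
      by rewrite subr_ge0 => /le_trans; apply; rewrite ler_piMr.
    (* The linear terms cancel and the quadratic ones add up to the variance p (1 - p) (l m)^2. Then
       [m <= 2] turns m^2 into 2 m, so that the exponents sum to a multiple of [#|offdiag P|]. *)
    apply: (@le_trans _ _ (1 + p * (l * m) ^+ 2)); last first.
      apply: le_trans (expR_ge1Dx _) => //.
      rewrite lerD2l.
      have -> : 2 * l ^+ 2 * p * m = p * (l ^+ 2 * (2 * m)) by ring.
      apply: ler_wpM2l => //; rewrite exprMn; apply: ler_wpM2l; first exact: sqr_ge0.
      by rewrite expr2; apply: ler_wpM2r.
    apply: (@le_trans _ _ (p * (1 + (l * m - l * p * m) + (l * m - l * p * m) ^+ 2) +
      (1 - p) * (1 + (- (l * p * m)) + (- (l * p * m)) ^+ 2))).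
      by apply: lerD; apply: ler_wpM2l; rewrite ?subr_ge0.
    rewrite -subr_ge0.
    have -> : 1 + p * (l * m) ^+ 2 - (p * (1 + (l * m - l * p * m) + (l * m - l * p * m) ^+ 2) +
      (1 - p) * (1 + (- (l * p * m)) + (- (l * p * m)) ^+ 2)) = (p * (l * m)) ^+ 2 by ring.
    exact: sqr_ge0.
  rewrite -expR_sum ler_expR -mulr_sumr; apply: ler_wpM2l => //.
  rewrite -natr_sum -offdiagE ler_nat subset_leq_card //.
  by apply/fintype.subsetP => xy; rewrite inE => /andP[].
Qed.

(** Markov's inequality for the exponential moment; the sign of [l] selects the tail. *)
Lemma gnp_chernoff (S : graph) (P : {set 'I_n * 'I_n}) (l t : R) :
  S \subset pairs 'I_n ->
  (forall xy, xy \in P -> [set xy.1; xy.2] \notin S) -> `|l| <= 8^-1 ->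
  gnp_prob p (fun G => S \subset G /\ t <= l * ((ordcount P G)%:R - p * #|offdiag P|%:R)) <=
  p ^+ #|S| * expR (2 * l ^+ 2 * p * #|P|%:R - t).
Proof.
move=> SP PS l8; rewrite expRD mulrA.
apply: le_trans (ler_wpM2r (expR_ge0 _) (gnp_exp_moment SP PS l8)).
rewrite [leRHS]mulrC -gnp_expZ gnp_prob_exp; apply: gnp_exp_le => G _.
case: asboolP => [[-> tl]|_]; last by rewrite !mulr_ge0 ?expR_ge0.
rewrite mul1r -expRD; apply: le_trans (expR_ge1Dx _).
by rewrite lerDl addrC subr_ge0.
Qed.

End Gnp.

(** * Random samples of vertices *)

Section Sampling.
Variables (R : realType) (V : finType).
Local Notation n := (#|V|%:R : R).

Lemma sum_ffun_prod m (f : V -> R) :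
  \sum_(t : {ffun 'I_m -> V}) \prod_i f (t i) = (\sum_v f v) ^+ m.
Proof. by rewrite -(bigA_distr_bigA (fun (_ : 'I_m) v => f v)) prodr_const card_ord. Qed.

(** Linearity of expectation for [m] independent uniform vertices; the factor [n] on the left avoids
    an exponent m - 1. *)
Lemma sum_ffun_sum m (f : V -> R) :
  n * \sum_(t : {ffun 'I_m -> V}) \sum_i f (t i) =
  m%:R * n ^+ m * \sum_v f v.
Proof.
rewrite exchange_big /= mulr_sumr.
rewrite (eq_bigr (fun=> n ^+ m * \sum_v f v)); last first.
  move=> i _.
  have : n ^+ m * \sum_v f v =
    n * \sum_(t : {ffun 'I_m -> V}) \prod_j (if j == i then f (t j) else 1).
    rewrite -(bigA_distr_bigA (fun (j : 'I_m) v => if j == i then f v else 1)).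
    rewrite [in RHS](bigD1 i) //= eqxx [X in _ * (_ * X)](eq_bigr (fun=> n)); last first.
      by move=> j ji; rewrite (negbTE ji) sumr_const.
    rewrite prodr_const cardC1 card_ord mulrCA -exprS.
    by case: (m) i => [[]|k _] //=; rewrite mulrC.
  move=> ->; congr (_ * _); apply: eq_bigr => t _.
  by rewrite (bigD1 i) //= eqxx big1 ?mulr1 // => j ji; rewrite (negbTE ji).
by rewrite sumr_const card_ord -mulrA [RHS]mulr_natl.
Qed.

Lemma markov_count (O : finType) (f : O -> R) (a : R) :
  (forall o, 0 <= f o) -> a * #|[set o | a < f o]|%:R <= \sum_o f o.
Proof.
move=> f0; rewrite -sum1_card natr_sum mulr_sumr [leRHS](bigID [pred o | a < f o]) /=.
rewrite -[leLHS]addr0 lerD ?sumr_ge0 //.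
rewrite (eq_bigl (fun o => a < f o)); last by move=> o; rewrite inE.
by apply: ler_sum => o /ltW; rewrite mulr1.
Qed.

(** First-moment method, by exchanging the two counts. The outcomes are samples of vertices, with
    [X] a set of vertices, and later colourings, with [X] the edge set of [H]. *)
Lemma exists_few_bad (O : finType) (X : {set V}) (bad : O -> V -> bool) (q : R) :
  (0 < #|O|)%N ->
  (forall u, u \in X -> #|[set o | bad o u]|%:R <= q * #|O|%:R) ->
  exists o, #|[set u in X | bad o u]|%:R <= q * #|X|%:R.
Proof.
move=> O0 Hb; apply: contrapT => /forallNP H.
have [x0 _] : exists o : O, o \in predT by apply/card_gt0P.
suff: \sum_(o : O) (q * #|X|%:R) < \sum_(o : O) #|[set u in X | bad o u]|%:R.
  apply/negP; rewrite -leNgt.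
  apply: (@le_trans _ _ (\sum_(u in X) #|[set o | bad o u]|%:R)); last first.
    apply: le_trans (ler_sum _ Hb) _.
    by rewrite !sumr_const -[leLHS]mulr_natr -[leRHS]mulr_natr -!mulrA [X in _ * X]mulrC.
  rewrite -!natr_sum ler_nat.
  under eq_bigr do rewrite -sum1_card big_mkcond /=.
  rewrite exchange_big /= [leqRHS]big_mkcond /=; apply: leq_sum => u _.
  case: ifPn => uX; last by rewrite big1 // => o _; rewrite inE (negbTE uX).
  rewrite -sum1_card [leqRHS]big_mkcond /=; apply: leq_sum => o _.
  by rewrite !inE uX.
apply: ltr_sum; last by move=> o _; rewrite ltNge; apply/negP/H.
by apply/hasP; exists x0; rewrite ?mem_index_enum.
Qed.

(** A fixed [w] is missed by a proportion (1 - |S w| / n)^m of all samples, which is at most exp(-m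
    s / n). *)
Lemma count_miss m (B0 : {set V}) (S : V -> {set V}) (s : R) :
  (forall w, w \in B0 -> s <= #|S w|%:R) ->
  \sum_(t : {ffun 'I_m -> V}) #|[set w in B0 | [forall i, t i \notin S w]]|%:R
  <= n ^+ m.+1 * expR (- (m%:R * s / n)).
Proof.
move=> Hs.
have [n0|n0] := posnP #|V|.
  rewrite [leLHS]big1 ?mulr_ge0 ?expR_ge0 ?exprn_ge0 // => t _.
  rewrite (_ : [set _ in B0 | _] = finset.set0) ?cards0 //.
  by apply/setP => w; have := fintype0 w n0.
apply: (@le_trans _ _ (\sum_(w in B0) (n - #|S w|%:R) ^+ m)).
  under eq_bigr => t _ do rewrite -sum1_card natr_sum big_mkcond /=.
  rewrite exchange_big /= [leRHS]big_mkcond /=; apply: ler_sum => w _.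
  case: ifPn => wB; last by rewrite big1 // => t _; rewrite inE (negbTE wB).
  have -> : n - #|S w|%:R = \sum_v (v \notin S w)%:R.
    rewrite -(cardsC (S w)) natrD addrC addKr -sum1_card natr_sum big_mkcond /=.
    by apply: eq_bigr => v _; rewrite inE; case: (v \in S w).
  rewrite -sum_ffun_prod; apply: ler_sum => t _; rewrite inE wB /=.
  case: ifPn => [/forallP Ht|_]; last by apply: prodr_ge0 => i _; case: (_ \notin _).
  by rewrite big1 // => i _; rewrite Ht.
apply: (@le_trans _ _ (\sum_(w in B0) n ^+ m * expR (- (m%:R * s / n)))).
  apply: ler_sum => w wB.
  have nn0 : 0 < n by rewrite ltr0n.
  have -> : - (m%:R * s / n) = m%:R * (- (s / n)) by rewrite mulrN mulrA.
  rewrite expRM_natl -exprMn; apply: lerXn2r.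
  - by rewrite nnegrE subr_ge0 ler_nat max_card.
  - by rewrite nnegrE mulr_ge0 ?expR_ge0.
  - have := Hs w wB => sS.
    apply: (@le_trans _ _ (n * (1 - s / n))).
      by rewrite mulrBr mulr1 mulrCA divff ?mulr1 ?lerB // gt_eqF.
    by apply: ler_wpM2l; [exact: ltW | exact: expR_ge1Dx].
rewrite sumr_const -[leLHS]mulr_natl mulrA exprS; apply: ler_wpM2r; first exact: expR_ge0.
by apply: ler_wpM2r; rewrite ?exprn_ge0 // ler_nat max_card.
Qed.

Lemma count_lower_tail m (S : {set V}) (p d : R) :
  (0 < #|V|)%N -> 0 <= p -> 0 < d -> d <= 1 -> #|S|%:R <= 2 * p * n ->
  #|[set t : {ffun 'I_m -> V} |
      #|[set i | t i \in S]|%:R < m%:R * #|S|%:R / n - d * (p * m%:R)]|%:R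
  <= n ^+ m * expR (- (d ^+ 2 / 8 * (p * m%:R))).
Proof.
move=> V0 p0 d0 d1 Sp.
have nn0 : 0 < n by rewrite ltr0n.
(* Minimiser of 2 l^2 - d l, the exponent per unit of [p * m] when [#|S| <= 2 * p * n]; the minimum
   is -d^2 / 8. *)
pose l := d / 4; pose q := #|S|%:R / n.
pose y := m%:R * #|S|%:R / n - d * (p * m%:R).
have l0 : 0 < l by rewrite divr_gt0.
have l14 : l <= 4^-1 by rewrite /l; lra.
have q0 : 0 <= q by rewrite divr_ge0.
have q2 : q <= 2 * p by rewrite ler_pdivrMr.
have q1 : q <= 1 by rewrite ler_pdivrMr // mul1r ler_nat max_card.
apply: (@le_trans _ _ (\sum_(t : {ffun 'I_m -> V})
   expR (l * y) * \prod_i (if t i \in S then expR (- l) else 1))).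
  rewrite -sum1_card natr_sum big_mkcond; apply: ler_sum => t _; rewrite inE.
  case: ifPn => [Ht|_]; last first.
    by rewrite mulr_ge0 ?expR_ge0 ?prodr_ge0 // => i _; case: ifP; rewrite ?expR_ge0.
  rewrite -big_mkcond /= prodr_const -expRM_natl -expRD.
  have -> : #|[pred i | t i \in S]| = #|[set i | t i \in S]|.
    by apply: eq_card => i; rewrite !inE.
  apply: le_trans (expR_ge1Dx _); rewrite lerDl mulrN [_%:R * l]mulrC -mulrBr.
  by apply: mulr_ge0; [exact: ltW | rewrite subr_ge0; exact: ltW].
rewrite -mulr_sumr (sum_ffun_prod m (fun v => if v \in S then expR (- l) else 1)).
have -> : \sum_v (if v \in S then expR (- l) else 1) = n * (1 - q * (1 - expR (- l))).
  rewrite (eq_bigr (fun v => 1 - (if v \in S then 1 - expR (- l) else 0))); last first.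
    by move=> v _; case: ifP => _; rewrite ?subr0 ?subKr.
  rewrite sumrB sumr_const -big_mkcond /= sumr_const -[_ *+ #|S|]mulr_natl [RHS]mulrBr mulr1 /q.
  by rewrite [in RHS]mulrA [n * (_ / _)]mulrCA divff ?mulr1 ?gt_eqF.
rewrite exprMn mulrCA; apply: ler_wpM2l; first by rewrite exprn_ge0 // ltW.
have e1 : expR (- l) <= 1 - l + l ^+ 2.
  by have := @expR_le_quad R (- l); rewrite sqrrN; apply; lra.
have e0 := expR_gt0 (- l).
have b1 : 1 - q * (1 - expR (- l)) <= expR (- (q * (l - l ^+ 2))).
  apply: le_trans (expR_ge1Dx _); rewrite lerD2l lerN2; apply: ler_wpM2l => //.
  by rewrite lerBrDr -lerBrDl; move: e1; lra.
have b0 : 0 <= 1 - q * (1 - expR (- l)).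
  have : q * (1 - expR (- l)) <= 1 * 1.
    have e2 : expR (- l) <= 1 by rewrite expR_le1 oppr_le0 ltW.
    by apply: ler_pM => //; lra.
  by lra.
apply: (@le_trans _ _ (expR (l * y) * expR (- (q * (l - l ^+ 2))) ^+ m)).
  by apply: ler_wpM2l; [exact: expR_ge0 | apply: lerXn2r; rewrite ?nnegrE ?expR_ge0].
rewrite -expRM_natl -expRD ler_expR.
have -> : y = m%:R * q - d * (p * m%:R) by rewrite /y /q [m%:R * (_ / _)]mulrA.
have m0 : 0 <= m%:R :> R by [].
move: (m%:R : R) m0 => M M0.
have -> : l * (M * q - d * (p * M)) + M * - (q * (l - l ^+ 2)) =
   M * (q * l ^+ 2) - d ^+ 2 / 4 * (p * M) by rewrite /l; field.
have : M * (q * l ^+ 2) <= M * (2 * p * l ^+ 2).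
  by apply: ler_wpM2l => //; apply: ler_wpM2r => //; exact: sqr_ge0.
have -> : M * (2 * p * l ^+ 2) = d ^+ 2 / 8 * (p * M) by rewrite /l; field.
by lra.
Qed.

End Sampling.

(** * Weak regularity relative to a host graph *)

(** Each refinement records membership in the two sides of a violated cut, so [t] rounds give 4^t
    cells. The type depends on [t] alone, hence the number of colours can be fixed before the
    graph. *)
Fixpoint cell_type (t : nat) : finType :=
  if t is t'.+1 then (cell_type t' * (bool * bool))%type : finType else unit.

Section WeakRegularity.
Variables (R : realType) (V : finType) (g h : rel V) (M : nat).
Hypothesis M0 : (0 < M)%N.
Local Notation mass := (\sum_x \sum_y (g x y)%:R : R).

(** The weights are multiples of 1/M, so that there are finitely many [D] and a union bound over
    them is possible. *)
Definition step_dev (T : finType) (c : {ffun V -> T}) (D : {ffun T * T -> 'I_M.+1})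
    (x y : V) : R :=
  (h x y)%:R - (D (c x, c y))%:R / M%:R.

Definition cut_dev (T : finType) (c : {ffun V -> T}) (D : {ffun T * T -> 'I_M.+1})
    (A B : {set V}) : R :=
  \sum_(x in A) \sum_(y in B) (g x y)%:R * step_dev c D x y.

Definition cut_good (T : finType) (c : {ffun V -> T}) (D : {ffun T * T -> 'I_M.+1}) : Prop :=
  forall A B, `|cut_dev c D A B| <= mass / M%:R.

Let nrm (T : finType) (c : {ffun V -> T}) (D : {ffun T * T -> 'I_M.+1}) : R :=
  \sum_x \sum_y (g x y)%:R * step_dev c D x y ^+ 2.

Let shift (s : bool) (v : 'I_M.+1) : 'I_M.+1 := if s then inord (minn v.+1 M) else inord v.-1.

(** Expanding the square gives equality for a full step of 1/M. At an end of the grid the step is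
    truncated, and there the sign of [b%:R - v%:R / M%:R] makes the linear term help. *)
Let shift_le (s : bool) (b : bool) (v : 'I_M.+1) :
  (b%:R - (shift s v)%:R / M%:R) ^+ 2 <=
  (b%:R - v%:R / M%:R) ^+ 2 - 2 * (-1) ^+ (~~ s) * (b%:R - v%:R / M%:R) / M%:R + M%:R ^- 2 :> R.
Proof.
have MR : 0 < M%:R :> R by rewrite ltr0n.
have M1 : M%:R != 0 :> R by rewrite gt_eqF.
have iM : 0 <= M%:R^-1 :> R by rewrite invr_ge0 ltW.
have b1 : 0 <= (b%:R : R) <= 1 by case: b; rewrite ?lexx ?ler01.
case/andP: b1 => b0 b1.
have vM : (v <= M)%N by rewrite -ltnS.
rewrite /shift; case: s => /=.
- rewrite inordK ?ltnS ?geq_minr //; have [vM'|vM'] := ltnP v M.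
    have -> : minn v.+1 M = v.+1 by apply/minn_idPl.
    rewrite -natr1 le_eqVlt; apply/orP; left; apply/eqP; field.
    by [].
  have -> : minn v.+1 M = M by apply/minn_idPr/ltnW.
  have -> : nat_of_ord v = M by apply/eqP; rewrite eqn_leq vM vM'.
  rewrite divff // -exprVn expr0 mulr1 -subr_ge0.
  set i := _^-1 in iM *.
  have -> : (b%:R - 1) ^+ 2 - 2 * (b%:R - 1) * i + i ^+ 2 - (b%:R - 1) ^+ 2 =
    2 * (1 - b%:R) * i + i ^+ 2 :> R by ring.
  by rewrite addr_ge0 ?sqr_ge0 // mulr_ge0 // mulr_ge0 // subr_ge0.
- rewrite inordK; last by rewrite ltnS (leq_trans (leq_pred _)).
  case: (nat_of_ord v) => [|k] /=.
    rewrite !mul0r subr0 -exprVn expr1.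
    set i := _^-1 in iM *.
    have -> : b%:R ^+ 2 - 2 * -1 * b%:R * i + i ^+ 2 = b%:R ^+ 2 + (2 * b%:R * i + i ^+ 2) :> R.
      by ring.
    by rewrite lerDl addr_ge0 ?sqr_ge0 // mulr_ge0 // mulr_ge0.
  rewrite -natr1 le_eqVlt; apply/orP; left; apply/eqP; field.
  by [].
Qed.

(** Refining by [A] and [B] allows [D] to be moved by 1/M exactly on the violated cut, in the
    direction of its deviation. This lowers the squared L^2(G) distance by at least 2 |cut_dev| / M
    - mass / M^2, and a violated cut has |cut_dev| > mass / M. *)
Let nrm_step (T : finType) (c : {ffun V -> T}) D : ~ cut_good c D ->
  exists (c' : {ffun V -> T * (bool * bool)}) D', nrm c' D' < nrm c D - mass / M%:R ^+ 2.
Proof.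
have MR : 0 < M%:R :> R by rewrite ltr0n.
move=> /existsNP[A /existsNP[B /negP]]; rewrite -ltNge => viol.
pose s := 0 <= cut_dev c D A B.
exists [ffun x => (c x, (x \in A, x \in B))].
exists [ffun ij => if ij.1.2.1 && ij.2.2.2 then shift s (D (ij.1.1, ij.2.1))
                   else D (ij.1.1, ij.2.1)].
apply: (@le_lt_trans _ _ (nrm c D - 2 * `|cut_dev c D A B| / M%:R + mass / M%:R ^+ 2)); last first.
  have : mass / M%:R < `|cut_dev c D A B| by [].
  rewrite -(ltr_pM2r (_ : 0 < 2 / M%:R)); last by rewrite divr_gt0.
  have -> : mass / M%:R * (2 / M%:R) = 2 * (mass / M%:R ^+ 2) by field; rewrite gt_eqF.
  have -> : `|cut_dev c D A B| * (2 / M%:R) = 2 * `|cut_dev c D A B| / M%:R.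
    by field; rewrite gt_eqF.
  by lra.
have -> : `|cut_dev c D A B| = (-1) ^+ (~~ s) * cut_dev c D A B.
  rewrite /s; case: (lerP 0 (cut_dev c D A B)) => h0 /=.
    by rewrite expr0 mul1r ger0_norm.
  by rewrite expr1 mulN1r ltr0_norm.
have -> : nrm c D - 2 * ((-1) ^+ (~~ s) * cut_dev c D A B) / M%:R + mass / M%:R ^+ 2 =
  \sum_x \sum_y (g x y)%:R * (step_dev c D x y ^+ 2
   - (if (x \in A) && (y \in B) then 2 * (-1) ^+ (~~ s) * step_dev c D x y / M%:R else 0)
   + M%:R ^- 2).
  rewrite /nrm /cut_dev !mulr_sumr !mulr_suml -sumrN.
  rewrite [X in _ + X + _]big_mkcond -!big_split /=; apply: eq_bigr => x _.
  case: (x \in A) => /=.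
    rewrite [\sum_(y in B) _]big_mkcond !mulr_sumr !mulr_suml -sumrN -!big_split /=; apply: eq_bigr => y _.
    by case: (y \in B); rewrite !mulrDr; ring.
  rewrite addr0 mulr_suml -big_split; apply: eq_bigr => y _ /=.
  by rewrite subr0 mulrDr.
apply: ler_sum => x _; apply: ler_sum => y _; apply: ler_wpM2l => //.
rewrite /step_dev !ffunE /=.
case: ((x \in A) && (y \in B)); first exact: shift_le.
by rewrite subr0 lerDl invr_ge0 exprn_ge0.
Qed.

(** The squared distance [nrm] is at most [mass] for [D = 0], never negative, and drops by more than
    mass / M^2 at each failed attempt. *)
Lemma weak_regularity :
  exists (c : {ffun V -> cell_type (M ^ 2)})
    (D : {ffun cell_type (M ^ 2) * cell_type (M ^ 2) -> 'I_M.+1}), cut_good c D.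
Proof.
have mass0 : 0 <= mass by apply: sumr_ge0 => x _; apply: sumr_ge0.
have nrm0 (T : finType) (c : {ffun V -> T}) D : 0 <= nrm c D.
  by apply: sumr_ge0 => x _; apply: sumr_ge0 => y _; rewrite mulr_ge0 ?sqr_ge0.
have MR : 0 < M%:R :> R by rewrite ltr0n.
have key t : (exists (c : {ffun V -> cell_type t}) D, cut_good c D) \/
   (exists (c : {ffun V -> cell_type t}) D, nrm c D <= mass * (1 - t%:R / M%:R ^+ 2)).
  elim: t => [|t [[c [D good]]|[c [D small]]]].
  - right; exists [ffun=> tt], [ffun=> ord0].
    rewrite mul0r subr0 mulr1 /nrm; apply: ler_sum => x _; apply: ler_sum => y _.
    rewrite /step_dev !ffunE /= mul0r subr0 -[leRHS]mulr1; apply: ler_wpM2l => //.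
    by case: (h x y); rewrite ?expr1n // expr0n /= ler01.
  (* A partition found early is padded by trivial refinements, so as to end in the type
     [cell_type (M ^ 2)]. *)
  - left; exists [ffun x => (c x, (false, false))], [ffun ij => D (ij.1.1, ij.2.1)] => A B.
    rewrite (_ : cut_dev _ _ A B = cut_dev c D A B); first exact: good.
    by apply: eq_bigr => x _; apply: eq_bigr => y _; rewrite /step_dev !ffunE.
  - case: (pselect (cut_good c D)) => [good|/nrm_step[c' [D' lt]]].
      left; exists [ffun x => (c x, (false, false))], [ffun ij => D (ij.1.1, ij.2.1)] => A B.
      rewrite (_ : cut_dev _ _ A B = cut_dev c D A B); first exact: good.
      by apply: eq_bigr => x _; apply: eq_bigr => y _; rewrite /step_dev !ffunE.
    right; exists c', D'; apply: le_trans (ltW lt) _.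
    have -> : mass * (1 - t.+1%:R / M%:R ^+ 2) =
              mass * (1 - t%:R / M%:R ^+ 2) - mass / M%:R ^+ 2.
      by rewrite -natr1; field; rewrite gt_eqF.
    by rewrite lerB.
have [//|[c [D]]] := key (M ^ 2)%N.
rewrite natrX divff ?subrr ?mulr0; last by rewrite expf_neq0 // gt_eqF.
move=> small; exists c, D; apply: contrapT => /nrm_step[c' [D' lt]].
have := nrm0 _ c' D'; rewrite leNgt => /negP; apply.
apply: lt_le_trans lt _; apply: (@le_trans _ _ 0) => //.
by rewrite subr_le0; apply: le_trans small _; rewrite divr_ge0 ?exprn_ge0.
Qed.

End WeakRegularity.

(** * Counting edges in quasirandom graphs *)

Definition nbr (V : finType) (E : {set {set V}}) (x : V) : {set V} :=
  [set y | [set x; y] \in E].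

(** An edge inside [U :&: B] is counted twice. *)
Definition ebt (V : finType) (E : {set {set V}}) (U B : {set V}) : nat :=
  \sum_(x in U) #|nbr E x :&: B|.

Section Quasirandom.
Variables (R : realType) (V : finType) (G : {set {set V}}) (p : R).
Local Notation n := (#|V|%:R : R).

Definition degree_bound : Prop := forall u, #|nbr G u|%:R <= 2 * p * n.

(** The term [C * n] pays for small [U]; it is dominated by the other one once
    [#|U| >= C / (eps * p)], hence the exceptional sets of that size below. *)
Definition discrepancy (eps C : R) : Prop := forall U B : {set V},
  `|(ebt G U B)%:R - p * #|U|%:R * #|B|%:R| <= eps * p * n * #|U|%:R + C * n.

(* The error is of smaller order than p #|U| #|D| as soon as #|D| is of order p n and #|U| is a  *)
(* large multiple of 1/p. *)
Definition local_discrepancy (eps C : R) : Prop := forall u (U D : {set V}),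
  U \subset nbr G u -> D \subset nbr G u ->
  `|(ebt G U D)%:R - p * #|U|%:R * #|D|%:R| <= eps * p ^+ 2 * n * #|U|%:R + C * p * n.

End Quasirandom.

Section GraphBasics.
Variables (R : realType) (V : finType).
Implicit Types (E G H : {set {set V}}) (U B D Y : {set V}).

Lemma in_nbr E x y : (y \in nbr E x) = ([set x; y] \in E).
Proof. by rewrite inE. Qed.

Lemma nbr_sym E x y : (y \in nbr E x) = (x \in nbr E y).
Proof. by rewrite !in_nbr finset.setUC. Qed.

Lemma nbrS H G x : H \subset G -> nbr H x \subset nbr G x.
Proof. by move=> HG; apply/fintype.subsetP => y; rewrite !in_nbr; exact: (fintype.subsetP HG). Qed.

Lemma ebt_sym E U B : ebt E U B = ebt E B U.
Proof.
have cE x C : #|nbr E x :&: C| = (\sum_(y in C) (y \in nbr E x))%N.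
  rewrite -sum1_card [RHS]big_mkcond [LHS]big_mkcond; apply: eq_bigr => y _.
  by rewrite inE; case: (y \in nbr E x); case: (y \in C).
rewrite /ebt; under eq_bigr do rewrite cE.
rewrite exchange_big; apply: eq_bigr => y _; rewrite cE.
by apply: eq_bigr => x _; rewrite nbr_sym.
Qed.

Lemma ebt_le H G U B : H \subset G -> (ebt H U B <= ebt G U B)%N.
Proof. by move=> HG; apply: leq_sum => x _; rewrite subset_leq_card // finset.setSI // nbrS. Qed.

Lemma sum_card_ge E U B (c : R) :
  (forall u, u \in U -> c <= #|nbr E u :&: B|%:R) -> c * #|U|%:R <= (ebt E U B)%:R.
Proof.
move=> h; rewrite /ebt natr_sum; apply: le_trans (ler_sum _ h).
by rewrite sumr_const mulr_natr.
Qed.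

Lemma triangle_double_count G H U Y : H \subset G -> triangle_free H ->
  (2 * \sum_(u in U) ebt G (nbr H u :&: U) (nbr H u :&: Y) <=
   \sum_(u in U) ebt G (nbr H u :&: U) (nbr G u :&: Y))%N.
Proof.
move=> HG tf.
pose r u v := [&& u \in U, v \in U & v \in nbr H u].
have rE (F : V -> V -> nat) : (\sum_(u in U) \sum_(v in nbr H u :&: U) F u v)%N =
    (\sum_u \sum_(v | r u v) F u v)%N.
  rewrite big_mkcond; apply: eq_bigr => u _; rewrite /r.
  case: ifPn => uU /=; last by rewrite big_pred0.
  by apply: eq_bigl => v; rewrite inE andbC.
rewrite /ebt !rE mul2n -addnn.
(* In one of the two copies of the sum the roles of [u] and [v] are exchanged. Then the disjoint
   sets N_H(u) and N_H(v) are both counted inside the common [G]-neighbours of [u] and [v] in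
   [Y]. *)
rewrite [X in (X + _)%N](exchange_big_dep predT) //=.
rewrite -big_split /=; apply: leq_sum => u _.
have -> : (\sum_(i | r i u) #|nbr G u :&: (nbr H i :&: Y)| =
           \sum_(i | r u i) #|nbr G u :&: (nbr H i :&: Y)|)%N.
  by apply: eq_bigl => v; rewrite /r nbr_sym andbCA.
rewrite -big_split /=; apply: leq_sum => v /and3P[_ _ vu].
rewrite -cardsUI [X in (_ + X)%N]eq_card0 ?addn0; last first.
  move=> w; rewrite !inE; apply/negP => /andP[/and3P[_ vw _] /and3P[_ uw _]].
  by apply: (tf u v w); split => //; rewrite -in_nbr.
apply/subset_leq_card/fintype.subsetP => w; rewrite !inE => /orP[] /and3P[wG wH ->].
    by rewrite wG andbT; move: wH => /(fintype.subsetP HG) ->.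
  by rewrite wG andbT; move: wH => /(fintype.subsetP HG) ->.
Qed.

(** Apply the discrepancy to the exceptional set [U] itself: half of the slack 2 eps p n per vertex
    absorbs the error linear in [#|U|], and the other half must stay below C n in total. *)
Lemma discrepancy_exceptional G (p eps C b : R) B :
  0 < p -> 0 < eps -> (0 < #|V|)%N -> discrepancy G p eps C ->
  p * #|B|%:R + 2 * eps * p * #|V|%:R <= b ->
  #|[set u | b < #|nbr G u :&: B|%:R]|%:R <= C / (eps * p).
Proof.
move=> p0 e0 V0 dis hb; set U := [set u | _].
have n0 : 0 < #|V|%:R :> R by rewrite ltr0n.
have h1 : b * #|U|%:R <= (ebt G U B)%:R.
  by apply: sum_card_ge => u; rewrite inE => /ltW.
have := dis U B; rewrite ler_norml => /andP[_]; rewrite lerBlDl => h2.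
have h3 : (p * #|B|%:R + 2 * eps * p * #|V|%:R) * #|U|%:R <= b * #|U|%:R.
  exact: ler_wpM2r.
have h4 := le_trans h3 (le_trans h1 h2).
have h5 : eps * p * #|V|%:R * #|U|%:R <= C * #|V|%:R by move: h4; lra.
rewrite ler_pdivlMr ?mulr_gt0 // -(ler_pM2r n0); move: h5; lra.
Qed.

(** With D(u) the neighbours of [u] in [U], local discrepancy gives at least about a p^2 n |D(u)|
    edges of [G] from D(u) to the [H]-neighbours of [u] in [Y], and at most about b p^2 n |D(u)| to
    its [G]-neighbours in [Y]. [triangle_double_count] compares the sums over [u], so a positive 2 a
    - b bounds the number of edges inside [U]. *)
Lemma few_edges_in_class G H (p a b eps eps1 C C1 : R) U Y :
  0 < p -> p <= 1 -> 0 < eps -> 0 <= C -> (0 < #|V|)%N ->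
  H \subset G -> triangle_free H ->
  degree_bound G p -> discrepancy G p eps C -> local_discrepancy G p eps1 C1 ->
  #|Y|%:R <= b * #|V|%:R ->
  (forall u, u \in U -> a * p * #|V|%:R <= #|nbr H u :&: Y|%:R) ->
  0 <= C1 ->
  (2 * a - b - 3 * eps1 - 2 * eps) * p * (ebt H U U)%:R <= (3 * C1 + 4 * C / eps) * #|V|%:R.
Proof.
move=> p0 p1 e0 C0 V0 HG tf deg dis loc Yb aU C10.
set n := #|V|%:R in Yb aU *.
have n0 : 0 < n by rewrite ltr0n.
have b0 : 0 <= b by rewrite -(pmulr_lge0 _ n0); apply: le_trans Yb.
pose D u := nbr H u :&: U; pose d u : R := #|D u|%:R.
have d0 u : 0 <= d u by [].
have DG u : D u \subset nbr G u.
  by apply: fintype.subset_trans (finset.subsetIl _ _) _; exact: nbrS.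
have dn u : d u <= 2 * p * n by apply: le_trans (deg u); rewrite ler_nat subset_leq_card.
(* Vertices with more [G]-neighbours in [Y] than expected get only the trivial bound 4 p^3 n^2.
   There are O(1/p) of them, so they contribute O(p^2 n^2), which is at most O(p n^2). *)
pose E := [set u | (b + 2 * eps) * p * n < #|nbr G u :&: Y|%:R].
have En : #|E|%:R <= C / (eps * p).
  apply: discrepancy_exceptional => //.
  have : p * #|Y|%:R <= p * (b * n) by rewrite ler_pM2l.
  rewrite -/n; lra.
have lower u : u \in U ->
    (a - eps1) * p ^+ 2 * n * d u - C1 * p * n <= (ebt G (D u) (nbr H u :&: Y))%:R.
  move=> uU; have := loc u (D u) (nbr H u :&: Y) (DG u).
  move=> /(_ (fintype.subset_trans (finset.subsetIl _ _) (nbrS u HG))).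
  rewrite ler_norml => /andP[+ _]; rewrite -/n -/(d u) lerBrDl.
  have : p * d u * (a * p * n) <= p * d u * #|nbr H u :&: Y|%:R.
    by apply: ler_wpM2l (aU _ uU); rewrite mulr_ge0 // ltW.
  move: (d u) => x; move: (#|_|%:R) => y; move: (_%:R) => z h1 h2; lra.
have upper u : u \in U -> (ebt G (D u) (nbr G u :&: Y))%:R <=
    (b + 2 * eps + eps1) * p ^+ 2 * n * d u + C1 * p * n +
    (if u \in E then 4 * p ^+ 3 * n ^+ 2 else 0).
  move=> uU; have := loc u (D u) (nbr G u :&: Y) (DG u) (finset.subsetIl _ _).
  rewrite ler_norml => /andP[_]; rewrite -/n -/(d u) lerBlDl.
  have : p * d u * #|nbr G u :&: Y|%:R <=
     (b + 2 * eps) * p ^+ 2 * n * d u + (if u \in E then 4 * p ^+ 3 * n ^+ 2 else 0).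
    rewrite inE; case: ltP => h.
      apply: (@le_trans _ _ (p * (2 * p * n) * (2 * p * n))).
        apply: ler_pM => //; first by rewrite mulr_ge0 // ltW.
          by rewrite ler_pM2l.
        by apply: le_trans (deg u); rewrite ler_nat subset_leq_card // finset.subsetIl.
      have : 0 <= (b + 2 * eps) * p ^+ 2 * n * d u.
        by rewrite !mulr_ge0 ?sqr_ge0 // ?addr_ge0 ?mulr_ge0 // ltW.
      lra.
    have : p * d u * #|nbr G u :&: Y|%:R <= p * d u * ((b + 2 * eps) * p * n).
      by apply: ler_wpM2l h; rewrite mulr_ge0 // ltW.
    lra.
  lra.
pose S : R := \sum_(u in U) d u.
have SE : (ebt H U U)%:R = S by rewrite /S natr_sum.
have Un : #|U|%:R <= n by rewrite ler_nat max_card.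
have L : (a - eps1) * p ^+ 2 * n * S - C1 * p * n * #|U|%:R <=
    (\sum_(u in U) ebt G (D u) (nbr H u :&: Y))%:R.
  rewrite natr_sum; apply: le_trans (ler_sum _ lower).
  by rewrite sumrB -mulr_sumr sumr_const mulr_natr.
have Up : (\sum_(u in U) ebt G (D u) (nbr G u :&: Y))%:R <=
   (b + 2 * eps + eps1) * p ^+ 2 * n * S + C1 * p * n * #|U|%:R +
   4 * p ^+ 3 * n ^+ 2 * #|E|%:R.
  rewrite natr_sum; apply: le_trans (ler_sum _ upper) _.
  rewrite !big_split /= -mulr_sumr sumr_const -[C1 * p * n *+ _]mulr_natr lerD2l.
  rewrite -big_mkcondr /=.
  rewrite sumr_const -[leLHS]mulr_natr; apply: ler_wpM2l.
    by rewrite !mulr_ge0 ?exprn_ge0 // ltW.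
  by rewrite ler_nat subset_leq_card //; apply/fintype.subsetP => u /andP[].
have tri : 2 * (\sum_(u in U) ebt G (D u) (nbr H u :&: Y))%:R <=
           (\sum_(u in U) ebt G (D u) (nbr G u :&: Y))%:R :> R.
  by rewrite -natrM ler_nat; exact: triangle_double_count.
have E4 : 4 * p ^+ 3 * n ^+ 2 * #|E|%:R <= 4 * C / eps * p * n ^+ 2.
  apply: (@le_trans _ _ (4 * p ^+ 3 * n ^+ 2 * (C / (eps * p)))).
    by apply: ler_wpM2l En; rewrite !mulr_ge0 ?exprn_ge0 // ltW.
  have -> : 4 * p ^+ 3 * n ^+ 2 * (C / (eps * p)) = p * (4 * C / eps * p * n ^+ 2).
    by field; rewrite !gt_eqF.
  by rewrite ler_piMl // !mulr_ge0 ?invr_ge0 ?exprn_ge0 // ltW.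
have C1U : C1 * p * n * #|U|%:R <= C1 * p * n * n.
  by apply: ler_wpM2l Un; rewrite !mulr_ge0 // ltW.
have pn0 : 0 < p * n by rewrite mulr_gt0.
rewrite SE -(ler_pM2l pn0).
have -> : p * n * ((3 * C1 + 4 * C / eps) * n) =
   3 * (C1 * p * n * n) + 4 * C / eps * p * n ^+ 2 by ring.
have -> : p * n * ((2 * a - b - 3 * eps1 - 2 * eps) * p * S) =
  2 * ((a - eps1) * p ^+ 2 * n * S) - (b + 2 * eps + eps1) * p ^+ 2 * n * S by ring.
lra.
Qed.

End GraphBasics.

(** * Neighbourhoods seen through a small sample *)

Lemma grid_itv (R : realType) (M : nat) (v : 'I_M.+1) : 0 <= (v%:R / M%:R : R) <= 1.
Proof.
case: M v => [|M] v; first by rewrite invr0 mulr0 lexx ler01.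
by rewrite divr_ge0 //= ler_pdivrMr ?ltr0n // mul1r ler_nat -ltnS.
Qed.

Section Fingerprints.
Variables (R : realType) (V K : finType) (M m : nat) (p : R).
Local Notation n := (#|V|%:R : R).
Implicit Types (E G H J : {set {set V}}) (A B W X Y Z : {set V}).
Implicit Types (t : {ffun 'I_m -> V}) (c : {ffun V -> K}) (D : {ffun K * K -> 'I_M.+1}).

Definition missed E t Z u : {set V} :=
  [set w in Z | [forall i, t i \notin nbr E u :&: nbr E w]].

(** [p * cell_sum c D A x] is the number of neighbours in [A] that the weights predict for [x]. *)
Definition cell_sum c D A x : R := \sum_(w in A) (D (c x, c w))%:R / M%:R.

(** The second sample estimates the degree of [x] into the missed set: the predicted number of hits
    is p m times [cell_sum] over n, and [x] is deficient when the count falls short by e p m. Only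
    edges at sampled vertices enter, so this can serve as [Q] in [concentrated]. *)
Definition deficient E t t' Z c D (e : R) u : {set V} :=
  [set x | #|[set i | t' i \in missed E t Z u :&: nbr E x]|%:R
             <= (cell_sum c D (missed E t Z u) x / n - e) * (p * m%:R)].

Definition sampled t t' : {set V} := [set t i | i : 'I_m] :|: [set t' i | i : 'I_m].

(* [Q J u] depends only on the edges [J] of the subgraph that meet the small set [W]; these   *)
(* carry so little information that a union bound over [J] is affordable.                     *)
Definition concentrated G W (Q : {set {set V}} -> V -> {set V}) (theta : R) (N : nat) : Prop :=
  forall J X, J \subset G -> (forall e, e \in J -> ~~ [disjoint e & W]) -> [disjoint X & W] ->
    (forall u, u \in X -> #|Q J u|%:R <= theta / 2 * n /\
        theta * p * n <= #|nbr G u :&: (Q J u :\: W)|%:R) ->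
    (#|X| < N)%N.

Definition touching E W : {set {set V}} := [set e in E | ~~ [disjoint e & W]].

Lemma nbr_touching E W x y : y \in W -> (y \in nbr (touching E W) x) = (y \in nbr E x).
Proof.
move=> yW; rewrite !in_nbr inE andb_idr // => _.
by rewrite disjoint_sym disjoints_subset; apply/fintype.subsetPn; exists y; rewrite ?inE ?eqxx ?orbT.
Qed.

Lemma missed_touching E t t' Z u : missed (touching E (sampled t t')) t Z u = missed E t Z u.
Proof.
apply/setP => w; rewrite /missed !in_set; congr (_ && _); apply: eq_forallb => i.
have ti : t i \in sampled t t' by rewrite inE imset_f.
by rewrite !in_setI !nbr_touching.
Qed.

Lemma deficient_touching E t t' Z c D e u :
  deficient (touching E (sampled t t')) t t' Z c D e u = deficient E t t' Z c D e u.
Proof.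
apply/setP => x; rewrite /deficient [LHS]in_set [RHS]in_set missed_touching; congr (_%:R <= _).
apply: eq_card => i; rewrite [LHS]in_set [RHS]in_set !in_setI; congr (_ && _).
have ti : t' i \in sampled t t' by rewrite !inE orbC imset_f.
by rewrite nbr_touching.
Qed.

Lemma card_sampled t t' : (#|sampled t t'| <= m + m)%N.
Proof.
apply: leq_trans (leq_card_setU _ _) _.
by apply: leq_add; apply: leq_trans (leq_imset_card _ _) _; rewrite card_ord.
Qed.

End Fingerprints.

Lemma card_set_sum (R : pzSemiRingType) (T : finType) (P : pred T) :
  #|[set x | P x]|%:R = \sum_x (P x)%:R :> R.
Proof.
rewrite -sum1_card natr_sum big_mkcond; apply: eq_bigr => x _.
by rewrite inE; case: (P x).
Qed.

Section SampleChoice.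
Variables (R : realType) (V : finType) (H : {set {set V}}) (m : nat) (p : R).
Hypothesis V0 : (0 < #|V|)%N.
Local Notation n := (#|V|%:R : R).

Let n0 : 0 < n. Proof. by rewrite ltr0n. Qed.

Let card_samples : #|{: {ffun 'I_m -> V}}|%:R = n ^+ m :> R.
Proof. by rewrite card_ffun card_ord natrX. Qed.

Let samples_gt0 : (0 < #|{: {ffun 'I_m -> V}}|)%N.
Proof. by rewrite card_ffun expn_gt0 V0. Qed.

Definition unhit (s : R) (t : {ffun 'I_m -> V}) u : {set V} :=
  [set w in [set w | s <= #|nbr H u :&: nbr H w|%:R] |
     [forall i, t i \notin nbr H u :&: nbr H w]].

(** For fixed [u], a vertex of high codegree with [u] is unhit with probability at most eta / 4, so
    by Markov there are more than eta n unhit vertices with probability at most 1/4. *)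
Lemma first_sample (X : {set V}) (s eta : R) :
  0 < eta -> expR (- (m%:R * s / n)) <= eta / 4 ->
  exists t : {ffun 'I_m -> V}, #|[set u in X | eta * n < #|unhit s t u|%:R]|%:R <= 4^-1 * #|X|%:R :> R.
Proof.
move=> eta0 hexp; apply: exists_few_bad => // u _.
have en : 0 < eta * n by rewrite mulr_gt0.
have := @markov_count R _ (fun t => #|unhit s t u|%:R) (eta * n) (fun _ => ler0n _ _).
have := @count_miss R V m [set w | s <= #|nbr H u :&: nbr H w|%:R]
   (fun w => nbr H u :&: nbr H w) s.
rewrite -/(unhit s _ u) => h1 h2.
have {}h1 : \sum_t #|unhit s t u|%:R <= n ^+ m.+1 * expR (- (m%:R * s / n)).
  by apply: h1 => w; rewrite inE.
rewrite -(ler_pM2l en) card_samples; apply: le_trans h2 (le_trans h1 _).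
have -> : eta * n * (4^-1 * n ^+ m) = n ^+ m.+1 * (eta / 4) by rewrite exprS; ring.
by apply: ler_wpM2l hexp; rewrite exprn_ge0 // ltW.
Qed.

(** Two failures of probability at most 1/4 each: Markov bounds the sampled codegrees by four times
    their mean, and the lower tail, with Markov over [x], bounds the number of vertices hit far less
    often than expected. *)
Lemma second_sample (X : {set V}) (A : V -> {set V}) (av : V -> R) (d rho : R) :
  0 < p -> 0 < d -> d <= 1 -> 0 < rho -> (0 < m)%N -> degree_bound H p ->
  (forall u, u \in X -> 0 < av u) ->
  (forall u, u \in X -> \sum_(w in A u) #|nbr H u :&: nbr H w|%:R <= n * av u) ->
  expR (- (d ^+ 2 / 8 * (p * m%:R))) <= rho / 4 ->
  exists t : {ffun 'I_m -> V}, #|[set u in X |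
     (4 * m%:R * av u < \sum_i (if t i \in A u then #|nbr H u :&: nbr H (t i)|%:R else 0)) ||
     (rho * n < #|[set x | (#|[set i | t i \in A u :&: nbr H x]|%:R : R) <
                  m%:R * #|A u :&: nbr H x|%:R / n - d * (p * m%:R)]|%:R)]|%:R
    <= 2^-1 * #|X|%:R :> R.
Proof.
move=> p0 d0 d1 rho0 m0 deg av0 avX hexp; apply: exists_few_bad => // u uX.
pose f (t : {ffun 'I_m -> V}) : R :=
  \sum_i (if t i \in A u then #|nbr H u :&: nbr H (t i)|%:R else 0).
pose g (t : {ffun 'I_m -> V}) := #|[set x | (#|[set i | t i \in A u :&: nbr H x]|%:R : R) <
  m%:R * #|A u :&: nbr H x|%:R / n - d * (p * m%:R)]|.
have mR : 0 < m%:R :> R by rewrite ltr0n.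
have b1 : #|[set t | 4 * m%:R * av u < f t]|%:R <= 4^-1 * n ^+ m.
  have c0 : 0 < 4 * m%:R * av u by rewrite !mulr_gt0 // av0.
  have f0 t : 0 <= f t by apply: sumr_ge0 => i _; case: ifP.
  rewrite -(ler_pM2l c0); apply: le_trans (markov_count _ f0) _.
  rewrite -(ler_pM2l n0).
  rewrite (sum_ffun_sum m (fun v => if v \in A u then #|nbr H u :&: nbr H v|%:R else 0)).
  rewrite -big_mkcond /=.
  apply: (@le_trans _ _ (m%:R * n ^+ m * (n * av u))).
    by apply: ler_wpM2l; [rewrite mulr_ge0 ?exprn_ge0 // ltW | exact: avX].
  by rewrite le_eqVlt; apply/orP; left; apply/eqP; field.
have b2 : #|[set t | rho * n < (g t)%:R]|%:R <= 4^-1 * n ^+ m.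
  have c0 : 0 < rho * n by rewrite mulr_gt0.
  rewrite -(ler_pM2l c0); apply: le_trans (markov_count _ (fun _ => ler0n _ _)) _.
  apply: (@le_trans _ _ (\sum_(x : V) n ^+ m * (rho / 4))); last first.
    rewrite sumr_const -[leLHS]mulr_natr le_eqVlt; apply/orP; left; apply/eqP.
    by rewrite cardE; field.
  under eq_bigr => t _ do rewrite /g card_set_sum.
  rewrite exchange_big /=; apply: ler_sum => x _.
  apply: (@le_trans _ _ (n ^+ m * expR (- (d ^+ 2 / 8 * (p * m%:R))))); last first.
    by apply: ler_wpM2l hexp; rewrite exprn_ge0 // ltW.
  rewrite -card_set_sum; apply: count_lower_tail => //; first exact: ltW.
  by apply: le_trans (deg x); rewrite ler_nat subset_leq_card // finset.subsetIr.
rewrite card_samples.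
apply: (@le_trans _ _ (4^-1 * n ^+ m + 4^-1 * n ^+ m)); last by lra.
apply: le_trans (lerD b1 b2); rewrite -natrD ler_nat.
apply: leq_trans (leq_card_setU _ _); apply/subset_leq_card/fintype.subsetP => t.
by rewrite !inE.
Qed.

End SampleChoice.

Section Irregular.
Variables (R : realType) (V K : finType) (M m N : nat) (G H : {set {set V}}).
Variables (c : {ffun V -> K}) (D : {ffun K * K -> 'I_M.+1}).
Variables (p eps C kap tau g e eta : R) (Z : {set V}).
Local Notation n := (#|V|%:R : R).

(* For typical u in X, the set [missed H t Z u] contains N_H(u) :&: Z by triangle-freeness, so it *)
(* cannot be small; as it has few edges to N_H(u), the vertices of N_H(u) send it fewer edges than *)
(* [D] predicts.  The second sample [t'] detects these vertices, of which [cut] allows only few.   *)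
Lemma few_irregular (X : {set V}) :
  (0 < #|V|)%N -> (0 < m)%N -> 0 < p -> p <= 1 -> 0 < eps -> 0 <= C -> 0 < tau -> 0 < g ->
  e = tau * g / 32 -> e <= 1 -> e <= g / 2 ->
  H \subset G -> triangle_free H -> degree_bound G p -> discrepancy G p eps C ->
  (forall A B : {set V},
     `|(ebt H A B)%:R - p * \sum_(x in A) cell_sum R c D B x| <= kap * p * n ^+ 2) ->
  (forall u w, u \in X -> w \in Z ->
     tau * p * n <= \sum_(x in nbr H u) (D (c x, c w))%:R / M%:R) ->
  (forall u, u \in X -> g * p * n <= #|nbr H u :&: Z|%:R) ->
  (forall t t' : {ffun 'I_m -> V}, concentrated p G (sampled t t')
     (fun J u => missed J t Z u) (g / 2) N) ->
  (forall t t' : {ffun 'I_m -> V}, concentrated p G (sampled t t')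
     (fun J u => deficient p J t t' Z c D e u) e N) ->
  0 < eta -> 8 * eta + 12 * eps <= 2 * e -> kap <= e ^+ 2 / 16 ->
  expR (- (tau / 16 * (p ^+ 2 * m%:R))) <= eta / 4 ->
  expR (- (e ^+ 2 / 32 * (p * m%:R))) <= e / 32 ->
  C <= eps * p ^+ 2 * n -> 2 * m%:R + 2 * eps * n <= e * n ->
  #|X|%:R <= 3 * (2 * N%:R + 2 * m%:R + C / (eps * p)).
Proof.
move=> V0 m0 p0 p1 eps0 C0 tau0 g0 eE e1 eg HG tf degG dis cut Xtau XZ conc1 conc2.
move=> eta0 he hkap exp1 exp2 hC hm.
have n0 : 0 < n by rewrite ltr0n.
have mR : 0 < m%:R :> R by rewrite ltr0n.
have e0 : 0 < e by rewrite eE !mulr_gt0.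
have pn0 : 0 < p * n by rewrite mulr_gt0.
have degH : degree_bound H p.
  by move=> u; apply: le_trans (degG u); rewrite ler_nat subset_leq_card // nbrS.
(* Codegrees below [s] are negligible: even after the factor 4 lost by Markov they reach only a
   quarter of the tau p^2 n that [Xtau] predicts. *)
pose s := tau / 16 * p ^+ 2 * n.
have s0 : 0 <= s by rewrite /s !mulr_ge0 ?exprn_ge0 // ltW.
have [t Ht] : exists t : {ffun 'I_m -> V}, #|[set u in X | eta * n < #|unhit H s t u|%:R]|%:R <= 4^-1 * #|X|%:R :> R.
  apply: (@first_sample R V H m) => //.
  have -> : m%:R * s / n = tau / 16 * (p ^+ 2 * m%:R) by rewrite /s; field; rewrite gt_eqF.
  by [].
pose X1 := [set u in X | #|unhit H s t u|%:R <= eta * n].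
have X1X u : u \in X1 -> u \in X by rewrite inE => /andP[].
have cX1 : 3 / 4 * #|X|%:R <= #|X1|%:R :> R.
  have : #|X|%:R <= #|[set u in X | eta * n < #|unhit H s t u|%:R]|%:R + #|X1|%:R :> R.
    rewrite -natrD ler_nat; apply: leq_trans (leq_card_setU _ _).
    apply/subset_leq_card/fintype.subsetP => u uX; rewrite !in_set uX /=.
    by case: ltP.
  by move: Ht; goal_lra.
pose A u := missed H t Z u.
(* Bounds 1/n times the number of edges of [H] between the missed set and N_H(u). Missed vertices of
   codegree at least [s] are unhit, so there are at most eta n of them, and discrepancy controls
   their edges to N_H(u). *)
pose av u : R := s * #|A u|%:R / n + 2 * p ^+ 2 * n * (eta + eps) + C.
have codegE u : u \in X1 ->
    \sum_(w in A u) #|nbr H u :&: nbr H w|%:R <= n * av u.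
  rewrite inE => /andP[uX ub].
  have degu : #|nbr H u|%:R <= 2 * p * n := degH u.
  have h1 : \sum_(w in A u) #|nbr H u :&: nbr H w|%:R <=
     s * #|A u|%:R + (ebt H (unhit H s t u) (nbr H u))%:R.
    rewrite (bigID (mem (unhit H s t u))) /= addrC; apply: lerD.
      apply: (@le_trans _ _ (\sum_(w in A u) s)); last by rewrite sumr_const mulr_natr.
      rewrite [leRHS](bigID (mem (unhit H s t u))) /= addrC -[leLHS]addr0.
      apply: lerD; last by apply: sumr_ge0.
      apply: ler_sum => w /andP[]; rewrite /A /missed /unhit !in_set => /andP[_ ->].
      by rewrite andbT -ltNge => /ltW.
    rewrite /ebt natr_sum [leRHS](bigID (mem (A u))) /= -[leLHS]addr0.
    apply: lerD; last by apply: sumr_ge0.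
    by under eq_bigl do rewrite andbC; apply: ler_sum => w _; rewrite finset.setIC.
  have h2 : (ebt H (unhit H s t u) (nbr H u))%:R <=
     p * #|nbr H u|%:R * #|unhit H s t u|%:R + (eps * p * n * #|nbr H u|%:R + C * n).
    apply: (@le_trans _ _ (ebt G (nbr H u) (unhit H s t u))%:R).
      by rewrite ler_nat ebt_sym ebt_le.
    by have := dis (nbr H u) (unhit H s t u); rewrite ler_norml => /andP[_]; rewrite lerBlDl.
  have h3 : p * #|nbr H u|%:R * #|unhit H s t u|%:R <= p * (2 * p * n) * (eta * n).
    by apply: ler_pM => //; rewrite ?mulr_ge0 ?ler_pM2l // ltW.
  have h4 : eps * p * n * #|nbr H u|%:R <= eps * p * n * (2 * p * n).
    by apply: ler_wpM2l degu; rewrite !mulr_ge0 // ltW.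
  apply: le_trans h1 _.
  have -> : n * av u = s * #|A u|%:R + p * (2 * p * n) * (eta * n) +
      eps * p * n * (2 * p * n) + C * n by rewrite /av; field; rewrite gt_eqF.
  move: h2 h3 h4; goal_lra.
have av0 u : u \in X1 -> 0 < av u.
  move=> _; apply: ltr_wpDr => //; apply: ltr_wpDl.
    by rewrite divr_ge0 // mulr_ge0.
  by rewrite !mulr_gt0 ?exprn_gt0 // addr_gt0.
pose Bad t' x u : bool := (#|[set i : 'I_m | t' i \in A u :&: nbr H x]|%:R : R) <
   m%:R * #|A u :&: nbr H x|%:R / n - e / 2 * (p * m%:R).
have [t' Ht'] : exists t' : {ffun 'I_m -> V}, #|[set u in X1 |
   (4 * m%:R * av u < \sum_i (if t' i \in A u then #|nbr H u :&: nbr H (t' i)|%:R else 0)) ||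
   (e / 8 * n < #|[set x | Bad t' x u]|%:R)]|%:R <= 2^-1 * #|X1|%:R :> R.
  apply: (second_sample V0 p0 _ _ _ m0 degH av0 codegE); rewrite ?divr_gt0 //; first by move: e1; goal_lra.
  have -> : (e / 2) ^+ 2 / 8 = e ^+ 2 / 32 by field.
  by have -> : e / 8 / 4 = e / 32 by field.
pose X2 := [set u in X1 |
   (\sum_i (if t' i \in A u then #|nbr H u :&: nbr H (t' i)|%:R else 0) <= 4 * m%:R * av u) &&
   (#|[set x | Bad t' x u]|%:R <= e / 8 * n)].
have cX2 : 2^-1 * #|X1|%:R <= #|X2|%:R :> R.
  have : (#|X1| <= #|[set u in X1 |
   ((4 * m%:R * av u < \sum_i (if t' i \in A u then #|nbr H u :&: nbr H (t' i)|%:R else 0)) ||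
   (e / 8 * n < #|[set x | Bad t' x u]|%:R))%R]| + #|X2|)%N.
    apply: leq_trans (leq_card_setU _ _).
    apply/subset_leq_card/fintype.subsetP => u uX; rewrite finset.in_setU !in_set.
    rewrite in_set in uX; rewrite uX /=.
    by case: ltP => //= h; case: ltP.
  rewrite -(ler_nat R) natrD; move: Ht'; goal_lra.
pose W := sampled t t'.
pose F := touching H W.
have FG : F \subset G.
  by apply: fintype.subset_trans HG; apply/fintype.subsetP => f; rewrite inE => /andP[].
have FW f : f \in F -> ~~ [disjoint f & W] by rewrite inE => /andP[].
(* [concentrated] speaks of neighbours outside [W], so the few vertices with many neighbours in the
   sample are set aside. *)
pose Ex := [set u | e * p * n < #|nbr G u :&: W|%:R].
have cEx : #|Ex|%:R <= C / (eps * p).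
  apply: discrepancy_exceptional => //.
  have : #|W|%:R <= 2 * m%:R :> R by rewrite -natrM ler_nat mul2n -addnn card_sampled.
  rewrite -(ler_pM2l p0) => h1; move: hm; rewrite -(ler_pM2l p0) => h2; move: h1 h2; goal_lra.
pose X3 := (X2 :\: W) :\: Ex.
have cX3 : #|X2|%:R <= #|X3|%:R + 2 * m%:R + C / (eps * p).
  have h1 : (#|X2| <= #|X3| + #|W| + #|Ex|)%N.
    rewrite /X3 -(cardsID W X2) -(cardsID Ex (X2 :\: W)).
    rewrite -[leqRHS]addnA [leqRHS]addnC -[leqRHS]addnA.
    by rewrite !leq_add ?subset_leq_card ?finset.subsetIr.
  have h2 : (#|W| <= m + m)%N by exact: card_sampled.
  move: h1 h2 cEx; rewrite -!(ler_nat R) !natrD; goal_lra.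
(* Either the missed set is small and holds too many neighbours of [u] ([XA]), or it is large, and
   then the deficient set plays this role ([XB]). *)
pose XA := [set u in X3 | #|A u|%:R <= g / 2 / 2 * n].
pose XB := [set u in X3 | #|deficient p H t t' Z c D e u|%:R <= e / 2 * n].
have nA u : u \in X3 -> g * p * n <= #|nbr G u :&: A u|%:R.
  rewrite !in_setD => /andP[_ /andP[_]]; rewrite in_set => /andP[uX1 _].
  apply: le_trans (XZ u (X1X u uX1)) _; rewrite ler_nat subset_leq_card //.
  apply/fintype.subsetP => w /finset.setIP[uw wZ].
  rewrite finset.inE (fintype.subsetP (nbrS u HG)) // /A /missed in_set wZ /=.
  apply/forallP => i; apply/negP => /finset.setIP[]; rewrite in_nbr => h1.
  rewrite nbr_sym in_nbr => h2; rewrite in_nbr in uw.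
  by apply: (tf u (t i) w).
have minusW u (Q : {set V}) (b : R) : u \in X3 -> b <= #|nbr G u :&: Q|%:R ->
    b - e * p * n <= #|nbr G u :&: (Q :\: W)|%:R.
  rewrite in_setD in_set -leNgt => /andP[h1 _] h2.
  have : (#|nbr G u :&: Q| <= #|nbr G u :&: (Q :\: W)| + #|nbr G u :&: W|)%N.
    apply: leq_trans (leq_card_setU _ _); apply/subset_leq_card/fintype.subsetP => w.
    rewrite finset.in_setU !finset.in_setI finset.in_setD.
    by case: (w \in W); case: (w \in Q); rewrite ?andbF ?andbT ?orbF ?orbT.
  rewrite -(ler_nat R) natrD; move: h1 h2; goal_lra.
have X3W (Y : {set V}) : Y \subset X3 -> [disjoint Y & W].
  move=> YX; rewrite disjoint_sym disjoints_subset; apply/fintype.subsetP => w wW.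
  rewrite finset.inE; apply/negP => /(fintype.subsetP YX).
  by rewrite !in_setD wW /= andbF.
have cXA : (#|XA| < N)%N.
  apply: (conc1 t t' F) => //; first by apply: X3W; apply/fintype.subsetP => u /setIdP[].
  move=> u; rewrite in_set => /andP[uX3 Au]; rewrite missed_touching; split => //.
  apply: le_trans (minusW u (A u) _ uX3 (nA u uX3)).
  have : e * (p * n) <= g / 2 * (p * n) by rewrite ler_pM2r.
  by goal_lra.
have XB3 u : u \in X3 -> u \notin XA -> u \in XB /\
    2 * e * p * n <= #|nbr G u :&: deficient p H t t' Z c D e u|%:R.
  move=> uX3; rewrite [u \in XA]in_set uX3 /= -ltNge => Au.
  have := uX3; rewrite !in_setD => /andP[_ /andP[_]]; rewrite in_set => /and3P[uX1 hF hBad].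
  have uX := X1X u uX1.
  set Q := deficient _ _ _ _ _ _ _ _ _.
  pose psi x := cell_sum R c D (A u) x / n.
  pose ph2 x : R := #|[set i : 'I_m | t' i \in A u :&: nbr H x]|%:R.
  have pm0 : 0 < p * m%:R by rewrite mulr_gt0.
  have psi1 x : psi x <= 1.
    rewrite /psi /cell_sum ler_pdivrMr // mul1r.
    apply: (@le_trans _ _ (\sum_(w in A u) 1)).
      by apply: ler_sum => w _; have /andP[] := grid_itv R (D (c x, c w)).
    by rewrite sumr_const ler_nat max_card.
  have inQ x : (x \in Q) = (ph2 x <= (psi x - e) * (p * m%:R)) by rewrite in_set.
  have sum_psi : tau * p * #|A u|%:R <= \sum_(x in nbr H u) psi x.
    rewrite /psi /cell_sum -mulr_suml exchange_big /= ler_pdivlMr //.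
    apply: (@le_trans _ _ (\sum_(w in A u) (tau * p * n))).
      by rewrite sumr_const -[leRHS]mulr_natr; goal_lra.
    by apply: ler_sum => w; rewrite /A /missed in_set => /andP[wZ _]; exact: Xtau.
  have sum_ph2 : \sum_(x in nbr H u) ph2 x <= 4 * m%:R * av u.
    apply: le_trans hF; rewrite le_eqVlt; apply/orP; left; apply/eqP.
    rewrite /ph2; under eq_bigr do rewrite card_set_sum.
    rewrite exchange_big; apply: eq_bigr => i _ /=.
    case: ifPn => ti; last by rewrite big1 // => x _; rewrite finset.inE (negbTE ti).
    rewrite -sum1_card natr_sum [LHS]big_mkcond [RHS]big_mkcond; apply: eq_bigr => x _.
    rewrite !finset.in_setI ti [t' i \in nbr H x]nbr_sym /=.
    by case: (x \in nbr H u); case: (x \in nbr H (t' i)).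
  have bound x : x \in nbr H u -> psi x * (p * m%:R) - ph2 x <=
      e * (p * m%:R) + (if x \in Q then p * m%:R else 0).
    move=> _; rewrite inQ; case: ifPn => [_|].
      have : psi x * (p * m%:R) <= 1 * (p * m%:R) by rewrite ler_pM2r.
      have : 0 <= ph2 x by [].
      have : 0 <= e * (p * m%:R) by rewrite mulr_ge0 // ltW.
      by goal_lra.
    by rewrite -ltNge; goal_lra.
  (* Over N_H(u) the predicted hits far exceed the actual ones. A vertex outside [Q] accounts for at
     most e p m of this excess and one in [Q] for at most p m, so many neighbours must lie in
     [Q]. *)
  have tot : tau * p * #|A u|%:R * (p * m%:R) - 4 * m%:R * av u <=
      e * (p * m%:R) * (2 * p * n) + p * m%:R * #|nbr G u :&: Q|%:R.
    apply: (@le_trans _ _ (\sum_(x in nbr H u) (psi x * (p * m%:R) - ph2 x))).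
      rewrite sumrB -mulr_suml; apply: lerB => //.
      by rewrite ler_pM2r.
    apply: le_trans (ler_sum _ bound) _; rewrite big_split /=; apply: lerD.
      rewrite sumr_const -[leLHS]mulr_natr; apply: ler_wpM2l; last exact: degH.
      by rewrite mulr_ge0 // ltW.
    rewrite -big_mkcondr /= sumr_const -[leLHS]mulr_natr; apply: ler_wpM2l; first exact: ltW.
    rewrite ler_nat subset_leq_card //; apply/fintype.subsetP => x /andP[xu xQ].
    by rewrite finset.inE xQ (fintype.subsetP (nbrS u HG)).
  have {}tot : 2 * e * p * n <= #|nbr G u :&: Q|%:R.
    have avE : 4 * m%:R * av u = m%:R * (tau / 4 * (p ^+ 2 * #|A u|%:R) +
        8 * (p ^+ 2 * n) * (eta + eps) + 4 * C) by rewrite /av /s; field; rewrite gt_eqF.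
    have C4 : 4 * C <= 4 * eps * (p ^+ 2 * n) by move: hC; goal_lra.
    have ppn0 : 0 < p ^+ 2 * n by rewrite mulr_gt0 ?exprn_gt0.
    have hA : 3 * tau / 4 * p ^+ 2 * (g / 4 * n) <= 3 * tau / 4 * p ^+ 2 * #|A u|%:R.
      apply: ler_wpM2l; first by rewrite !mulr_ge0 ?exprn_ge0 // ltW.
      by apply: ltW; move: Au; goal_lra.
    have hE : (8 * eta + 12 * eps) * (p ^+ 2 * n) <= 2 * e * (p ^+ 2 * n) by rewrite ler_pM2r.
    rewrite -(ler_pM2l pm0).
    apply: le_trans (_ : tau * p * #|A u|%:R * (p * m%:R) - 4 * m%:R * av u -
      e * (p * m%:R) * (2 * p * n) <= _); last by move: tot; goal_lra.
    rewrite avE.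
    have -> : tau * p * #|A u|%:R * (p * m%:R) - m%:R * (tau / 4 * (p ^+ 2 * #|A u|%:R) +
        8 * (p ^+ 2 * n) * (eta + eps) + 4 * C) - e * (p * m%:R) * (2 * p * n) =
      m%:R * (3 * tau / 4 * p ^+ 2 * #|A u|%:R - 8 * (p ^+ 2 * n) * (eta + eps) - 4 * C
        - 2 * e * (p ^+ 2 * n)) by field.
    have -> : p * m%:R * (2 * e * p * n) = m%:R * (2 * e * (p ^+ 2 * n)) by ring.
    apply: ler_wpM2l => //.
    (* This is why [e = tau * g / 32]: the main term is 6 e p^2 n, the error terms take 2 e and 2 e,
       and 2 e is left. *)
    have hg : 3 * tau / 4 * p ^+ 2 * (g / 4 * n) = 6 * e * (p ^+ 2 * n).
      by rewrite eE; field.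
    move: hA hE C4; rewrite hg; goal_lra.
  split => //; rewrite [u \in XB]in_set uX3 -/Q /=.
  (* A deficient vertex either truly has too few neighbours in the missed set, by a margin e/2, or
     its sample count is off by e/2. The first kind is limited to e n / 8 by [cut], since kap <= e^2
     / 16. *)
  pose E1 := [set x | #|nbr H x :&: A u|%:R <= (psi x - e / 2) * (p * n)].
  have QE : (#|Q| <= #|E1| + #|[set x | Bad t' x u]|)%N.
    apply: leq_trans (leq_card_setU _ _); apply/subset_leq_card/fintype.subsetP => x.
    rewrite inQ => h1; rewrite finset.in_setU; apply/orP.
    have [h2|h2] := leP #|nbr H x :&: A u|%:R ((psi x - e / 2) * (p * n)).
      by left; rewrite in_set.
    right; rewrite in_set /Bad -/(ph2 x) ltNge; apply/negP => h3.
    have := le_trans h3 h1; rewrite lerBlDr ler_pdivrMr // [A u :&: _]finset.setIC.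
    have : m%:R * ((psi x - e / 2) * (p * n)) < m%:R * #|nbr H x :&: A u|%:R by rewrite ltr_pM2l.
    goal_lra.
  have E1n : #|E1|%:R <= e / 8 * n.
    have := cut E1 (A u); rewrite ler_norml => /andP[h1 _].
    have h2 : (ebt H E1 (A u))%:R <= p * (\sum_(x in E1) cell_sum R c D (A u) x) -
        e / 2 * (p * n) * #|E1|%:R.
      rewrite /ebt natr_sum.
      apply: (@le_trans _ _ (\sum_(x in E1) (psi x - e / 2) * (p * n))).
        by apply: ler_sum => x; rewrite in_set.
      rewrite -mulr_suml sumrB sumr_const -[_ *+ _]mulr_natr /psi -mulr_suml.
      rewrite le_eqVlt; apply/orP; left; apply/eqP; field; rewrite gt_eqF //.
    have h3 : e / 2 * (p * n) * #|E1|%:R <= e / 2 * (p * n) * (e / 8 * n).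
      apply: (@le_trans _ _ (kap * p * n ^+ 2)); first by move: h1 h2; goal_lra.
      have -> : e / 2 * (p * n) * (e / 8 * n) = e ^+ 2 / 16 * (p * n ^+ 2) by field.
      by rewrite -mulrA ler_pM2r // mulr_gt0 // exprn_gt0.
    by move: h3; rewrite ler_pM2l // mulr_gt0 // divr_gt0.
  move: QE hBad E1n; rewrite -(ler_nat R) natrD.
  have : 0 <= e * n by rewrite mulr_ge0 // ltW.
  goal_lra.
have cXB : (#|XB :\: XA| < N)%N.
  apply: (conc2 t t' F) => //.
    apply: X3W; apply/fintype.subsetP => u; rewrite in_setD => /andP[_].
    by rewrite in_set => /andP[].
  move=> u; rewrite in_setD => /andP[uXA]; rewrite in_set => /andP[uX3 hQ].
  rewrite deficient_touching; split => //.
  have [_ /(minusW u _ _ uX3)] := XB3 u uX3 uXA.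
  by apply: le_trans; goal_lra.
have cX3N : (#|X3| <= #|XA| + #|XB :\: XA|)%N.
  apply: leq_trans (leq_card_setU _ _); apply/subset_leq_card/fintype.subsetP => u uX3.
  rewrite finset.in_setU in_setD; case: (boolP (u \in XA)) => //= uXA.
  by have [] := XB3 u uX3 uXA.
(* The two samples keep at least 3/4 and 1/2 of the vertices, so a factor 8/3 is lost, rounded up to
   3. *)
have : (#|X3| <= N + N)%N by apply: leq_trans cX3N _; rewrite leq_add // ltnW.
rewrite -(ler_nat R) natrD.
have : 0 <= C / (eps * p) by rewrite divr_ge0 // mulr_ge0 // ltW.
have : 0 <= N%:R :> R by [].
move: cX1 cX2 cX3 mR; goal_lra.
Qed.

End Irregular.

(** * Colour classes *)

Section Classes.
Variables (R : realType) (V K : finType) (M : nat) (G H : {set {set V}}).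
Variables (c : {ffun V -> K}) (D : {ffun K * K -> 'I_M.+1}) (p : R).
Local Notation n := (#|V|%:R : R).

(** For a typical [u], the neighbours of [u] send on average at most about p n / 3 edges each
    outside [Y], as its complement has at most n / 3 vertices. Their degrees exceed this by gamma p
    n, so about gamma p^2 n^2 / 3 edges go to [Y], more than [Xtau] and the cut approximation allow.
    The exceptional [u] are those with many neighbours in the set [E] where the prediction is
    exceeded. *)
Lemma large_class_small (eps C kap tau e gamma : R) (X Y : {set V}) :
  (0 < #|V|)%N -> 0 < p -> p <= 1 -> 0 < eps -> 0 <= C -> 0 < e -> 0 <= tau ->
  eps <= gamma ->
  H \subset G -> degree_bound G p -> discrepancy G p eps C ->
  (forall A B : {set V},
     `|(ebt H A B)%:R - p * \sum_(x in A) cell_sum R c D B x| <= kap * p * n ^+ 2) ->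
  (forall u, (3^-1 + gamma) * p * n <= #|nbr H u|%:R) ->
  (forall u w, u \in X -> w \in Y ->
     \sum_(x in nbr H u) (D (c x, c w))%:R / M%:R <= tau * p * n) ->
  2 / 3 * n <= #|Y|%:R -> C <= eps * p ^+ 2 * n ->
  tau + 2 * e + 2 * (kap / e) + 6 * eps < gamma / 3 ->
  #|X|%:R <= C / (eps * p).
Proof.
move=> V0 p0 p1 eps0 C0 e0 tau0 epsg HG degG dis cut mind Xtau Y23 hC consts.
have n0 : 0 < n by rewrite ltr0n.
have pn0 : 0 < p * n by rewrite mulr_gt0.
have degH : degree_bound H p.
  by move=> u; apply: le_trans (degG u); rewrite ler_nat subset_leq_card // nbrS.
pose psi x := cell_sum R c D Y x / n.
pose E := [set x | (psi x + e) * (p * n) <= #|nbr H x :&: Y|%:R].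
have En : #|E|%:R <= kap / e * n.
  have := cut E Y; rewrite ler_norml => /andP[_ h1].
  have h2 : p * (\sum_(x in E) cell_sum R c D Y x) + e * (p * n) * #|E|%:R <= (ebt H E Y)%:R.
    rewrite /ebt natr_sum.
    apply: (@le_trans _ _ (\sum_(x in E) (psi x + e) * (p * n))).
      rewrite -mulr_suml big_split /= sumr_const -[_ *+ _]mulr_natr /psi -mulr_suml.
      by rewrite le_eqVlt; apply/orP; left; apply/eqP; field; rewrite gt_eqF.
    by apply: ler_sum => x; rewrite in_set.
  have h3 : e * (p * n) * #|E|%:R <= e * (p * n) * (kap / e * n).
    have -> : e * (p * n) * (kap / e * n) = kap * p * n ^+ 2 by field; rewrite gt_eqF.
    by move: h1 h2; lra.
  by move: h3; rewrite ler_pM2l // mulr_gt0.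
apply: le_trans (discrepancy_exceptional p0 eps0 V0 dis (lexx (p * #|E|%:R + 2 * eps * p * n))).
rewrite ler_nat; apply/subset_leq_card/fintype.subsetP => u uX; rewrite in_set ltNge.
apply/negP => uE.
set d : R := #|nbr H u|%:R.
have du : d <= 2 * p * n := degH u.
have d3 : 3^-1 * (p * n) <= d.
  have : 0 <= gamma * (p * n) by rewrite mulr_ge0 // ltW //; apply: lt_le_trans epsg.
  by move: (mind u); rewrite -/d; lra.
have low : (3^-1 + gamma) * p * n * d <= (ebt H (nbr H u) Y)%:R + (ebt H (nbr H u) (~: Y))%:R.
  rewrite -natrD /ebt -big_split /= natr_sum /d.
  apply: (@le_trans _ _ (\sum_(x in nbr H u) ((3^-1 + gamma) * p * n))).
    by rewrite sumr_const mulr_natr.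
  by apply: ler_sum => x _; rewrite -setDE cardsID; exact: mind.
have hY : (ebt H (nbr H u) Y)%:R <=
    p ^+ 2 * n ^+ 2 * (tau + 2 * e + 2 * (kap / e) + 4 * eps).
  have b1 x : x \in nbr H u -> #|nbr H x :&: Y|%:R <=
      psi x * (p * n) + e * (p * n) + (if x \in E then 2 * (p * n) else 0).
    move=> _; rewrite in_set; case: ifPn => [_|]; last by rewrite -ltNge addr0 -mulrDl => /ltW.
    have : #|nbr H x :&: Y|%:R <= 2 * p * n.
      by apply: le_trans (degH x); rewrite ler_nat subset_leq_card // finset.subsetIl.
    have : 0 <= psi x * (p * n).
      rewrite !mulr_ge0 ?invr_ge0 //; try exact: ltW.
      by apply: sumr_ge0 => w _; have /andP[] := grid_itv R (D (c x, c w)).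
    have : 0 <= e * (p * n) by rewrite mulr_ge0 // ltW.
    lra.
  rewrite /ebt natr_sum; apply: le_trans (ler_sum _ b1) _.
  rewrite !big_split /= -mulr_suml sumr_const -[e * _ *+ _]mulr_natr -/d.
  have s1 : (\sum_(x in nbr H u) psi x) <= tau * (p * n).
    rewrite /psi /cell_sum -mulr_suml exchange_big /= ler_pdivrMr //.
    apply: (@le_trans _ _ (\sum_(w in Y) (tau * p * n))).
      by apply: ler_sum => w; exact: Xtau.
    rewrite sumr_const -[leLHS]mulr_natr mulrA; apply: ler_wpM2l.
      by rewrite !mulr_ge0 // ltW.
    by rewrite ler_nat max_card.
  have s2 : \sum_(x in nbr H u) (if x \in E then 2 * (p * n) else 0) <=
      2 * (p * n) * #|nbr G u :&: E|%:R.
    rewrite -big_mkcondr /= sumr_const -[leLHS]mulr_natr; apply: ler_wpM2l.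
      by rewrite mulr_ge0 // ltW.
    rewrite ler_nat subset_leq_card //; apply/fintype.subsetP => x /andP[xu xE].
    by rewrite finset.inE xE (fintype.subsetP (nbrS u HG)).
  have s3 : #|nbr G u :&: E|%:R <= (kap / e + 2 * eps) * (p * n).
    by apply: le_trans uE _; move: En; rewrite -(ler_pM2l p0); lra.
  have s4 : (\sum_(x in nbr H u) psi x) * (p * n) <= tau * (p * n) * (p * n).
    by rewrite ler_pM2r.
  have s5 : e * (p * n) * d <= e * (p * n) * (2 * p * n).
    by rewrite ler_pM2l // mulr_gt0.
  have s6 : 2 * (p * n) * #|nbr G u :&: E|%:R <= 2 * (p * n) * ((kap / e + 2 * eps) * (p * n)).
    by rewrite ler_pM2l // mulr_gt0.
  move: s2 s4 s5 s6; lra.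
have hYc : (ebt H (nbr H u) (~: Y))%:R <= p * d * (n / 3) + (eps * p * n * d + C * n).
  apply: (@le_trans _ _ (ebt G (nbr H u) (~: Y))%:R); first by rewrite ler_nat ebt_le.
  have := dis (nbr H u) (~: Y); rewrite ler_norml => /andP[_]; rewrite lerBlDl -/d => h1.
  apply: le_trans h1 _; rewrite lerD2r; apply: ler_wpM2l; first by rewrite mulr_ge0 // ltW.
  have : #|Y|%:R + #|~: Y|%:R = n :> R by rewrite -natrD cardsC.
  by move: Y23; lra.
have hCn : C * n <= eps * (p ^+ 2 * n ^+ 2) by move: hC; rewrite -(ler_pM2r n0); lra.
have h1 : (gamma - eps) * (p * n) * (3^-1 * (p * n)) <= (gamma - eps) * (p * n) * d.
  by apply: ler_wpM2l d3; rewrite mulr_ge0 ?subr_ge0 // ltW.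
have ppnn : 0 < p ^+ 2 * n ^+ 2 by rewrite mulr_gt0 // exprn_gt0.
have h2 : (p ^+ 2 * n ^+ 2) * (tau + 2 * e + 2 * (kap / e) + 6 * eps) < (p ^+ 2 * n ^+ 2) * (gamma / 3).
  by rewrite ltr_pM2l.
have : 0 < eps * (p ^+ 2 * n ^+ 2) by rewrite mulr_gt0.
move: low hY hYc hCn h1 h2; lra.
Qed.

Variables (L : nat) (e3 : R).

Definition cell_degree u i : nat := #|[set x in nbr H u | c x == i]|.

Definition profile u : {ffun K -> 'I_L.+1} :=
  [ffun i => inord (Num.truncn ((cell_degree u i)%:R / (e3 * p * n)))].

(** The sum sees [u] only through its cell degrees, which for equal profiles differ by at most
    [e3 * p * n], and all weights lie in [0, 1]. *)
Lemma profile_close u v w : (0 < #|V|)%N -> 0 < p -> 0 < e3 -> 2 / e3 < L.+1%:R ->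
  degree_bound H p -> profile u = profile v ->
  `|\sum_(x in nbr H u) (D (c x, c w))%:R / M%:R - \sum_(x in nbr H v) (D (c x, c w))%:R / M%:R|
  <= #|K|%:R * (e3 * p * n) :> R.
Proof.
move=> V0 p0 e30 L2 deg uv.
have n0 : 0 < n by rewrite ltr0n.
have epn0 : 0 < e3 * p * n by rewrite !mulr_gt0.
have sE u' : \sum_(x in nbr H u') (D (c x, c w))%:R / M%:R =
    \sum_i (cell_degree u' i)%:R * ((D (i, c w))%:R / M%:R) :> R.
  rewrite (partition_big c predT) //=; apply: eq_bigr => i _.
  rewrite (eq_bigr (fun=> (D (i, c w))%:R / M%:R)); last by move=> x /andP[_ /eqP->].
  rewrite sumr_const -[LHS]mulr_natl; congr (_%:R * _).
  by apply: eq_card => x; rewrite /cell_degree in_set.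
have close i : `|(cell_degree u i)%:R - (cell_degree v i)%:R| <= e3 * p * n :> R.
  (* The quotient is at most 2 / e3, so [inord] never falls back on its default value. *)
  have bnd u' : (Num.truncn ((cell_degree u' i)%:R / (e3 * p * n)) < L.+1)%N.
    rewrite -(ltr_nat R); apply: le_lt_trans L2.
    apply: (@le_trans _ _ ((cell_degree u' i)%:R / (e3 * p * n))).
      by rewrite truncn_le divr_ge0 // ltW.
    rewrite ler_pdivrMr //; have -> : 2 / e3 * (e3 * p * n) = 2 * p * n.
      by field; rewrite gt_eqF.
    apply: le_trans (deg u'); rewrite ler_nat subset_leq_card //.
    by apply/fintype.subsetP => x; rewrite in_set => /andP[].
  have := congr1 (fun f : {ffun K -> 'I_L.+1} => val (f i)) uv.
  rewrite /= !ffunE !inordK ?bnd // => tE.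
  have t0 u' : 0 <= (cell_degree u' i)%:R / (e3 * p * n) by rewrite divr_ge0 // ltW.
  have := truncn_itv (t0 u); have := truncn_itv (t0 v); rewrite tE.
  set k : R := (Num.truncn _)%:R; rewrite -natr1 -/k.
  rewrite !ler_pdivlMr // !ltr_pdivrMr // => /andP[h1 h2] /andP[h3 h4].
  by rewrite ler_norml; apply/andP; split; lra.
rewrite !sE -sumrB; apply: le_trans (ler_norm_sum _ _ _) _.
apply: (@le_trans _ _ (\sum_(i : K) e3 * p * n)); last by rewrite sumr_const -[leLHS]mulr_natl.
apply: ler_sum => i _; rewrite -mulrBl normrM.
have /andP[h0 h1] := grid_itv R (D (i, c w)).
rewrite [X in _ * X]ger0_norm // -[leRHS]mulr1; apply: ler_pM => //.
Qed.

End Classes.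

Section Colouring.
Variables (V L : finType) (H : {set {set V}}) (key : V -> L).

Definition colour_class k : {set V} := [set x | key x == k].

Definition monochromatic : {set {set V}} :=
  [set e in H | [exists x, [exists y, (e == [set x; y]) && (key x == key y)]]].

Lemma monochromatic_partite : partite #|L| (H :\: monochromatic).
Proof.
exists (fun x => enum_rank (key x)) => x y; rewrite in_setD => /andP[nm xyH].
apply: contraNN nm => /eqP/enum_rank_inj kxy; rewrite in_set xyH /=.
by apply/existsP; exists x; apply/existsP; exists y; rewrite kxy !eqxx.
Qed.

Lemma card_monochromatic :
  (#|monochromatic| <= \sum_k ebt H (colour_class k) (colour_class k))%N.
Proof.
pose P := [set xy : V * V | (xy.2 \in nbr H xy.1) && (key xy.1 == key xy.2)].
apply: (@leq_trans #|P|).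
  apply: leq_trans (leq_imset_card (fun xy : V * V => [set xy.1; xy.2]) P).
  apply/subset_leq_card/fintype.subsetP => e; rewrite in_set => /andP[eH].
  move=> /existsP[x /existsP[y /andP[/eqP E kxy]]]; apply/imsetP; exists (x, y) => //.
  by rewrite in_set /= kxy in_nbr -E eH.
rewrite /ebt (exchange_big_dep predT) //= -sum1_card big_mkcond.
have -> : (\sum_i (if i \in P then 1 else 0) =
    \sum_x \sum_y (if (x, y) \in P then 1 else 0))%N by rewrite pair_bigA; apply: eq_bigr => -[].
apply: leq_sum => x _; rewrite (big_pred1 (key x)); last first.
  by move=> k; rewrite in_set eq_sym.
rewrite -sum1_card [leqRHS]big_mkcond; apply: leq_sum => y _.
by rewrite in_setI /P /colour_class !in_set /= [key y == _]eq_sym.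
Qed.

End Colouring.

Lemma ebt_split (V : finType) (E : {set {set V}}) (U W : {set V}) :
  (ebt E U U <= ebt E (U :\: W) (U :\: W) + 2 * \sum_(x in U :&: W) #|nbr E x|)%N.
Proof.
have l1 A : (ebt E A U <= ebt E A (U :\: W) + ebt E A (U :&: W))%N.
  rewrite /ebt -big_split; apply: leq_sum => x _ /=.
  apply: leq_trans (leq_card_setU _ _); apply/subset_leq_card/fintype.subsetP => y.
  rewrite finset.in_setU !finset.in_setI in_setD.
  by case: (y \in W); case: (y \in U); rewrite ?andbT ?andbF ?orbT ?orbF.
have l2 : ebt E U U = (ebt E (U :&: W) U + ebt E (U :\: W) U)%N.
  by rewrite {1}/ebt (big_setID W).
have l3 A : (ebt E (U :&: W) A <= \sum_(x in U :&: W) #|nbr E x|)%N.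
  by apply: leq_sum => x _; rewrite subset_leq_card // finset.subsetIl.
rewrite l2 addnC; apply: (@leq_trans (ebt E (U :\: W) (U :\: W) + ebt E (U :\: W) (U :&: W) +
   ebt E (U :&: W) U)); first by rewrite leq_add2r l1.
by rewrite -addnA leq_add2l mul2n -addnn leq_add // ebt_sym.
Qed.

Section Assembly.
Variables (R : realType) (V K : finType) (M m N L : nat) (G H : {set {set V}}).
Variables (c : {ffun V -> K}) (D : {ffun K * K -> 'I_M.+1}).
Variables (p gamma eps C eps1 C1 C0 kap tau g e eta e2 e3 : R).
Local Notation n := (#|V|%:R : R).

Let dsum u w : R := \sum_(x in nbr H u) (D (c x, c w))%:R / M%:R.

Lemma few_monochromatic :
  (0 < #|V|)%N -> (0 < m)%N -> 0 < p -> p <= 1 ->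
  0 < eps -> eps <= gamma / 8 -> 0 <= C -> eps1 <= gamma / 12 -> 0 <= C1 ->
  0 < gamma -> g = gamma / 4 -> tau = gamma / 12 -> e = tau * g / 64 -> e <= 1 -> e <= g / 2 ->
  0 < e2 -> 3 / 2 * tau + 2 * e2 + 2 * (kap / e2) + 6 * eps < gamma / 3 ->
  0 < e3 -> 2 / e3 < L.+1%:R -> #|K|%:R * e3 <= tau / 2 ->
  0 < eta -> 8 * eta + 12 * eps <= 2 * e -> kap <= e ^+ 2 / 16 ->
  expR (- (tau / 32 * (p ^+ 2 * m%:R))) <= eta / 4 ->
  expR (- (e ^+ 2 / 32 * (p * m%:R))) <= e / 32 ->
  C <= eps * p ^+ 2 * n -> 2 * m%:R + 2 * eps * n <= e * n ->
  3 * (2 * N%:R + 2 * m%:R + C / (eps * p)) <= C0 / p ^+ 2 ->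
  H \subset G -> triangle_free H ->
  degree_bound G p -> discrepancy G p eps C -> local_discrepancy G p eps1 C1 ->
  (forall A B : {set V},
     `|(ebt H A B)%:R - p * \sum_(x in A) cell_sum R c D B x| <= kap * p * n ^+ 2) ->
  (forall u, (3^-1 + gamma) * p * n <= #|nbr H u|%:R) ->
  (forall Z (t t' : {ffun 'I_m -> V}), concentrated p G (sampled t t')
     (fun J u => missed J t Z u) (g / 2) N) ->
  (forall Z (t t' : {ffun 'I_m -> V}), concentrated p G (sampled t t')
     (fun J u => deficient p J t t' Z c D e u) e N) ->
  #|monochromatic H (profile H c p L e3)|%:R <=
    #|{: {ffun K -> 'I_L.+1}}|%:R * (2 * C / eps + 4 * C0 + (3 * C1 + 4 * C / eps) / gamma) * n / p.
Proof.
move=> V0 m0 p0 p1 eps0 epsg C00 eps1g C10 gam0 gE tauE eE e1 eg e20 cst2 e30 L2 K3.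
move=> eta0 he hkap exp1 exp2 hC hm hC0 HG tf degG dis loc cut mind conc1 conc2.
have n0 : 0 < n by rewrite ltr0n.
have pn0 : 0 < p * n by rewrite mulr_gt0.
have g0 : 0 < g by rewrite gE divr_gt0.
have tau0 : 0 < tau by rewrite tauE divr_gt0.
have degH : degree_bound H p.
  by move=> u; apply: le_trans (degG u); rewrite ler_nat subset_leq_card // nbrS.
have npos : 0 <= n / p by rewrite divr_ge0 // ltW.
have c1 : 0 <= C / eps by rewrite divr_ge0 // ltW.
have c3 : 0 <= C0 / p ^+ 2.
  apply: le_trans hC0; have : 0 <= C / (eps * p) by rewrite divr_ge0 // mulr_ge0 // ltW.
  by move=> ?; rewrite mulr_ge0 // !addr_ge0 // mulr_ge0.
have p20 : 0 < p ^+ 2 by rewrite exprn_gt0.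
have C0pos : 0 <= C0 by move: c3; rewrite pmulr_lge0 // invr_gt0.
have c2 : 0 <= 2 * C / eps by rewrite divr_ge0 ?(ltW eps0) // mulr_ge0.
have c5 : 0 <= 4 * C / eps by rewrite divr_ge0 ?(ltW eps0) // mulr_ge0.
have c4 : 0 <= (3 * C1 + 4 * C / eps) / gamma.
  by rewrite divr_ge0 ?(ltW gam0) // addr_ge0 // mulr_ge0.
have c6 : 0 <= 4 * C0 by rewrite mulr_ge0.
apply: (@le_trans _ _ (\sum_(k : {ffun K -> 'I_L.+1})
   (2 * C / eps + 4 * C0 + (3 * C1 + 4 * C / eps) / gamma) * n / p)); last first.
  by rewrite sumr_const -[leLHS]mulr_natl !mulrA.
apply: (@le_trans _ _ (\sum_(k : {ffun K -> 'I_L.+1})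
   (ebt H (colour_class (profile H c p L e3) k) (colour_class (profile H c p L e3) k))%:R)).
  by rewrite -natr_sum ler_nat card_monochromatic.
apply: ler_sum => k _; set U := colour_class _ k.
have [->|/set0Pn[u0 u0U]] := eqVneq U finset.set0.
  by rewrite /ebt big_set0 -mulrA mulr_ge0 // !addr_ge0.
(* One [Z] serves the whole class: passing from [u0] to another vertex costs tau / 2, which leaves
   the thresholds tau / 2 on [Z] and 3 tau / 2 off it. *)
pose Z := [set w | tau * p * n <= dsum u0 w].
have near u w : u \in U -> `|dsum u w - dsum u0 w| <= tau / 2 * (p * n).
  rewrite !in_set => /eqP uk; move: u0U; rewrite in_set => /eqP u0k.
  apply: le_trans (profile_close D w V0 p0 e30 L2 degH (etrans uk (esym u0k))) _.
  have -> : #|K|%:R * (e3 * p * n) = #|K|%:R * e3 * (p * n) by ring.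
  by rewrite ler_pM2r.
have nearZ u w : u \in U -> w \in Z -> tau / 2 * p * n <= dsum u w.
  move=> uU; have := near u w uU; rewrite ler_norml => /andP[h1 _].
  by rewrite in_set; move: h1; goal_lra.
have nearY u w : u \in U -> w \in ~: Z -> dsum u w <= 3 / 2 * tau * p * n.
  move=> uU; have := near u w uU; rewrite ler_norml => /andP[_ h1].
  by rewrite finset.in_setC in_set -ltNge; move: h1; goal_lra.
have deg2 (X : {set V}) : (\sum_(x in X) #|nbr H x|)%:R <= 2 * (p * n) * #|X|%:R.
  rewrite natr_sum; apply: (@le_trans _ _ (\sum_(x in X) 2 * (p * n))).
    by apply: ler_sum => x _; move: (degH x); goal_lra.
  by rewrite sumr_const -[leLHS]mulr_natr.
have [Ybig|Ysmall] := leP (2 / 3 * n) #|~: Z|%:R.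
  have cU : #|U|%:R <= C / (eps * p).
    apply: (large_class_small V0 p0 p1 eps0 C00 e20 _ _ HG degG dis cut mind nearY Ybig hC cst2).
      by rewrite mulr_ge0 // ltW.
    by apply: le_trans epsg _; move: gam0; goal_lra.
  apply: (@le_trans _ _ (2 * C / eps * (n / p))).
    apply: (@le_trans _ _ (2 * (p * n) * (C / (eps * p)))).
      apply: (@le_trans _ _ (\sum_(x in U) #|nbr H x|)%:R).
        by rewrite ler_nat; apply: leq_sum => x _; rewrite subset_leq_card // finset.subsetIl.
      by apply: le_trans (deg2 U) _; rewrite ler_pM2l // mulr_gt0.
    have -> : 2 * (p * n) * (C / (eps * p)) = 2 * C / eps * n by field; rewrite !gt_eqF.
    apply: ler_wpM2l => //.
    by rewrite ler_pdivlMr // ler_piMr // ltW.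
  by rewrite -[leRHS]mulrA; apply: ler_wpM2r => //; rewrite -addrA lerDl addr_ge0.
pose Tr := [set u in U | g * p * n <= #|nbr H u :&: Z|%:R].
have TrU u : u \in Tr -> u \in U by rewrite in_set => /andP[].
have cTr : #|Tr|%:R <= C0 / p ^+ 2.
  apply: le_trans hC0.
  (* Used with tau / 2, whence [e = tau * g / 64] here. *)
  apply: (@few_irregular R V K M m N G H c D p eps C kap (tau / 2) g e eta Z Tr) => //.
  - by rewrite divr_gt0.
  - by rewrite eE; field.
  - by move=> u w /TrU; exact: nearZ.
  - by move=> u; rewrite in_set => /andP[].
  - by have -> : tau / 2 / 16 = tau / 32 by field.
have main : p * (ebt H (U :\: Tr) (U :\: Tr))%:R <= (3 * C1 + 4 * C / eps) / gamma * n.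
  (* A vertex outside [Tr] has at least (1/3 + gamma - g) p n neighbours off [Z]. The resulting
     factor is at least 2 gamma - gamma / 2 - gamma / 4 - gamma / 4 = gamma. *)
  have := @few_edges_in_class R V G H p (3^-1 + gamma - g) (2 / 3) eps eps1 C C1
    (U :\: Tr) (~: Z) p0 p1 eps0 C00 V0 HG tf degG dis loc (ltW Ysmall).
  move=> /(_ _ C10) h.
  have {}h : (2 * (3^-1 + gamma - g) - 2 / 3 - 3 * eps1 - 2 * eps) * p *
      (ebt H (U :\: Tr) (U :\: Tr))%:R <= (3 * C1 + 4 * C / eps) * n.
    apply: h => u; rewrite in_setD => /andP[uTr uU].
    have hZ : #|nbr H u :&: Z|%:R < g * p * n.
      by rewrite ltNge; apply: contra uTr => h; rewrite in_set uU.
    have := mind u; rewrite -(cardsID Z (nbr H u)) natrD -setDE; move: hZ; goal_lra.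
  rewrite mulrAC ler_pdivlMr // mulrC; apply: le_trans h; rewrite mulrA.
  apply: ler_wpM2r => //; rewrite ler_pM2r //; move: epsg eps1g; rewrite gE; goal_lra.
have sp := ebt_split H U Tr.
have h1 : (ebt H U U)%:R <= (ebt H (U :\: Tr) (U :\: Tr))%:R +
    2 * (\sum_(x in U :&: Tr) #|nbr H x|)%:R :> R.
  by rewrite -natrM -natrD ler_nat.
have UTr : U :&: Tr = Tr by apply/finset.setIidPr/fintype.subsetP.
rewrite UTr in h1.
have h2 : 2 * (p * n) * #|Tr|%:R <= 2 * C0 * (n / p).
  have -> : 2 * C0 * (n / p) = 2 * (p * n) * (C0 / p ^+ 2) by field; rewrite gt_eqF.
  by rewrite ler_pM2l // mulr_gt0.
have h3 : (ebt H (U :\: Tr) (U :\: Tr))%:R <= (3 * C1 + 4 * C / eps) / gamma * (n / p).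
  by rewrite mulrA ler_pdivlMr // mulrC.
have h4 : 0 <= 2 * C / eps * (n / p) by exact: mulr_ge0.
rewrite -[leRHS]mulrA.
move: h1 h2 h3 h4 (deg2 Tr); set y := n / p.
set a := (ebt _ _ _)%:R; set b := (ebt _ _ _)%:R; set s := (\sum_(x in Tr) _)%:R.
set q := (_ / gamma); set r := 2 * C / eps; move=> h1 h2 h3 h4 h5.
rewrite !mulrDl; move: h1 h2 h3 h4 h5; goal_lra.
Qed.

End Assembly.

(** * Quasirandomness of the binomial random graph *)

Lemma bin_le_exp n m : ('C(n, m) <= n ^ m)%N.
Proof.
apply: (@leq_trans (n ^_ m)); first by rewrite -bin_ffact leq_pmulr ?fact_gt0.
rewrite ffact_prod -[X in (_ <= _ ^ X)%N]card_ord -prod_nat_const.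
by apply: leq_prod => i _; rewrite leq_subr.
Qed.

Lemma sum_subset_exp (R : comNzRingType) (T : finType) (S : {set T}) (p : R) :
  \sum_(J : {set T} | J \subset S) p ^+ #|J| = (p + 1) ^+ #|S|.
Proof.
rewrite -prodr_const -(sum_prod_subset S (fun=> p) (fun=> 1)).
apply: eq_bigr => J JS; rewrite -big_mkcondr /= prodr_const; congr (_ ^+ _).
by apply: eq_card => e; rewrite [RHS]unfold_in andb_idl // => /(fintype.subsetP JS).
Qed.

Lemma card_set_type (T : finType) : #|{: {set T}}| = (2 ^ #|T|)%N.
Proof. by rewrite -[LHS]cardsT -powersetT card_powerset cardsT. Qed.

Lemma ebt_ordcount n (G : {set {set 'I_n}}) (U B : {set 'I_n}) :
  ebt G U B = ordcount (finset.setX U B) G.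
Proof.
rewrite /ordcount -sum1_card big_mkcond.
have -> : (\sum_i (if i \in [set xy in finset.setX U B | [set xy.1; xy.2] \in G] then 1 else 0) =
    \sum_x \sum_y (if [&& x \in U, y \in B & [set x; y] \in G] then 1 else 0))%N.
  by rewrite pair_bigA; apply: eq_bigr => -[x y] _; rewrite !inE /= andbA.
rewrite /ebt [LHS]big_mkcond; apply: eq_bigr => x _.
case: (x \in U) => /=; last by rewrite big1.
by rewrite -sum1_card big_mkcond; apply: eq_bigr => y _; rewrite !inE andbC.
Qed.

Lemma card_offdiag n (U B : {set 'I_n}) :
  (#|offdiag (finset.setX U B)| <= #|U| * #|B| <=
   #|offdiag (finset.setX U B)| + #|U :&: B|)%N.
Proof.
rewrite -finset.cardsX subset_leq_card /=; last first.
  by apply/fintype.subsetP => xy; rewrite inE => /andP[].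
apply: (@leq_trans (#|offdiag (finset.setX U B)| + #|(fun x => (x, x)) @: (U :&: B)|)); last first.
  by rewrite leq_add2l leq_imset_card.
apply: leq_trans (leq_card_setU _ _); apply/subset_leq_card/fintype.subsetP => -[x y] /finset.setXP[xU yB].
rewrite finset.in_setU; have [xy|xy] := eqVneq x y; last first.
  by rewrite /offdiag in_set finset.in_setX xU yB /= xy.
apply/orP; right; apply/imsetP; exists y; last by rewrite xy.
by rewrite finset.in_setI yB -xy xU.
Qed.

Section Properties.
Variables (R : realType) (n : nat) (p : R).
Hypotheses (n0 : (0 < n)%N) (p0 : 0 < p) (p1 : p <= 1).
Let nR : 0 < n%:R :> R. Proof. by rewrite ltr0n. Qed.

(** The mean [p * #|U| * #|B|] also counts the pairs (x, x), which are never edges; this shifts the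
    exponent by at most |l| p times [#|U :&: B|]. *)
Lemma cut_tail (S : {set {set 'I_n}}) (U B : {set 'I_n}) (l t : R) :
  S \subset pairs 'I_n ->
  (forall x y, x \in U -> y \in B -> [set x; y] \notin S) -> `|l| <= 8^-1 ->
  gnp_prob p (fun G => S \subset G /\ t <= l * ((ebt G U B)%:R - p * #|U|%:R * #|B|%:R)) <=
  p ^+ #|S| * expR (2 * l ^+ 2 * p * #|U|%:R * #|B|%:R - t + `|l| * p * #|U :&: B|%:R).
Proof.
move=> SP US l8; have pe := ltW p0.
have SP' xy : xy \in finset.setX U B -> [set xy.1; xy.2] \notin S.
  by case: xy => x y /finset.setXP[]; exact: US.
have := gnp_chernoff pe p1 (t - `|l| * p * #|U :&: B|%:R) SP SP' l8.
rewrite finset.cardsX natrM opprB addrA [_ * (_ * _)]mulrA.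
have -> : 2 * l ^+ 2 * p * #|U|%:R * #|B|%:R + `|l| * p * #|U :&: B|%:R - t =
  2 * l ^+ 2 * p * #|U|%:R * #|B|%:R - t + `|l| * p * #|U :&: B|%:R by ring.
apply: le_trans; apply: le_gnp_prob => // G _ [SG tG]; split => //.
rewrite -ebt_ordcount lerBlDr; apply: le_trans tG _.
have /andP[h1 h2] := card_offdiag U B.
move: h1 h2; rewrite -!(ler_nat R) natrD natrM => h1 h2.
rewrite -subr_ge0.
set a := (ebt _ _ _)%:R; set o := #|offdiag _|%:R in h1 h2 *; set d := #|_ :&: _|%:R in h2 *.
set b := #|B|%:R in h1 h2 *; set u := #|U|%:R in h1 h2 *.
have -> : l * (a - p * o) + `|l| * p * d - l * (a - p * u * b) =
   `|l| * (p * d) - (- l) * (p * (u * b - o)) by ring.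
rewrite subr_ge0; apply: le_trans (ler_norm _) _; rewrite normrM normrN.
apply: ler_wpM2l => //; rewrite ger0_norm; last by rewrite mulr_ge0 // subr_ge0.
by apply: ler_wpM2l => //; rewrite lerBlDl.
Qed.

Lemma prob_degree_bound :
  gnp_prob p (fun G : {set {set 'I_n}} => ~ degree_bound G p) <=
  n%:R * expR (1 - 3 / 32 * (p * n%:R)).
Proof.
have pe := ltW p0.
apply: (@le_trans _ _ (\sum_(u : 'I_n) expR (1 - 3 / 32 * (p * n%:R)))); last first.
  by rewrite sumr_const card_ord -[leLHS]mulr_natl.
pose A (u : 'I_n) (G : {set {set 'I_n}}) := 2 * p * n%:R < #|nbr G u|%:R :> R.
apply: (@le_trans _ _ (gnp_prob p (fun G => exists2 u : 'I_n, True & A u G))).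
  apply: le_gnp_prob => // G _ /existsNP[u /negP]; rewrite -ltNge card_ord => h.
  by exists u.
apply: gnp_prob_bigU => // u _.
apply: (@le_trans _ _ (gnp_prob p (fun G => finset.set0 \subset G /\
   p * n%:R / 8 <= 8^-1 * ((ebt G [set u] [set: 'I_n])%:R -
     p * #|[set u]|%:R * #|[set: 'I_n]|%:R)))); last first.
  apply: le_trans (cut_tail _ (finset.sub0set _) _ _) _.
  - by move=> x y _ _; rewrite inE.
  - by rewrite ger0_norm.
  rewrite cards0 expr0 mul1r finset.setIT cards1 finset.cardsT card_ord ler_expR ger0_norm //.
  by have := p1; lra.
rewrite cards1 finset.cardsT card_ord.
  apply: le_gnp_prob => // G _; rewrite /A => h1; split; first exact: finset.sub0set.
  rewrite /ebt big_set1 finset.setIT; lra.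
Qed.

Lemma cut_two_tails (S : {set {set 'I_n}}) (U B : {set 'I_n}) (l t : R) :
  S \subset pairs 'I_n ->
  (forall x y, x \in U -> y \in B -> [set x; y] \notin S) -> 0 <= l -> l <= 8^-1 ->
  gnp_prob p (fun G => S \subset G /\ t < `|(ebt G U B)%:R - p * #|U|%:R * #|B|%:R|) <=
  p ^+ #|S| *
    (2 * expR (2 * l ^+ 2 * p * #|U|%:R * #|B|%:R - l * t + l * p * #|U :&: B|%:R)).
Proof.
move=> SP US l0 l8.
have h1 := cut_tail (l * t) SP US (l := l); have h2 := cut_tail (l * t) SP US (l := - l).
rewrite sqrrN normrN !ger0_norm // in h1 h2.
rewrite mulrDl mul1r mulrDr; apply: le_trans (lerD (h1 l8) (h2 l8)).
apply: le_trans (gnp_probU (ltW p0) p1 _ _); apply: le_gnp_prob; rewrite ?(ltW p0) //.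
move=> G _ [SG]; rewrite lter_normr => /orP[] /ltW h; [left|right]; split => //.
  exact: ler_wpM2l.
by rewrite mulNr -mulrN; exact: ler_wpM2l.
Qed.

Lemma expR_ge_natpow (k : nat) (x : R) : k%:R <= x -> 2 ^+ k <= expR x.
Proof.
move=> kx; apply: (@le_trans _ _ (expR k%:R)); last by rewrite ler_expR.
rewrite -[k%:R]mulr1 expRM_natl; apply: lerXn2r; rewrite ?nnegrE ?expR_ge0 //.
by have := expR_ge1Dx (1 : R).
Qed.

(** With [l = eps / 4] the quadratic term is at most eps^2 p n |U| / 8, half of what the error
    linear in [#|U|] provides. The term [C * n] then beats the 4^n choices of [U] and [B]. *)
Lemma prob_discrepancy (eps C : R) : 0 < eps -> eps <= 2^-1 -> 4 <= eps / 4 * (C - 1) ->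
  gnp_prob p (fun G : {set {set 'I_n}} => ~ discrepancy G p eps C) <= 2 * expR (- (2 * n%:R)).
Proof.
move=> e0 e2 hC; have pe := ltW p0.
pose A (UB : {set 'I_n} * {set 'I_n}) (G : {set {set 'I_n}}) := finset.set0 \subset G /\
  eps * p * n%:R * #|UB.1|%:R + C * n%:R <
  `|(ebt G UB.1 UB.2)%:R - p * #|UB.1|%:R * #|UB.2|%:R|.
apply: (@le_trans _ _ (gnp_prob p (fun G => exists2 UB, True & A UB G))).
  apply: le_gnp_prob => // G _ /existsNP[U /existsNP[B /negP]]; rewrite -ltNge card_ord => h.
  by exists (U, B) => //; split => //; exact: finset.sub0set.
apply: (@le_trans _ _ (\sum_(UB : {set 'I_n} * {set 'I_n}) 2 * expR (- (4 * n%:R)))).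
  apply: gnp_prob_bigU => // -[U B] _.
  apply: le_trans (cut_two_tails _ (l := eps / 4) (finset.sub0set _) _ _ _) _.
  - by move=> x y _ _; rewrite inE.
  - by rewrite divr_ge0 // ltW.
  - by move: e2; lra.
  rewrite cards0 expr0 mul1r ler_pM2l // ler_expR /=.
  have Bn : #|B|%:R <= n%:R :> R by rewrite ler_nat -[leqRHS]card_ord max_card.
  have UBn : #|U :&: B|%:R <= n%:R :> R by rewrite ler_nat -[leqRHS]card_ord max_card.
  set u : R := #|U|%:R; have u0 : 0 <= u by [].
  have e20 : 0 <= eps ^+ 2 by exact: sqr_ge0.
  have h1 : 2 * (eps / 4) ^+ 2 * p * u * #|B|%:R <= eps ^+ 2 / 8 * (p * n%:R * u).
    have -> : 2 * (eps / 4) ^+ 2 * p * u * #|B|%:R = eps ^+ 2 / 8 * (p * #|B|%:R * u) by field.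
    apply: ler_wpM2l; first by rewrite divr_ge0.
    by rewrite ler_wpM2r // ler_pM2l.
  have h2 : eps / 4 * p * #|U :&: B|%:R <= eps / 4 * n%:R.
    rewrite -mulrA; apply: ler_wpM2l; first by rewrite divr_ge0 // ltW.
    by rewrite -[leRHS]mul1r; apply: ler_pM.
  have h3 : 0 <= eps ^+ 2 / 8 * (p * n%:R * u).
    by rewrite mulr_ge0 ?divr_ge0 // mulr_ge0 // mulr_ge0.
  have h4 : 4 * n%:R <= eps / 4 * (C - 1) * n%:R by rewrite ler_pM2r.
  have -> : eps / 4 * (eps * p * n%:R * u + C * n%:R) =
     2 * (eps ^+ 2 / 8 * (p * n%:R * u)) + eps / 4 * (C - 1) * n%:R + eps / 4 * n%:R by field.
  by move: h1 h2 h3 h4; lra.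
rewrite sumr_const card_prod !card_set_type card_ord -mulrnAr ler_pM2l // -mulr_natl natrM natrX.
have h : 2 ^+ n <= expR n%:R :> R by apply: expR_ge_natpow.
apply: (@le_trans _ _ (expR n%:R * expR n%:R * expR (- (4 * n%:R)))).
  apply: ler_wpM2r; first exact: expR_ge0.
  by apply: ler_pM; rewrite ?exprn_ge0.
by rewrite -!expRD ler_expR; lra.
Qed.

(** Union bound over [u], its neighbourhood [B] and two subsets of [B]. The star from [u] to [B] is
    disjoint from the pairs inside [B], so it enters as a factor p^|B|, whose sum over [B] is at
    most exp(p n). As |B| <= 2 p n, the subsets cost exp(4 p n), and the tail exp(-6 p n) leaves
    exp(-p n). *)
Lemma prob_local_discrepancy (eps C : R) : 0 < eps -> eps <= 2^-1 -> 6 <= eps / 4 * (C - 2) ->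
  gnp_prob p (fun G : {set {set 'I_n}} => degree_bound G p /\ ~ local_discrepancy G p eps C) <=
  2 * n%:R * expR (- (p * n%:R)).
Proof.
move=> e0 e2 hC; have pe := ltW p0.
pose star (u : 'I_n) (S : {set 'I_n}) : {set {set 'I_n}} := [set [set u; v] | v in S].
pose I : finType := ('I_n * {set 'I_n} * {set 'I_n} * {set 'I_n})%type.
pose P (i : I) := let: (u, B, U, D) := i in
  [&& u \notin B, U \subset B, D \subset B & #|B|%:R <= 2 * p * n%:R :> R].
pose A (i : I) (G : {set {set 'I_n}}) := let: (u, B, U, D) := i in star u B \subset G /\
  eps * p ^+ 2 * n%:R * #|U|%:R + C * p * n%:R <
  `|(ebt G U D)%:R - p * #|U|%:R * #|D|%:R|.
pose q : R := 2 * expR (- (6 * (p * n%:R))).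
have q0 : 0 <= q by rewrite mulr_ge0 ?expR_ge0.
apply: (@le_trans _ _ (gnp_prob p (fun G => exists2 i, P i & A i G))).
  apply: le_gnp_prob => // G gG [deg /existsNP[u /existsNP[U /existsNP[D]]]].
  move=> /not_implyP[US /not_implyP[DS /negP]]; rewrite -ltNge card_ord => h.
  exists (u, nbr G u, U, D) => /=.
    rewrite US DS; move: (deg u); rewrite card_ord => ->; rewrite !andbT in_nbr.
    apply/negP => /(fintype.subsetP gG); rewrite inE finset.setUid cards1.
    by [].
  split=> //; apply/fintype.subsetP => e /imsetP[v vS ->]; by rewrite -in_nbr.
pose b (i : I) : R := if P i then p ^+ #|i.1.1.2| * q else 0.
apply: (@le_trans _ _ (\sum_i b i)).
  apply: gnp_prob_bigU => // [i|i Pi].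
    by rewrite /b; case: ifP => // _; rewrite mulr_ge0 ?exprn_ge0.
  rewrite /b Pi; move: i Pi => [[[u S] U] D] /= /and4P[uS US DS Sn].
  have starS : #|star u S| = #|S|.
    apply: card_in_imset => v w vS wS E.
    have : v \in [set u; w] by rewrite -E !inE eqxx orbT.
    by rewrite !inE => /orP[/eqP vu|/eqP//]; rewrite -vu vS in uS.
  rewrite -starS; apply: le_trans (cut_two_tails _ (l := eps / 4) _ _ _ _) _.
  - apply/fintype.subsetP => e /imsetP[v vS ->]; rewrite inE cards2.
    by have [uv|//] := eqVneq u v; rewrite uv vS in uS.
  - move=> x y xU yD; apply/negP => /imsetP[v vS E].
    have : u \in [set x; y] by rewrite E !inE eqxx.
    rewrite !inE => /orP[/eqP ux|/eqP uy].
      by rewrite ux (fintype.subsetP US) in uS.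
    by rewrite uy (fintype.subsetP DS) in uS.
  - by rewrite divr_ge0 // ltW.
  - by move: e2; lra.
  apply: ler_wpM2l; first by rewrite exprn_ge0.
  rewrite /q ler_pM2l // ler_expR.
  have Dn : #|D|%:R <= 2 * p * n%:R by apply: le_trans Sn; rewrite ler_nat subset_leq_card.
  have UDn : #|U :&: D|%:R <= 2 * p * n%:R.
    by apply: le_trans Dn; rewrite ler_nat subset_leq_card // finset.subsetIr.
  set x : R := #|U|%:R; have x0 : 0 <= x by [].
  have e20 : 0 <= eps ^+ 2 by exact: sqr_ge0.
  have pn0 : 0 < p * n%:R by rewrite mulr_gt0.
  have h1 : 2 * (eps / 4) ^+ 2 * p * x * #|D|%:R <=
      2 * (eps / 4) ^+ 2 * p * x * (2 * p * n%:R).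
    apply: ler_wpM2l => //; rewrite mulr_ge0 // mulr_ge0 // mulr_ge0 //; exact: sqr_ge0.
  have h2 : eps / 4 * p * #|U :&: D|%:R <= eps / 4 * (2 * (p * n%:R)).
    rewrite -mulrA; apply: ler_wpM2l; first by rewrite divr_ge0 // ltW.
    apply: (@le_trans _ _ (1 * #|U :&: D|%:R)); first by apply: ler_wpM2r.
    by rewrite mul1r mulrA.
  have h4 : 6 * (p * n%:R) <= eps / 4 * (C - 2) * (p * n%:R) by rewrite ler_pM2r.
  have -> : eps / 4 * (eps * p ^+ 2 * n%:R * x + C * p * n%:R) =
     2 * (eps / 4) ^+ 2 * p * x * (2 * p * n%:R) + eps / 4 * (C - 2) * (p * n%:R) +
     eps / 4 * (2 * (p * n%:R)) by field.
  by move: h1 h2 h4; lra.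
have bS (u : 'I_n) (S : {set 'I_n}) : \sum_U \sum_D b (u, S, U, D) <=
   p ^+ #|S| * q * expR (4 * (p * n%:R)).
  rewrite /b /=; case: (boolP (u \notin S)) => [_|_] /=; last first.
    by rewrite !big1 ?mulr_ge0 ?exprn_ge0 ?expR_ge0 // => U _; rewrite big1.
  have [Sn|_] := leP #|S|%:R (2 * p * n%:R); last first.
    rewrite !big1 ?mulr_ge0 ?exprn_ge0 ?expR_ge0 // => U _; rewrite big1 // => D _.
    by rewrite !andbF.
  under eq_bigr => U _ do under eq_bigr => D _ do rewrite andbT.
  apply: (@le_trans _ _ (\sum_(U in powerset S) \sum_(D in powerset S) p ^+ #|S| * q)).
    rewrite [leRHS]big_mkcond; apply: ler_sum => U _; rewrite inE.
    case: ifPn => _ /=; last by rewrite big1.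
    by rewrite [leRHS]big_mkcond; apply: ler_sum => D _; rewrite inE.
  rewrite !sumr_const card_powerset -mulrnA -[leLHS]mulr_natr.
  apply: ler_wpM2l; first by rewrite mulr_ge0 ?exprn_ge0.
  rewrite natrM natrX.
  have h : 2 ^+ #|S| <= expR (2 * (p * n%:R)) by apply: expR_ge_natpow; rewrite mulrA.
  apply: (@le_trans _ _ (expR (2 * (p * n%:R)) * expR (2 * (p * n%:R)))).
    by apply: ler_pM; rewrite ?exprn_ge0.
  by rewrite -expRD ler_expR; lra.
have -> : \sum_i b i = \sum_u \sum_S \sum_U \sum_D b (u, S, U, D).
  rewrite !pair_bigA /=; apply: eq_bigr => -[[[u S] U] D] _ //.
apply: (@le_trans _ _ (\sum_(u : 'I_n) \sum_(S : {set 'I_n})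
    p ^+ #|S| * (q * expR (4 * (p * n%:R))))).
  by apply: ler_sum => u _; apply: ler_sum => S _; rewrite mulrA; exact: bS.
rewrite sumr_const card_ord -[leLHS]mulr_natl -mulr_suml.
have -> : \sum_(S : {set 'I_n}) p ^+ #|S| = (p + 1) ^+ n.
  rewrite -[in RHS](card_ord n) -cardsT -sum_subset_exp.
  by apply: eq_bigl => S; rewrite finset.subsetT.
have h5 : (p + 1) ^+ n <= expR (p * n%:R).
  rewrite mulrC expRM_natl; apply: lerXn2r; rewrite ?nnegrE ?expR_ge0 ?addr_ge0 //.
  by rewrite addrC expR_ge1Dx.
have -> : 2 * n%:R * expR (- (p * n%:R)) =
    n%:R * (expR (p * n%:R) * (q * expR (4 * (p * n%:R)))).
  rewrite /q [2 * n%:R]mulrC -!mulrA; congr (_ * _).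
  rewrite [RHS]mulrCA; congr (_ * _); rewrite -!expRD; congr expR; ring.
by rewrite ler_pM2l //; apply: ler_wpM2r h5; rewrite mulr_ge0 ?expR_ge0.
Qed.

End Properties.

(** * Union bound over the edges exposed by a sample *)

Section Concentration.
Variables (R : realType) (n : nat) (p : R).
Hypotheses (n0 : (0 < n)%N) (p0 : 0 < p) (p1 : p <= 1).

Definition fibred (X : {set 'I_n}) (F : 'I_n -> {set 'I_n}) : {set 'I_n * 'I_n} :=
  [set xy | (xy.1 \in X) && (xy.2 \in F xy.1)].

Lemma ordcount_fibred (G : {set {set 'I_n}}) X F :
  ordcount (fibred X F) G = (\sum_(x in X) #|nbr G x :&: F x|)%N.
Proof.
rewrite /ordcount -sum1_card big_mkcond.
have -> : (\sum_i (if i \in [set xy in fibred X F | [set xy.1; xy.2] \in G] then 1 else 0) =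
    \sum_x \sum_y (if [&& x \in X, y \in F x & [set x; y] \in G] then 1 else 0))%N.
  by rewrite pair_bigA; apply: eq_bigr => -[x y] _; rewrite !inE /= andbA.
rewrite [RHS]big_mkcond; apply: eq_bigr => x _.
case: (x \in X) => /=; last by rewrite big1.
by rewrite -[RHS]sum1_card [RHS]big_mkcond; apply: eq_bigr => y _; rewrite !inE andbC.
Qed.

Lemma card_fibred (X : {set 'I_n}) (F : 'I_n -> {set 'I_n}) :
  #|fibred X F| = (\sum_(x in X) #|F x|)%N.
Proof.
rewrite -sum1_card big_mkcond.
have -> : (\sum_i (if i \in fibred X F then 1 else 0) =
    \sum_x \sum_y (if (x \in X) && (y \in F x) then 1 else 0))%N.
  by rewrite pair_bigA; apply: eq_bigr => -[x y] _; rewrite !inE.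
rewrite [RHS]big_mkcond; apply: eq_bigr => x _.
case: (x \in X) => /=; last by rewrite big1.
by rewrite -[RHS]sum1_card [RHS]big_mkcond.
Qed.

(** The pairs from [X] to [Q] outside [W] are not in [J], so [J \subset G] is independent of how
    many of them are edges. Summing p^|J| over sets of pairs meeting [W] gives at most exp(p w n),
    and [X] costs n^N. The expected number of edges is at most half of what is assumed, and with
    [l = 1/8] the exponent is (1/16 - 1/64) theta = 3/64 theta per unit of p n N. *)
Lemma prob_concentrated (I : finType) (W : I -> {set 'I_n})
    (Q : I -> {set {set 'I_n}} -> 'I_n -> {set 'I_n}) (theta : R) (w N : nat) :
  0 < theta -> (forall i, (#|W i| <= w)%N) ->
  gnp_prob p (fun G => ~ forall i, concentrated p G (W i) (Q i) theta N) <=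
  #|I|%:R * n%:R ^+ N *
    expR (p * (w%:R * n%:R) - 3 / 64 * theta * (p * n%:R * N%:R)).
Proof.
move=> th0 Ww; have pe := ltW p0.
have nR : 0 < n%:R :> R by rewrite ltr0n.
pose T (i : I) : {set {set 'I_n}} := [set e in pairs 'I_n | ~~ [disjoint e & W i]].
pose D : finType := (I * {set {set 'I_n}} * {set 'I_n})%type.
pose good (d : D) := [&& d.1.2 \subset T d.1.1, #|d.2| == N, [disjoint d.2 & W d.1.1] &
  [forall (u | u \in d.2), #|Q d.1.1 d.1.2 u|%:R <= theta / 2 * n%:R]].
pose F (d : D) u := Q d.1.1 d.1.2 u :\: W d.1.1.
pose A (d : D) (G : {set {set 'I_n}}) := d.1.2 \subset G /\
  theta * (p * n%:R * N%:R) / 16 <=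
  8^-1 * ((ordcount (fibred d.2 (F d)) G)%:R - p * #|offdiag (fibred d.2 (F d))|%:R).
pose q : R := expR (- (3 / 64 * theta * (p * n%:R * N%:R))).
pose b (d : D) : R := if good d then p ^+ #|d.1.2| * q else 0.
have fib2 (d : D) : good d -> #|fibred d.2 (F d)|%:R <= theta / 2 * n%:R * N%:R.
  move=> /and4P[_ /eqP XN _ /'forall_implyP hQ].
  rewrite card_fibred natr_sum -XN.
  apply: (@le_trans _ _ (\sum_(u in d.2) (theta / 2 * n%:R))).
    apply: ler_sum => u uX; apply: le_trans (hQ u uX).
    by rewrite ler_nat subset_leq_card // finset.subsetDl.
  by rewrite sumr_const -[leLHS]mulr_natr.
apply: (@le_trans _ _ (gnp_prob p (fun G => exists2 d : D, good d & A d G))).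
  apply: le_gnp_prob => // G gG /existsNP[i /existsNP[J /existsNP[X]]].
  move=> /not_implyP[JG /not_implyP[JW /not_implyP[XW /not_implyP[hX /negP]]]].
  rewrite -leqNgt => NX.
  have [Y YX YN] : exists2 Y : {set 'I_n}, Y \subset X & #|Y| = N.
    have : (0 < #|[set Y : {set 'I_n} | Y \subset X & #|Y| == N]|)%N.
      by rewrite cards_draws bin_gt0.
    by move=> /card_gt0P[Y]; rewrite in_set => /andP[YX /eqP YN]; exists Y.
  have gd : good (i, J, Y).
    apply/and4P; split => /=.
    - apply/fintype.subsetP => e eJ; rewrite inE (fintype.subsetP gG) ?JW //.
      exact: (fintype.subsetP JG).
    - by rewrite YN.
    - exact: disjointWl XW.
    - apply/'forall_implyP => u uY; have := (hX u (fintype.subsetP YX u uY)).1.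
      by rewrite card_ord.
  exists (i, J, Y) => //; split => //.
  have h1 : theta * (p * n%:R * N%:R) <= (ordcount (fibred Y (F (i, J, Y))) G)%:R.
    rewrite ordcount_fibred natr_sum.
    apply: (@le_trans _ _ (\sum_(u in Y) theta * p * n%:R)).
      by rewrite sumr_const YN -[leRHS]mulr_natr; lra.
    apply: ler_sum => u uY; have := (hX u (fintype.subsetP YX u uY)).2.
    by rewrite card_ord.
  have h2 : p * #|offdiag (fibred Y (F (i, J, Y)))|%:R <= p * (theta / 2 * n%:R * N%:R).
    rewrite ler_pM2l //; apply: le_trans (fib2 _ gd); rewrite ler_nat subset_leq_card //.
    by apply/fintype.subsetP => xy; rewrite inE => /andP[].
  by move: h1 h2; lra.
apply: (@le_trans _ _ (\sum_d b d)).
  apply: gnp_prob_bigU => // [d|d gd].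
    by rewrite /b; case: ifP => // _; rewrite mulr_ge0 ?exprn_ge0 ?expR_ge0.
  rewrite /b gd; have /and4P[/fintype.subsetP JT _ XW _] := gd.
  apply: le_trans (gnp_chernoff pe p1 _ _ _ _) _.
  - by apply/fintype.subsetP => e /JT; rewrite inE => /andP[].
  - move=> [x y]; rewrite inE /F /= in_setD => /andP[xX /andP[yW _]]; apply/negP => /JT.
    rewrite inE => /andP[_ /negP]; apply.
    rewrite disjoint_sym disjoints_subset; apply/fintype.subsetP => z zW.
    rewrite !inE negb_or; apply/andP; split; apply/eqP => zE.
      by move: XW; rewrite disjoint_sym disjoints_subset => /fintype.subsetP/(_ z zW);
         rewrite inE zE xX.
    by rewrite -zE zW in yW.
  - by rewrite ger0_norm.
  apply: ler_wpM2l; first by rewrite exprn_ge0.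
  rewrite /q ler_expR; have : p * #|fibred d.2 (F d)|%:R <= p * (theta / 2 * n%:R * N%:R).
    by rewrite ler_pM2l // fib2.
  lra.
have -> : \sum_d b d = \sum_i \sum_J \sum_X b (i, J, X).
  by rewrite !pair_bigA /=; apply: eq_bigr => -[[i J] X] _.
have hT i : \sum_J \sum_X b (i, J, X) <= (p + 1) ^+ #|T i| * (n%:R ^+ N * q).
  rewrite -sum_subset_exp mulr_suml [leRHS]big_mkcond; apply: ler_sum => J _.
  rewrite /b /good /=; case: ifPn => JT /=; last by rewrite big1.
  apply: (@le_trans _ _ (\sum_(X : {set 'I_n} | #|X| == N) p ^+ #|J| * q)).
    rewrite [leRHS]big_mkcond; apply: ler_sum => X _; case: (#|X| == N) => //=.
    by case: ifP => // _; rewrite mulr_ge0 ?exprn_ge0 ?expR_ge0.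
  rewrite sumr_const -[leLHS]mulr_natl mulrCA; apply: ler_wpM2l; first by rewrite exprn_ge0.
  apply: ler_wpM2r; first exact: expR_ge0.
  have -> : #|[pred X : {set 'I_n} | #|X| == N]| = 'C(n, N).
    by rewrite -[in RHS](card_ord n) -card_draws; apply: eq_card => X; rewrite !inE.
  by rewrite -natrX ler_nat bin_le_exp.
have cT i : (#|T i| <= w * n)%N.
  apply: (@leq_trans #|finset.setX (W i) [set: 'I_n]|); last first.
    by rewrite finset.cardsX cardsT card_ord leq_mul2r Ww orbT.
  apply: leq_trans (leq_imset_card (fun xy : 'I_n * 'I_n => [set xy.1; xy.2]) _).
  apply/subset_leq_card/fintype.subsetP => e; rewrite !inE => /andP[/cards2P[x [y [xy ->]]]].
  rewrite disjoint_sym disjoints_subset => /fintype.subsetPn[z zW].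
  rewrite !inE negbK => /orP[] /eqP zE; apply/imsetP.
    by exists (x, y) => //; rewrite finset.in_setX inE -zE zW.
  by exists (y, x); rewrite /= 1?finset.setUC // finset.in_setX inE -zE zW.
apply: (@le_trans _ _ (\sum_(i : I) expR (p * (w%:R * n%:R)) * (n%:R ^+ N * q))).
  apply: ler_sum => i _; apply: le_trans (hT i) _.
  apply: ler_wpM2r; first by rewrite mulr_ge0 ?exprn_ge0 ?expR_ge0.
  apply: (@le_trans _ _ (expR (p * #|T i|%:R))).
    rewrite mulrC expRM_natl; apply: lerXn2r; rewrite ?nnegrE ?expR_ge0 ?addr_ge0 //.
    by rewrite addrC expR_ge1Dx.
  by rewrite ler_expR ler_pM2l // -natrM ler_nat.
rewrite sumr_const -[leLHS]mulr_natl expRD -/q le_eqVlt; apply/orP; left; apply/eqP.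
by ring.
Qed.

End Concentration.

(** * From weak regularity inside [G] to densities scaled by [p] *)

Lemma card_sum_mem (R : pzSemiRingType) (V : finType) (A B : {set V}) :
  #|A :&: B|%:R = \sum_(y in B) (y \in A)%:R :> R.
Proof.
rewrite -sum1_card natr_sum [LHS]big_mkcond [RHS]big_mkcond; apply: eq_bigr => y _.
by rewrite inE; case: (y \in A); case: (y \in B).
Qed.

Lemma sum_by_cells (R : comPzSemiRingType) (V K : finType) (c : V -> K) (A B : {set V})
    (f : V -> V -> R) (d : K -> K -> R) :
  \sum_(x in A) \sum_(y in B) f x y * d (c x) (c y) =
  \sum_i \sum_j d i j * \sum_(x in [set x in A | c x == i]) \sum_(y in [set y in B | c y == j]) f x y.
Proof.
rewrite (partition_big c predT) //=; apply: eq_bigr => i _.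
transitivity (\sum_(x in [set x in A | c x == i])
    \sum_j \sum_(y in [set y in B | c y == j]) d i j * f x y); last first.
  rewrite exchange_big /=; apply: eq_bigr => j _; rewrite mulr_sumr.
  by apply: eq_bigr => x _; rewrite mulr_sumr.
rewrite [RHS](eq_bigl (fun x => (x \in A) && (c x == i))); last by move=> x; rewrite inE.
apply: eq_bigr => x /andP[_ /eqP cx]; rewrite (partition_big c predT) //=; apply: eq_bigr => j _.
rewrite [RHS](eq_bigl (fun y => (y \in B) && (c y == j))); last by move=> y; rewrite inE.
by apply: eq_bigr => y /andP[_ /eqP cy]; rewrite cx cy mulrC.
Qed.

Section CutApprox.
Variables (R : realType) (V K : finType) (M : nat) (G H : {set {set V}}) (p eps C : R).
Variables (c : {ffun V -> K}) (D : {ffun K * K -> 'I_M.+1}).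
Local Notation n := (#|V|%:R : R).

(** Weak regularity compares [H] with the weights summed over edges of [G]. On a pair of cells the
    weight is constant, so discrepancy replaces the edges of [G] there by [p] times all pairs, at a
    cost paid once per pair of cells. *)
Lemma cut_approx : (0 < #|V|)%N -> (0 < M)%N -> 0 < p -> 0 <= eps -> 0 <= C ->
  H \subset G -> degree_bound G p -> discrepancy G p eps C ->
  @cut_good R V (fun x y => y \in nbr G x) (fun x y => y \in nbr H x) M K c D ->
  forall A B : {set V},
  `|(ebt H A B)%:R - p * \sum_(x in A) cell_sum R c D B x| <=
     2 / M%:R * (p * n ^+ 2) + #|K|%:R ^+ 2 * (eps * p * n * n + C * n).
Proof.
move=> V0 M0 p0 eps0 C0 HG deg dis good A B.
have MR : 0 < M%:R :> R by rewrite ltr0n.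
have n0 : 0 < n by rewrite ltr0n.
pose Ac (X : {set V}) i := [set x in X | c x == i].
pose d i j : R := (D (i, j))%:R / M%:R.
have massE : \sum_x \sum_y (y \in nbr G x)%:R <= 2 * (p * n ^+ 2) :> R.
  apply: (@le_trans _ _ (\sum_(x : V) 2 * p * n)); last first.
    by rewrite sumr_const -[leLHS]mulr_natr expr2; lra.
  apply: ler_sum => x _; apply: le_trans (deg x).
  have := card_sum_mem R (nbr G x) [set: V]; rewrite finset.setIT => ->; rewrite le_eqVlt; apply/orP; left; apply/eqP.
  by apply: eq_bigl => y; rewrite inE.
pose S := \sum_i \sum_j d i j * (ebt G (Ac A i) (Ac B j))%:R.
have devE : cut_dev R (fun x y => y \in nbr G x) (fun x y => y \in nbr H x) c D A B =
    (ebt H A B)%:R - S.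
  have -> : S = \sum_(x in A) \sum_(y in B) (y \in nbr G x)%:R * d (c x) (c y).
    rewrite sum_by_cells; apply: eq_bigr => i _; apply: eq_bigr => j _; congr (_ * _).
    by rewrite /ebt natr_sum; apply: eq_bigr => x _; exact: card_sum_mem.
  rewrite /ebt natr_sum -sumrB; apply: eq_bigr => x _.
  rewrite card_sum_mem -sumrB; apply: eq_bigr => y _; rewrite /step_dev mulrBr; congr (_ - _).
  case: (boolP (y \in nbr H x)) => [/(fintype.subsetP (nbrS x HG)) ->|_]; rewrite ?mulr0 //.
  by rewrite mulr1.
have cellE : p * \sum_(x in A) cell_sum R c D B x =
    \sum_i \sum_j d i j * (p * #|Ac A i|%:R * #|Ac B j|%:R).
  have -> : p * \sum_(x in A) cell_sum R c D B x =
     \sum_(x in A) \sum_(y in B) p * d (c x) (c y).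
    by rewrite mulr_sumr; apply: eq_bigr => x _; rewrite mulr_sumr.
  rewrite (sum_by_cells c A B (fun _ _ => p) d).
  apply: eq_bigr => i _; apply: eq_bigr => j _; congr (_ * _).
  by rewrite !sumr_const -mulrnA -[LHS]mulr_natr natrM; ring.
have cellB : `|S - p * \sum_(x in A) cell_sum R c D B x| <=
    #|K|%:R ^+ 2 * (eps * p * n * n + C * n).
  rewrite cellE -sumrB; apply: le_trans (ler_norm_sum _ _ _) _.
  apply: (@le_trans _ _ (\sum_(i : K) #|K|%:R * (eps * p * n * n + C * n))); last first.
    by rewrite sumr_const -[leLHS]mulr_natl expr2 !mulrA.
  apply: ler_sum => i _; rewrite -sumrB; apply: le_trans (ler_norm_sum _ _ _) _.
  apply: (@le_trans _ _ (\sum_(j : K) (eps * p * n * n + C * n))); last first.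
    by rewrite sumr_const -[leLHS]mulr_natl.
  apply: ler_sum => j _; rewrite -mulrBr normrM.
  have /andP[d0 d1] := grid_itv R (D (i, j)).
  rewrite ger0_norm // -[leRHS]mul1r; apply: ler_pM => //.
  apply: le_trans (dis _ _) _; rewrite lerD2r; apply: ler_wpM2l; last by rewrite ler_nat max_card.
  by rewrite !mulr_ge0 // ltW.
have -> : (ebt H A B)%:R - p * \sum_(x in A) cell_sum R c D B x =
   ((ebt H A B)%:R - S) + (S - p * \sum_(x in A) cell_sum R c D B x) by ring.
apply: le_trans (ler_normD _ _) _; apply: lerD => //; rewrite -devE.
apply: le_trans (good A B) _; rewrite ler_pdivrMr //.
by have -> : 2 / M%:R * (p * n ^+ 2) * M%:R = 2 * (p * n ^+ 2) by field; rewrite gt_eqF.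
Qed.

End CutApprox.

(** * Random colourings, edge counts and degrees *)

Lemma random_colouring (R : realType) (V : finType) (r : nat) (H : {set {set V}}) :
  (0 < r)%N -> is_graph H ->
  exists f : {ffun V -> 'I_r}, r%:R * #|monochromatic H f|%:R <= #|H|%:R :> R.
Proof.
move=> r0 gH; have rR : 0 < r%:R :> R by rewrite ltr0n.
pose mono (f : {ffun V -> 'I_r}) (e : {set V}) :=
  [exists x, [exists y, (e == [set x; y]) && (f x == f y)]].
have [||f Hf] := @exists_few_bad R _ {ffun V -> 'I_r} H mono r%:R^-1.
- by rewrite card_ffun card_ord expn_gt0 r0.
- move=> e /(fintype.subsetP gH); rewrite inE => /cards2P[x [y [xy ->]]].
  pose B := [set f : {ffun V -> 'I_r} | f x == f y].
  have sub : [set f | mono f [set x; y]] \subset B.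
    apply/fintype.subsetP => f; rewrite !in_set => /existsP[a /existsP[b /andP[/eqP E /eqP fab]]].
    have : x \in [set a; b] by rewrite -E !inE eqxx.
    have : y \in [set a; b] by rewrite -E !inE eqxx orbT.
    by rewrite !inE => /orP[] /eqP-> /orP[] /eqP->; rewrite ?fab.
  apply: (@le_trans _ _ #|B|%:R); first by rewrite ler_nat subset_leq_card.
  rewrite ler_pdivlMl // -natrM ler_nat.
  (* Recolouring [x] arbitrarily is injective on pairs of a colour and a colouring with f(x) = f(y),
     since the old f(x) can be read off at [y]. So such colourings are at most a proportion 1/r. *)
  pose h (kf : 'I_r * {ffun V -> 'I_r}) := [ffun v => if v == x then kf.1 else kf.2 v].
  have <- : #|h @: finset.setX [set: 'I_r] B| = (r * #|B|)%N.
    rewrite card_in_imset; first by rewrite finset.cardsX cardsT card_ord.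
    move=> [k f] [k' f'] /finset.setXP[_]; rewrite in_set => /eqP fxy.
    move=> /finset.setXP[_]; rewrite in_set => /eqP fxy' E.
    have ev v : h (k, f) v = h (k', f') v by rewrite E.
    have -> : k = k' by have := ev x; rewrite !ffunE eqxx.
    congr (_, _); apply/ffunP => v; have := ev v; rewrite !ffunE /=.
    have [->|//] := eqVneq v x; move=> _.
    by have := ev y; rewrite !ffunE /= eq_sym (negbTE xy) fxy fxy'.
  by rewrite max_card.
- exists f; rewrite -ler_pdivlMl //; apply: le_trans Hf; rewrite ler_nat subset_leq_card //.
Qed.

Lemma double_edges (n : nat) (H : {set {set 'I_n}}) : is_graph H ->
  (2 * #|H| <= ebt H [set: 'I_n] [set: 'I_n])%N.
Proof.
move=> gH; rewrite ebt_ordcount /ordcount -[leqRHS]sum1_card.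
rewrite (partition_big (fun xy : 'I_n * 'I_n => [set xy.1; xy.2]) (fun e => e \in H)) /=; last first.
  by move=> xy; rewrite inE => /andP[].
rewrite mulnC -sum_nat_const; apply: leq_sum => e eH; rewrite sum1_card.
have := fintype.subsetP gH e eH; rewrite inE => /cards2P[x [y [xy eE]]].
apply: (@leq_trans #|[set (x, y); (y, x)]|).
  by rewrite cards2 xpair_eqE (negbTE xy).
apply/subset_leq_card/fintype.subsetP => ab; rewrite !inE unfold_in.
by move=> /orP[] /eqP-> /=; rewrite !inE /= -?eE ?eH ?eqxx //= finset.setUC -eE eH eqxx.
Qed.

Lemma nbr_card_degree (V : finType) (E : {set {set V}}) (v : V) : is_graph E ->
  (degree E v <= #|nbr E v|)%N.
Proof.
move=> gE; apply: leq_trans (leq_imset_card (fun y => [set v; y]) (nbr E v)).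
apply/subset_leq_card/fintype.subsetP => e; rewrite in_set => /andP[eE ve].
have := fintype.subsetP gE e eE; rewrite inE => /cards2P[x [y [xy eq]]].
move: ve eE; rewrite eq !inE => /orP[] /eqP-> h; apply/imsetP.
  by exists y; rewrite ?in_nbr.
by exists x; rewrite ?in_nbr finset.setUC.
Qed.

Lemma min_degree_le (V : finType) (E : {set {set V}}) (v : V) : (min_degree E <= degree E v)%N.
Proof.
rewrite /min_degree; have : v \in index_enum V by rewrite mem_index_enum.
elim: (index_enum V) => // a s IH; rewrite inE big_cons => /orP[/eqP->|/IH h].
  exact: geq_minl.
by apply: leq_trans (geq_minr _ _) h.
Qed.

(** * Choice of constants *)

Lemma cell_type_gt0 t : (0 < #|cell_type t|)%N.
Proof. by elim: t => [|t IH]; rewrite ?card_unit // !card_prod card_bool !muln_gt0 IH. Qed.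

Section RealBounds.
Variable R : realType.
Implicit Types (x y nu : R).

Lemma expRN_le x : 0 < x -> expR (- x) <= x^-1.
Proof.
move=> x0; rewrite expRN lef_pV2 ?posrE ?expR_gt0 //.
by apply: le_trans (expR_ge1Dx _); rewrite lerDr.
Qed.

(** Used with x = p n, where n <= x^2 once p^2 n >= 1: it lets exp(nu p n) absorb a factor n. A
    fourth power is taken because x^4 >= n^2. *)
Lemma nat_le_expR (n : nat) nu x : 0 < nu -> 0 <= x -> n%:R <= x ^+ 2 -> 256 / nu ^+ 4 <= n%:R ->
  n%:R <= expR (nu * x).
Proof.
move=> nu0 x0 nx nn.
have -> : nu * x = 4%:R * (nu * x / 4) by field.
rewrite expRM_natl; apply: (@le_trans _ _ ((nu * x / 4) ^+ 4)); last first.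
  apply: lerXn2r; rewrite ?nnegrE ?expR_ge0 ?divr_ge0 ?mulr_ge0 ?(ltW nu0) //.
  by apply: le_trans (expR_ge1Dx _); rewrite lerDr.
have -> : (nu * x / 4) ^+ 4 = nu ^+ 4 / 256 * (x ^+ 2 * x ^+ 2) by field.
have nu4 : 0 < nu ^+ 4 by rewrite exprn_gt0.
apply: (@le_trans _ _ (nu ^+ 4 / 256 * (n%:R * n%:R))).
  rewrite mulrA -[leLHS]mul1r; apply: ler_wpM2r => //.
  move: nn; rewrite ler_pdivrMr // => nn.
  by rewrite mulrAC ler_pdivlMr // mul1r mulrC.
apply: ler_wpM2l; first by rewrite divr_ge0 // ltW.
by apply: ler_pM.
Qed.

(** Sets the number of data (t, t', Z, c, D), of sets [X] and of exposed edges against the tail in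
    [prob_concentrated]. The bound on [n] makes n^N cost a third of the gain, and [CN] is such that
    the remaining e p n N / 32 exceeds all other costs, which are O(n/p). *)
Lemma data_bound (n m N k M : nat) (p e T CN : R) :
  (0 < n)%N -> 0 < p -> p <= 1 -> 0 < e -> e <= 1 -> 0 < T ->
  n%:R <= expR (e / 64 * (p * n%:R)) ->
  m%:R <= 2 * T / p ^+ 2 -> CN / p ^+ 2 <= N%:R ->
  CN = 32 / e * (8 * T + k%:R + M.+1%:R * (k * k)%:R + 2) ->
  (n ^ m * n ^ m * 2 ^ n * k ^ n * M.+1 ^ (k * k))%:R * n%:R ^+ N *
    expR (p * ((m + m)%:R * n%:R) - 3 / 64 * e * (p * n%:R * N%:R)) <= expR (- n%:R).
Proof.
move=> n0 p0 p1 e0 e1 T0 nexp mT NC; move: (k * k)%N => kk CNE.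
have nR : 0 < n%:R :> R by rewrite ltr0n.
have xe (x : R) : x <= expR x by apply: le_trans (expR_ge1Dx _); rewrite lerDr.
have pw (x y : R) j : 0 <= x -> x <= expR y -> x ^+ j <= expR (j%:R * y).
  by move=> x0 xy; rewrite expRM_natl; apply: lerXn2r; rewrite ?nnegrE ?expR_ge0.
set y := e / 64 * (p * n%:R) in nexp.
have b1 := pw _ _ m (ltW nR) nexp; have b2 := pw _ _ N (ltW nR) nexp.
have b3 : 2 ^+ n <= expR (n%:R * 1) :> R by apply: pw => //; have := expR_ge1Dx (1 : R).
have b4 : k%:R ^+ n <= expR (n%:R * k%:R) :> R by apply: pw.
have b5 : M.+1%:R ^+ kk <= expR (kk%:R * M.+1%:R) :> R by apply: pw.
apply: (@le_trans _ _ (expR (m%:R * y) * expR (m%:R * y) * expR (n%:R * 1) *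
   expR (n%:R * k%:R) * expR (kk%:R * M.+1%:R) * expR (N%:R * y) *
   expR (p * ((m + m)%:R * n%:R) - 3 / 64 * e * (p * n%:R * N%:R)))).
  apply: ler_wpM2r; first exact: expR_ge0.
  rewrite !natrM !natrX.
  by repeat (apply: ler_pM; rewrite ?mulr_ge0 ?exprn_ge0 //).
rewrite -!expRD ler_expR.
have np : n%:R <= n%:R / p by rewrite ler_pdivlMr // ler_piMr // ltW.
have np1 : 1 <= n%:R / p by apply: le_trans np; rewrite ler1n.
have h1 : m%:R * (p * n%:R) <= 2 * T * (n%:R / p).
  have -> : 2 * T * (n%:R / p) = 2 * T / p ^+ 2 * (p * n%:R) by field; rewrite gt_eqF.
  by apply: ler_wpM2r => //; rewrite mulr_ge0 // ltW.
have h2 : m%:R * y <= m%:R * (p * n%:R).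
  apply: ler_wpM2l => //; rewrite /y ler_piMl ?mulr_ge0 // ?(ltW p0) //.
  by rewrite ler_pdivrMr //; lra.
have h3 : CN * (n%:R / p) <= N%:R * (p * n%:R).
  have -> : CN * (n%:R / p) = CN / p ^+ 2 * (p * n%:R) by field; rewrite gt_eqF.
  by apply: ler_wpM2r => //; rewrite mulr_ge0 // ltW.
have h4 : e / 32 * (CN * (n%:R / p)) <= e / 32 * (N%:R * (p * n%:R)).
  by rewrite ler_pM2l // divr_gt0.
have h5 : e / 32 * (CN * (n%:R / p)) = (8 * T + k%:R + M.+1%:R * kk%:R + 2) * (n%:R / p).
  by rewrite CNE; field; rewrite !gt_eqF.
have h6 : n%:R * k%:R <= k%:R * (n%:R / p) by rewrite mulrC ler_wpM2l.
have h7 : kk%:R * M.+1%:R <= M.+1%:R * kk%:R * (n%:R / p) :> R.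
  by rewrite mulrC ler_peMr // mulr_ge0.
rewrite h5 in h4.
have -> : N%:R * y = e / 64 * (N%:R * (p * n%:R)) by rewrite /y; ring.
have -> : p * ((m + m)%:R * n%:R) - 3 / 64 * e * (p * n%:R * N%:R) =
   2 * (m%:R * (p * n%:R)) - 3 / 64 * e * (N%:R * (p * n%:R)) by rewrite natrD; ring.
move: h1 h2 h4 h6 h7 np.
set a := m%:R * (p * n%:R); set b := N%:R * (p * n%:R); set w := n%:R / p.
set s := _%:R * M.+1%:R; set s' := M.+1%:R * _.
lra.
Qed.

Lemma ceil_nat (x : R) : 1 <= x -> exists m : nat, [/\ (0 < m)%N, x <= m%:R & m%:R <= 2 * x].
Proof.
move=> x1; have x0 : 0 <= x by apply: le_trans x1.
exists (Num.truncn x).+1; split => //; have /andP[h1 h2] := truncn_itv x0.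
  exact: ltW.
by rewrite -natr1; lra.
Qed.

End RealBounds.

(** * The range where [p^2 n] is large *)

Definition partite_after_removal (R : realType) (n r : nat) (b : R) (H : {set {set 'I_n}}) : Prop :=
  exists F : {set {set 'I_n}},
    [/\ F \subset H, partite r (H :\: F) & #|F|%:R <= b].

(** The number [r] of colours is the number of profiles. [CA <= gamma * K0] ensures that
    [CA * n / p] is also at most gamma p n^2 in this range, so a single bound settles the
    minimum. *)
Lemma dense_range (R : realType) (gamma : R) : 0 < gamma -> gamma <= 10^-1 ->
  exists (CA K0 : R) (r n1 : nat), [/\ (0 < r)%N, 0 <= CA, 1 <= K0, CA <= gamma * K0 &
  forall (n : nat) (p : R), (n1 <= n)%N -> 0 < p -> p <= 1 -> K0 <= p ^+ 2 * n%:R ->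
    gnp_prob p (fun G : {set {set 'I_n}} => ~ forall H : {set {set 'I_n}},
        H \subset G -> triangle_free H ->
        (forall u, (3^-1 + gamma) * p * n%:R <= #|nbr H u|%:R) ->
        partite_after_removal r (CA * n%:R / p) H) <= 40 / (p * n%:R)].
Proof.
move=> gam0 gam1.
have [g gE] : exists x : R, x = gamma / 4 by eexists.
have [tau tauE] : exists x : R, x = gamma / 12 by eexists.
have [e eE] : exists x : R, x = tau * g / 64 by eexists.
have [e2 e2E] : exists x : R, x = gamma / 48 by eexists.
have g0 : 0 < g by rewrite gE divr_gt0.
have tau0 : 0 < tau by rewrite tauE divr_gt0.
have e0 : 0 < e by rewrite eE !mulr_gt0.
have eE' : e = gamma * gamma / 3072 by rewrite eE tauE gE; field.
have gg : gamma * gamma <= 10^-1 * gamma by rewrite ler_pM2r.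
have e1 : e <= 1 by rewrite eE'; move: gg gam1; goal_lra.
have eg : e <= gamma / 10000 by rewrite eE'; move: gg gam0; goal_lra.
have e20 : 0 < e2 by rewrite e2E divr_gt0.
have [kap kapE] : exists x : R, x = e ^+ 2 / 16 by eexists.
have kap0 : 0 < kap by rewrite kapE divr_gt0 // exprn_gt0.
have kape : kap <= e / 16.
  by rewrite kapE expr2; apply: ler_wpM2r => //; rewrite -[leRHS]mul1r ler_pM2r.
(* [M >= 4 / kap], and below [eps = kap / (4 k^2)], allot kap / 2 to each of the two errors in
   [cut_approx]. *)
have [M [M0 M4 _]] : exists M : nat, [/\ (0 < M)%N, 4 / kap <= M%:R & M%:R <= 2 * (4 / kap)].
  by apply: ceil_nat; rewrite ler_pdivlMr //; move: kape e1; goal_lra.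
pose K := cell_type (M ^ 2).
have k1 : 1 <= #|K|%:R :> R by rewrite ler1n cell_type_gt0.
set k := #|K| in k1.
have k0 : 0 < k%:R :> R by apply: lt_le_trans k1.
have [eps epsE] : exists x : R, x = kap / (4 * k%:R ^+ 2) by eexists.
have eps0 : 0 < eps by rewrite epsE divr_gt0 // mulr_gt0 // exprn_gt0.
have epsk : k%:R ^+ 2 * eps = kap / 4 by rewrite epsE; field; rewrite gt_eqF.
have epskap : eps <= kap / 4.
  by rewrite -epsk ler_peMl ?(ltW eps0) // -[leLHS]mulr1 expr2; apply: ler_pM.
have [e3 e3E] : exists x : R, x = tau / (2 * k%:R) by eexists.
have e30 : 0 < e3 by rewrite e3E divr_gt0 // mulr_gt0.
pose L := Num.truncn (2 / e3).
have L2 : 2 / e3 < L.+1%:R.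
  by have /truncn_itv/andP[] : 0 <= 2 / e3 by rewrite divr_ge0 // ltW.
have ke3 : k%:R * e3 <= tau / 2 by rewrite e3E le_eqVlt; apply/orP; left; apply/eqP; field; rewrite gt_eqF.
(* [C] and later [C1] make eps / 4 * (C - 1) = 4 and eps1 / 4 * (C1 - 2) = 6, as the two discrepancy
   tails ask. *)
have [C CE] : exists x : R, x = 1 + 16 / eps by eexists.
have C0 : 0 <= C by rewrite CE addr_ge0 // divr_ge0 // ltW.
have [eps1 eps1E] : exists x : R, x = gamma / 12 by eexists.
have eps10 : 0 < eps1 by rewrite eps1E divr_gt0.
have [C1 C1E] : exists x : R, x = 2 + 24 / eps1 by eexists.
have C10 : 0 <= C1 by rewrite C1E addr_ge0 // divr_ge0 // ltW.
(* The samples have size about T / p^2. With this [T], e^2 / 32 * T = 32 / e, and exp(-32 / e) <= e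
   / 32 meets both exponential conditions. *)
have [T TE] : exists x : R, x = 1024 / e ^+ 3 by eexists.
have T0 : 0 < T by rewrite TE divr_gt0 ?ltr0n ?exprn_gt0.
have T1 : 1 <= T.
  rewrite TE ler_pdivlMr ?exprn_gt0 // mul1r; apply: (@le_trans _ _ 1); last by rewrite ler1n.
  by rewrite exprn_ile1 // ltW.
have [CN CNE] : exists x : R, x = 32 / e * (8 * T + k%:R + M.+1%:R * (k * k)%:R + 2) by eexists.
have CN1 : 1 <= CN.
  rewrite CNE -[leLHS]mulr1; apply: ler_pM => //.
    by rewrite ler_pdivlMr // mul1r; apply: le_trans e1 _; rewrite ler1n.
  by have : 0 <= M.+1%:R * (k * k)%:R :> R by []; move: k1 T1; goal_lra.
have [CT CTE] : exists x : R, x = 3 * (4 * CN + 4 * T + C / eps) by eexists.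
pose r := #|{: {ffun K -> 'I_L.+1}}|.
have r0 : (0 < r)%N by rewrite /r card_ffun card_ord expn_gt0.
have [B BE] : exists x : R, x = 2 * C / eps + 4 * CT + (3 * C1 + 4 * C / eps) / gamma by eexists.
have Ce0 : 0 <= C / eps by rewrite divr_ge0 // ltW.
have CT0 : 0 <= CT by rewrite CTE; move: CN1 T1 Ce0; goal_lra.
have B0 : 0 <= B.
  have h1 : 0 <= 3 * C1 + 4 * C / eps by rewrite -[4 * C / eps]mulrA; move: C10 Ce0; goal_lra.
  have h2 : 0 <= (3 * C1 + 4 * C / eps) / gamma by rewrite divr_ge0 // ltW.
  by rewrite BE -[2 * C / eps]mulrA; move: h2 CT0 Ce0; goal_lra.
have [CA CAE] : exists x : R, x = r%:R * B by eexists.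
have CA0 : 0 <= CA by rewrite CAE mulr_ge0.
(* The summands serve, in this order, n <= (p n)^2, C <= eps p^2 n, the smallness of the sample
   compared with n, and [CA <= gamma * K0]. *)
have [K0 K0E] : exists x : R, x = 1 + C / eps + 8 * T / e + CA / gamma by eexists.
have Te0 : 0 <= 8 * T / e by rewrite divr_ge0 ?mulr_ge0 // ltW.
have CAg0 : 0 <= CA / gamma by rewrite divr_ge0 // ltW.
have [nu nuE] : exists x : R, x = e / 64 by eexists.
have nu0 : 0 < nu by rewrite nuE divr_gt0.
(* 1024 gives p n >= 32, and 256 / nu^4 is the threshold of [nat_le_expR]. *)
have [n1 [n1_gt0 n1E _]] : exists m : nat, [/\ (0 < m)%N, 1024 + 256 / nu ^+ 4 <= m%:R &
    m%:R <= 2 * (1024 + 256 / nu ^+ 4)].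
  apply: ceil_nat; have : 0 <= 256 / nu ^+ 4 by rewrite divr_ge0 ?ler0n ?exprn_ge0 // ltW.
  by goal_lra.
exists CA, K0, r, n1; split => //.
- by rewrite K0E; move: Ce0 Te0 CAg0; goal_lra.
- rewrite -ler_pdivrMl // mulrC K0E; move: Ce0 Te0; goal_lra.
move=> n p nn1 p0 p1 pK.
have n0 : (0 < n)%N by apply: leq_trans nn1.
have nR : 0 < n%:R :> R by rewrite ltr0n.
have p20 : 0 < p ^+ 2 by rewrite exprn_gt0.
set y := p * n%:R.
have y0 : 0 < y by rewrite mulr_gt0.
have yn : y <= n%:R by rewrite /y ler_piMl // ltW.
have y2n : n%:R <= y ^+ 2.
  have -> : y ^+ 2 = p ^+ 2 * n%:R * n%:R by rewrite /y; ring.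
  by rewrite ler_peMl //; apply: le_trans pK; rewrite K0E; move: Ce0 Te0 CAg0; goal_lra.
have nbig : 1024 + 256 / nu ^+ 4 <= n%:R by apply: le_trans n1E _; rewrite ler_nat.
have nu4 : 0 <= 256 / nu ^+ 4 by rewrite divr_ge0 ?ler0n ?exprn_ge0 // ltW.
have nexp : n%:R <= expR (nu * y) by apply: nat_le_expR => //; [exact: ltW | move: nbig nu4; goal_lra].
have y32 : 32 <= y.
  rewrite -(@ler_pXn2r _ 2) ?nnegrE // ?(ltW y0) //; apply: le_trans y2n.
  by move: nbig nu4; rewrite expr2; goal_lra.
have Tp1 : 1 <= T / p ^+ 2.
  by rewrite ler_pdivlMr // mul1r; apply: le_trans T1; rewrite exprn_ile1 // ltW.
have CNp1 : 1 <= CN / p ^+ 2.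
  by rewrite ler_pdivlMr // mul1r; apply: le_trans CN1; rewrite exprn_ile1 // ltW.
have [m [m0 mT Tm]] := ceil_nat Tp1.
have [N [N0 NC CNN]] := ceil_nat CNp1.
pose I : finType := ({ffun 'I_m -> 'I_n} * {ffun 'I_m -> 'I_n} * {set 'I_n} *
  {ffun 'I_n -> K} * {ffun K * K -> 'I_M.+1})%type.
have cardI : #|I| = (n ^ m * n ^ m * 2 ^ n * k ^ n * M.+1 ^ (k * k))%N.
  by rewrite !card_prod !card_ffun card_set_type !card_ord card_prod.
pose W (i : I) := sampled i.1.1.1.1 i.1.1.1.2.
pose Q1 (i : I) J u := missed J i.1.1.1.1 i.1.1.2 u.
pose Q2 (i : I) J u := deficient p J i.1.1.1.1 i.1.1.1.2 i.1.1.2 i.1.2 i.2 e u.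
have WI i : (#|W i| <= m + m)%N by exact: card_sampled.
pose bad (G : {set {set 'I_n}}) := ~ degree_bound G p \/ (~ discrepancy G p eps C \/
  ((degree_bound G p /\ ~ local_discrepancy G p eps1 C1) \/
  ((~ forall i, concentrated p G (W i) (Q1 i) (g / 2) N) \/
   (~ forall i, concentrated p G (W i) (Q2 i) e N)))).
apply: (@le_trans _ _ (gnp_prob p bad)).
  apply: le_gnp_prob; rewrite ?(ltW p0) // => G gG; apply: contra_notP.
  move=> /not_orP[/contrapT deg /not_orP[/contrapT dis /not_orP[nloc]]].
  move=> /not_orP[/contrapT conc1 /contrapT conc2] H HG tf mind.
  have loc : local_discrepancy G p eps1 C1 by apply: contrapT => h; apply: nloc.
  have cn : #|'I_n|%:R = n%:R :> R by rewrite card_ord.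
  have V0 : (0 < #|'I_n|)%N by rewrite card_ord.
  have hC : C <= eps * p ^+ 2 * #|'I_n|%:R.
    rewrite cn -mulrA -ler_pdivrMl // mulrC; apply: le_trans pK; rewrite K0E.
    by move: Te0 CAg0; goal_lra.
  have [c [D good]] := @weak_regularity R 'I_n (fun x y => y \in nbr G x)
    (fun x y => y \in nbr H x) M M0.
  have cut := cut_approx V0 M0 p0 (ltW eps0) C0 HG deg dis good.
  exists (monochromatic H (profile H c p L e3)); split.
  - by apply/fintype.subsetP => f; rewrite in_set => /andP[].
  - exact: monochromatic_partite.
  - rewrite CAE BE -cn.
    apply: (@few_monochromatic R 'I_n K M m N L G H c D p gamma eps C eps1 C1 CT kap tau g e
      (e / 8) e2 e3) => //.
    + by move: epskap kape eg gam0; goal_lra.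
    + by rewrite eps1E.
    + by move: eg gam0; rewrite gE; goal_lra.
    + have -> : kap / e2 = e * (e * (3 / gamma)) by rewrite kapE e2E; field; rewrite gt_eqF.
      have h : e * (3 / gamma) <= 3 / 10000.
        by rewrite mulrCA mulrA ler_pdivrMr //; move: eg; goal_lra.
      have : e * (e * (3 / gamma)) <= e * (3 / 10000) by rewrite ler_pM2l.
      rewrite tauE e2E; move: epskap kape eg gam0; goal_lra.
    + by rewrite divr_gt0.
    + by move: epskap kape e1 e0; goal_lra.
    + by rewrite kapE.
    + have -> : e / 8 / 4 = (32 / e)^-1 by field; rewrite gt_eqF.
      apply: le_trans (_ : expR (- (32 / e)) <= _); last by apply: expRN_le; rewrite divr_gt0.
      rewrite ler_expR lerN2.
      have h1 : T <= p ^+ 2 * m%:R by rewrite mulrC -ler_pdivrMr.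
      have h2 : tau / 32 * T <= tau / 32 * (p ^+ 2 * m%:R) by rewrite ler_pM2l // divr_gt0.
      apply: le_trans h2.
      have -> : 32 / e = e ^+ 2 / 32 * T by rewrite TE; field; rewrite gt_eqF.
      apply: ler_wpM2r; first exact: ltW.
      apply: ler_wpM2r => //; apply: (@le_trans _ _ e).
        by rewrite expr2 -[leRHS]mul1r ler_pM2r.
      by move: eg gam0; rewrite tauE; goal_lra.
    + have -> : e / 32 = (32 / e)^-1 by field; rewrite gt_eqF.
      apply: le_trans (_ : expR (- (32 / e)) <= _); last by apply: expRN_le; rewrite divr_gt0.
      rewrite ler_expR lerN2.
      have h1 : T <= p ^+ 2 * m%:R by rewrite mulrC -ler_pdivrMr.
      have h3 : p ^+ 2 * m%:R <= p * m%:R.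
        by apply: ler_wpM2r => //; rewrite expr2 ler_piMl // ltW.
      have -> : 32 / e = e ^+ 2 / 32 * T by rewrite TE; field; rewrite gt_eqF.
      apply: ler_wpM2l; first by rewrite divr_ge0 // exprn_ge0 // ltW.
      exact: le_trans h3.
    + rewrite cn; have h1 : 2 * m%:R <= e / 2 * n%:R.
        apply: (@le_trans _ _ (4 * T / p ^+ 2)); first by move: Tm; goal_lra.
        rewrite ler_pdivrMr //; have : 8 * T / e <= p ^+ 2 * n%:R.
          by apply: le_trans pK; rewrite K0E; move: Ce0 CAg0; goal_lra.
        by rewrite ler_pdivrMr //; goal_lra.
      have h2 : eps * n%:R <= e / 4 * n%:R.
        by apply: ler_wpM2r => //; move: epskap kape e0; goal_lra.
      by move: h1 h2; goal_lra.
    + rewrite CTE ler_pdivlMr //.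
      have h1 : N%:R * p ^+ 2 <= 2 * CN.
        by move: CNN; rewrite mulrA ler_pdivlMr.
      have h2 : m%:R * p ^+ 2 <= 2 * T.
        by move: Tm; rewrite mulrA ler_pdivlMr.
      have h3 : C / (eps * p) * p ^+ 2 <= C / eps.
        have -> : C / (eps * p) * p ^+ 2 = C / eps * p by field; rewrite !gt_eqF.
        by rewrite ler_piMr.
      by move: h1 h2 h3; goal_lra.
    + move=> A1 B1; apply: le_trans (cut A1 B1) _; rewrite cn -/k.
      have h1 : 2 / M%:R * (p * n%:R ^+ 2) <= kap / 2 * (p * n%:R ^+ 2).
        apply: ler_wpM2r; first by rewrite mulr_ge0 ?exprn_ge0 // ltW.
        rewrite ler_pdivrMr ?ltr0n //; move: M4; rewrite ler_pdivrMr //; goal_lra.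
      have h2 : C * n%:R <= eps * (p * n%:R ^+ 2).
        have h3 : C <= eps * (p * n%:R).
          apply: le_trans hC _; rewrite cn -mulrA ler_pM2l //.
          by apply: ler_wpM2r => //; rewrite expr2 ler_piMl // ltW.
        by move: h3; rewrite -(ler_pM2r nR) expr2; goal_lra.
      have h3 : k%:R ^+ 2 * (eps * p * n%:R * n%:R + C * n%:R) <=
          k%:R ^+ 2 * (2 * eps * (p * n%:R ^+ 2)).
        by rewrite ler_pM2l ?exprn_gt0 //; move: h2; rewrite expr2; goal_lra.
      have h4 : k%:R ^+ 2 * (2 * eps * (p * n%:R ^+ 2)) = kap / 2 * (p * n%:R ^+ 2).
        have -> : k%:R ^+ 2 * (2 * eps * (p * n%:R ^+ 2)) =
           2 * (k%:R ^+ 2 * eps) * (p * n%:R ^+ 2) by ring.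
        by rewrite epsk; field.
      by move: h1 h3; rewrite h4; goal_lra.
    + by move=> u; rewrite cn.
    + by move=> Z t t'; exact: (conc1 (t, t', Z, c, D)).
    + by move=> Z t t'; exact: (conc2 (t, t', Z, c, D)).
have pe := ltW p0.
apply: le_trans (gnp_probU pe p1 _ _) _.
have b1 : gnp_prob p (fun G : {set {set 'I_n}} => ~ degree_bound G p) <= 32 / y.
  apply: le_trans (prob_degree_bound n p0 p1) _.
  apply: (@le_trans _ _ (expR (y / 32) * expR (1 - 3 / 32 * y))).
    apply: ler_wpM2r; first exact: expR_ge0.
    apply: le_trans nexp _; rewrite ler_expR mulrC; apply: ler_wpM2l; first exact: ltW.
    by rewrite nuE; move: e1; goal_lra.
  rewrite -expRD; apply: (@le_trans _ _ (expR (- (y / 32)))); first by rewrite ler_expR; move: y32; goal_lra.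
  by have -> : 32 / y = (y / 32)^-1; [rewrite invf_div | apply: expRN_le; rewrite divr_gt0].
have iny : n%:R^-1 <= y^-1 :> R by rewrite lef_pV2 ?posrE.
have b2 : gnp_prob p (fun G : {set {set 'I_n}} => ~ discrepancy G p eps C) <= y^-1.
  apply: le_trans (prob_discrepancy n0 p0 p1 eps0 _ _) _.
  - by move: epskap kape e1; goal_lra.
  - have -> : eps / 4 * (C - 1) = 4 by rewrite CE; field; rewrite gt_eqF.
    by [].
  apply: le_trans iny; have -> : n%:R^-1 = 2 * (2 * n%:R)^-1 :> R by field; rewrite gt_eqF.
  by rewrite ler_pM2l //; apply: expRN_le; rewrite mulr_gt0.
have b3 : gnp_prob p (fun G : {set {set 'I_n}} =>
    degree_bound G p /\ ~ local_discrepancy G p eps1 C1) <= 4 / y.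
  apply: le_trans (prob_local_discrepancy n0 p0 p1 eps10 _ _) _.
  - by rewrite eps1E; move: gam1; goal_lra.
  - have -> : eps1 / 4 * (C1 - 2) = 6 by rewrite C1E; field; rewrite gt_eqF.
    by [].
  rewrite -/y -mulrA.
  apply: (@le_trans _ _ (2 * (expR (y / 2) * expR (- y)))).
    rewrite ler_pM2l //; apply: ler_wpM2r; first exact: expR_ge0.
    apply: le_trans nexp _; rewrite ler_expR mulrC; apply: ler_wpM2l; first exact: ltW.
    by rewrite nuE; move: e1; goal_lra.
  rewrite -expRD; have -> : 4 / y = 2 * (y / 2)^-1 by field; rewrite gt_eqF.
  rewrite ler_pM2l //; apply: (@le_trans _ _ (expR (- (y / 2)))); first by rewrite ler_expR; goal_lra.
  by apply: expRN_le; rewrite divr_gt0.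
have enn : expR (- n%:R) <= y^-1 by apply: le_trans iny; exact: expRN_le.
have nexp' : n%:R <= expR (e / 64 * y) by rewrite -nuE.
have Tm' : m%:R <= 2 * T / p ^+ 2 by rewrite -mulrA.
have b5 : gnp_prob p (fun G => ~ forall i, concentrated p G (W i) (Q2 i) e N) <= y^-1.
  apply: le_trans (prob_concentrated n0 p0 p1 _ _ e0 WI) _.
  by rewrite cardI; apply: le_trans enn; exact: (data_bound n0 p0 p1 e0 e1 T0 nexp' Tm' NC CNE).
have b4 : gnp_prob p (fun G => ~ forall i, concentrated p G (W i) (Q1 i) (g / 2) N) <= y^-1.
  have g20 : 0 < g / 2 by rewrite divr_gt0.
  apply: le_trans (prob_concentrated n0 p0 p1 _ _ g20 WI) _.
  rewrite cardI; apply: le_trans enn.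
  apply: le_trans (data_bound n0 p0 p1 e0 e1 T0 nexp' Tm' NC CNE).
  apply: ler_wpM2l; first by rewrite mulr_ge0 ?exprn_ge0.
  rewrite ler_expR lerD2l lerN2; apply: ler_wpM2r; first by rewrite mulr_ge0 // ltW.
  by move: eg gam0; rewrite gE; goal_lra.
(* The five failure probabilities are at most 32/y, 1/y, 4/y, 1/y and 1/y. *)
have h := gnp_probU pe p1.
apply: le_trans (lerD b1 (le_trans (h _ _ _) (lerD b2 (le_trans (h _ _ _) (lerD b3
  (le_trans (h _ _ _) (lerD b4 b5))))))) _.
have : 0 <= y^-1 by rewrite invr_ge0 ltW.
by move: (y^-1) => w; goal_lra.
Qed.

(** For tiny [p] the number of edges is not concentrated. But a spanning subgraph of positive
    minimum degree forces at least n adjacent ordered pairs, which is itself unlikely when p n <=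
    1/4; otherwise p n^2 > n / 4 and the Chernoff bound applies. *)
Lemma sparse_edges (R : realType) (gamma : R) (n : nat) (p : R) :
  0 < gamma -> gamma <= 10^-1 -> 2 / gamma <= n%:R -> (0 < n)%N -> 0 < p -> p <= 1 ->
  gnp_prob p (fun G : {set {set 'I_n}} =>
     n%:R <= (ebt G [set: 'I_n] [set: 'I_n])%:R :> R /\
     (1 + 2 * gamma) * (p * n%:R ^+ 2) < (ebt G [set: 'I_n] [set: 'I_n])%:R)
  <= 32 / gamma ^+ 2 / n%:R.
Proof.
move=> g0 g1 gn n0 p0 p1; have pe := ltW p0.
have nR : 0 < n%:R :> R by rewrite ltr0n.
have nR1 : 1 <= n%:R :> R by rewrite ler1n.
have gg : 0 < gamma ^+ 2 by rewrite exprn_gt0.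
have gg1 : gamma ^+ 2 <= 10^-1 by rewrite expr2 -[leRHS]mulr1; apply: ler_pM; rewrite ?(ltW g0) //; move: g1; goal_lra.
pose T : {set 'I_n} := [set: 'I_n].
have cT : #|T|%:R = n%:R :> R by rewrite cardsT card_ord.
have tail (l t : R) : 0 <= l -> l <= 8^-1 ->
    gnp_prob p (fun G : {set {set 'I_n}} => t <= l * ((ebt G T T)%:R - p * n%:R ^+ 2)) <=
    expR (2 * l ^+ 2 * (p * n%:R ^+ 2) - t + l * (p * n%:R)).
  move=> l0 l8.
  have -> : expR (2 * l ^+ 2 * (p * n%:R ^+ 2) - t + l * (p * n%:R)) =
     p ^+ #|(finset.set0 : {set {set 'I_n}})| *
     expR (2 * l ^+ 2 * p * #|T|%:R * #|T|%:R - t + `|l| * p * #|T :&: T|%:R).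
    rewrite cards0 expr0 mul1r finset.setIid cT ger0_norm //; congr expR; ring.
  apply: le_trans (cut_tail p0 p1 _ (finset.sub0set _) _ _).
  - apply: le_gnp_prob => // G _ h; split; first exact: finset.sub0set.
    by rewrite cT -mulrA -expr2.
  - by move=> x y _ _; rewrite inE.
  - by rewrite ger0_norm.
have pn0 : 0 <= p * n%:R by rewrite mulr_ge0.
have e32 c : 0 < c -> c^-1 <= 32 / gamma ^+ 2 -> expR (- (c * n%:R)) <= 32 / gamma ^+ 2 / n%:R.
  move=> c0 cg; apply: le_trans (expRN_le _) _; first by rewrite mulr_gt0.
  by rewrite invfM; apply: ler_wpM2r => //; rewrite invr_ge0 ltW.
have [pn4|pn4] := leP (p * n%:R) 4^-1.
  apply: (@le_trans _ _ (expR (- (20^-1 * n%:R)))); last first.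
    apply: e32; first by rewrite invr_gt0 ltr0n.
    by rewrite invrK ler_pdivlMr //; move: gg1; goal_lra.
  apply: (@le_trans _ _ (gnp_prob p (fun G : {set {set 'I_n}} =>
     (n%:R - p * n%:R ^+ 2) / 8 <= 8^-1 * ((ebt G T T)%:R - p * n%:R ^+ 2)))).
    by apply: le_gnp_prob => // G _ [h _]; rewrite mulrC ler_pM2l // lerD2r.
  apply: le_trans (tail _ _ _ _) _ => //.
  rewrite ler_expR.
  have : p * n%:R ^+ 2 <= 4^-1 * n%:R by rewrite expr2 mulrA ler_pM2r.
  by move: pn4 nR1; goal_lra.
have l0 : 0 <= gamma / 8 by rewrite divr_ge0 // ltW.
apply: (@le_trans _ _ (expR (- ((5 / 128 * gamma ^+ 2) * n%:R)))); last first.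
  apply: e32; first by rewrite mulr_gt0 // divr_gt0 ?ltr0n.
  rewrite invfM ler_pM2r ?invr_gt0 // invf_div ler_pdivrMr ?ltr0n // -natrM ler_nat.
  by [].
apply: (@le_trans _ _ (gnp_prob p (fun G : {set {set 'I_n}} =>
   gamma / 8 * (2 * gamma * (p * n%:R ^+ 2)) <= gamma / 8 * ((ebt G T T)%:R - p * n%:R ^+ 2)))).
  apply: le_gnp_prob => // G _ [_ h]; apply: ler_wpM2l => //.
  by move: (ltW h); rewrite -/T; goal_lra.
apply: le_trans (tail _ _ l0 _) _; first by move: g1; goal_lra.
rewrite ler_expR.
have h1 : gamma / 8 * (p * n%:R) <= gamma ^+ 2 / 16 * (p * n%:R ^+ 2).
  have -> : gamma ^+ 2 / 16 * (p * n%:R ^+ 2) = gamma / 8 * (p * n%:R) * (gamma / 2 * n%:R) by field.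
  rewrite ler_peMr //; first by rewrite mulr_ge0.
  move: gn; rewrite ler_pdivrMr //; goal_lra.
have h2 : gamma ^+ 2 * (4^-1 * n%:R) <= gamma ^+ 2 * (p * n%:R ^+ 2).
  by rewrite ler_pM2l // expr2 mulrA ler_pM2r // ltW.
move: h1 h2; set w := p * n%:R ^+ 2; have -> : (gamma / 8) ^+ 2 = gamma ^+ 2 / 64 by field.
have -> : gamma / 8 * (2 * gamma * w) = gamma ^+ 2 / 4 * w by field.
goal_lra.
Qed.

Theorem theorem4 (R : realType) (gamma : R) (gamma_gt0 : 0 < gamma) :
  exists (C : R) (r : nat), (0 < r)%N /\
    forall p : nat -> R, (forall n : nat, 0 < p n <= 1) ->
      gnp_aas p (fun (n : nat) (G : {set {set 'I_n}}) =>
        forall H : {set {set 'I_n}},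
          H \subset G -> triangle_free H ->
          (3^-1 + gamma) * p n * n%:R <= (min_degree H)%:R ->
          exists F : {set {set 'I_n}},
            [/\ F \subset H,
                partite r (H :\: F) &
                #|F|%:R <= Num.min (C * (p n)^-1 * n%:R)
                             (((2 * r%:R)^-1 + gamma) * p n * n%:R ^+ 2)]).
Proof.
(* The constants are chosen for a value at most 1/10; decreasing [gamma] weakens the degree
   condition and strengthens the conclusion. *)
have [gam [gam0 gam1 gamg]] : exists gam : R, [/\ 0 < gam, gam <= 10^-1 & gam <= gamma].
  exists (Num.min gamma 10^-1); split; last by rewrite ge_min lexx.
    by rewrite lt_min gamma_gt0 invr_gt0 ltr0n.
  by rewrite ge_min lexx orbT.
have [CA [K0 [r [n1 [r0 CA0 K1 CAK whp]]]]] := dense_range gam0 gam1.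
(* [CA] serves the range p^2 n >= K0. Below it p n^2 < K0 n / p, so the second entry makes the
   quadratic bound the smaller of the two. *)
exists (Num.max CA ((1 + gamma) * K0)), r; split => // p hp.
set C := Num.max _ _.
have rR : 0 < r%:R :> R by rewrite ltr0n.
have r1 : 1 <= r%:R :> R by rewrite ler1n.
have ir0 : 0 < (2 * r%:R)^-1 :> R by rewrite invr_gt0 mulr_gt0.
have ir1 : (2 * r%:R)^-1 <= 1 :> R by rewrite invf_le1 ?mulr_gt0 //; move: r1; goal_lra.
pose A (n : nat) (G : {set {set 'I_n}}) : Prop := forall H : {set {set 'I_n}},
  H \subset G -> triangle_free H -> (3^-1 + gamma) * p n * n%:R <= (min_degree H)%:R ->
  partite_after_removal r (Num.min (C * (p n)^-1 * n%:R)
    (((2 * r%:R)^-1 + gamma) * p n * n%:R ^+ 2)) H.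
suff : (gnp_prob (p n) (@A n) @[n --> \oo] --> (1 : R))%classic by [].
pose D : R := 40 + 32 / gam ^+ 2.
have g20 : 0 < 32 / gam ^+ 2 by rewrite divr_gt0 ?exprn_gt0 ?ltr0n.
(* When p^2 n >= K0 >= 1 one has p n >= sqrt n, so the failure bounds of both ranges are at most
   [D / Num.sqrt n%:R]. *)
have low : \forall n \near \oo%classic, 1 - D / Num.sqrt n%:R <= gnp_prob (p n) (@A n).
  near=> n.
  have n0 : (0 < n)%N by near: n; exists 1%N.
  have nn1 : (n1 <= n)%N by near: n; exists n1.
  have ng : 2 / gam <= n%:R by near: n; exact: nbhs_infty_ger.
  have nR : 0 < n%:R :> R by rewrite ltr0n.
  have nR1 : 1 <= n%:R :> R by rewrite ler1n.
  have /andP[p0 p1] := hp n; have pe := ltW p0.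
  have pn0 : 0 < p n * n%:R by rewrite mulr_gt0.
  have sq0 : 0 < Num.sqrt n%:R :> R by rewrite sqrtr_gt0.
  have degs (H : {set {set 'I_n}}) u : is_graph H ->
      (3^-1 + gamma) * p n * n%:R <= (min_degree H)%:R ->
      (3^-1 + gam) * p n * n%:R <= #|nbr H u|%:R.
    move=> gH hd; apply: (@le_trans _ _ ((3^-1 + gamma) * p n * n%:R)).
      by rewrite -!mulrA; apply: ler_wpM2r; [exact: ltW | rewrite lerD2l].
    apply: le_trans hd _; rewrite ler_nat; apply: leq_trans (min_degree_le H u) _.
    exact: nbr_card_degree.
  rewrite gnp_probC // lerD2l lerN2.
  have [pK|pK] := leP K0 (p n ^+ 2 * n%:R).
    apply: (@le_trans _ _ (40 / (p n * n%:R))); last first.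
      apply: (@le_trans _ _ (40 / Num.sqrt n%:R)).
        rewrite ler_pM2l ?ltr0n // lef_pV2 ?posrE //.
        rewrite -(@ler_pXn2r _ 2) ?nnegrE ?(ltW pn0) ?(ltW sq0) // sqr_sqrtr ?(ltW nR) //.
        have -> : (p n * n%:R) ^+ 2 = p n ^+ 2 * n%:R * n%:R by ring.
        by rewrite ler_peMl // ?(ltW nR) //; exact: le_trans pK.
      by rewrite ler_pM2r ?invr_gt0 // /D lerDl ltW.
    apply: le_trans (whp n (p n) nn1 p0 p1 pK); apply: le_gnp_prob => // G gG.
    apply: contra_not => good H HG tf hd.
    have gH : is_graph H by exact: fintype.subset_trans HG gG.
    have [F [FH Fp Fn]] := good H HG tf (fun u => degs H u gH hd).
    exists F; split => //; apply: le_trans Fn _; rewrite le_min; apply/andP; split.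
      rewrite mulrAC; apply: ler_wpM2r; first exact: ltW.
      by apply: ler_wpM2r; rewrite ?invr_ge0 // /C le_max lexx.
    apply: (@le_trans _ _ (gam * (p n * n%:R ^+ 2))).
      rewrite ler_pdivrMr //; apply: (@le_trans _ _ (gam * K0 * n%:R)).
        by rewrite ler_pM2r.
      have -> : gam * (p n * n%:R ^+ 2) * p n = gam * (p n ^+ 2 * n%:R) * n%:R by ring.
      by rewrite ler_pM2r // ler_pM2l.
    rewrite -[leRHS]mulrA; apply: ler_wpM2r; first by rewrite mulr_ge0 // exprn_ge0.
    by apply: le_trans gamg _; rewrite lerDr ltW.
  apply: (@le_trans _ _ (32 / gam ^+ 2 / n%:R)); last first.
    apply: ler_pM; rewrite ?(ltW g20) ?invr_ge0 //; first by rewrite /D lerDr.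
    rewrite lef_pV2 ?posrE // -[leRHS]sqr_sqrtr // expr2 ler_peMl ?(ltW sq0) //.
    by apply: le_trans (ler_wsqrtr nR1); rewrite sqrtr1.
  apply: le_trans (sparse_edges gam0 gam1 ng n0 p0 p1); apply: le_gnp_prob => // G gG.
  move=> nA; apply: contrapT => nb; apply: nA => H HG tf hd.
  have gH : is_graph H by exact: fintype.subset_trans HG gG.
  have HGe : (ebt H [set: 'I_n] [set: 'I_n] <= ebt G [set: 'I_n] [set: 'I_n])%N by exact: ebt_le.
  have manyH : n%:R <= (ebt H [set: 'I_n] [set: 'I_n])%:R :> R.
    rewrite ler_nat /ebt -[leqLHS]card_ord -cardsT -sum1_card; apply: leq_sum => u _.
    rewrite finset.setIT -(ltr_nat R); apply: lt_le_trans (degs H u gH hd).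
    by rewrite !mulr_gt0 // addr_gt0.
  have fewG : (ebt G [set: 'I_n] [set: 'I_n])%:R <= (1 + 2 * gam) * (p n * n%:R ^+ 2).
    rewrite leNgt; apply/negP => h; apply: nb; split => //.
    by apply: le_trans manyH _; rewrite ler_nat.
  (* At most |H| / r edges are lost, and 2 |H| <= (1 + 2 gam) p n^2 turns this into (1/(2r) + gam /
     r) p n^2. *)
  have [f Hf] := random_colouring R r0 gH.
  exists (monochromatic H f); split.
  - by apply/fintype.subsetP => e; rewrite in_set => /andP[].
  - by have := monochromatic_partite H f; rewrite card_ord.
  have w0 : 0 < p n * n%:R ^+ 2 by rewrite mulr_gt0 // exprn_gt0.
  have Fn : #|monochromatic H f|%:R <= ((2 * r%:R)^-1 + gamma) * p n * n%:R ^+ 2.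
    rewrite -(ler_pM2l rR); apply: le_trans Hf _.
    have h1 : 2 * #|H|%:R <= (1 + 2 * gam) * (p n * n%:R ^+ 2).
      apply: le_trans fewG; rewrite -natrM ler_nat; apply: leq_trans HGe.
      exact: double_edges.
    have -> : r%:R * (((2 * r%:R)^-1 + gamma) * p n * n%:R ^+ 2) =
      (2^-1 + r%:R * gamma) * (p n * n%:R ^+ 2) by field; rewrite gt_eqF.
    have h2 : gam * (p n * n%:R ^+ 2) <= r%:R * gamma * (p n * n%:R ^+ 2).
      rewrite ler_pM2r //; apply: le_trans gamg _; rewrite ler_peMl // ltW //.
    by move: h1 h2; goal_lra.
  rewrite le_min Fn andbT; apply: le_trans Fn _.
  apply: (@le_trans _ _ ((1 + gamma) * (p n * n%:R ^+ 2))).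
    by rewrite -[leLHS]mulrA ler_pM2r // lerD2r.
  apply: (@le_trans _ _ ((1 + gamma) * K0 * (p n)^-1 * n%:R)); last first.
    apply: ler_wpM2r; first exact: ltW.
    by apply: ler_wpM2r; rewrite ?invr_ge0 // /C le_max lexx orbT.
  rewrite mulrAC ler_pdivlMr // -[leRHS]mulrA -mulrA ler_pM2l; last by rewrite addr_gt0.
  have -> : p n * n%:R ^+ 2 * p n = p n ^+ 2 * n%:R * n%:R by ring.
  by rewrite ler_pM2r // ltW.
have D0 : 0 < D by rewrite addr_gt0 ?ltr0n.
have lim : (D / Num.sqrt n%:R @[n --> \oo] --> (0 : R))%classic.
  apply/cvgrPdist_le => d d0; near=> n.
  have nd : (D / d) ^+ 2 <= n%:R by near: n; exact: nbhs_infty_ger.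
  have n0 : 0 < n%:R :> R by rewrite ltr0n; near: n; exists 1%N.
  have sq0 : 0 < Num.sqrt n%:R :> R by rewrite sqrtr_gt0.
  rewrite sub0r normrN ger0_norm; last by rewrite divr_ge0 ?ltW.
  rewrite ler_pdivrMr // -ler_pdivrMl // mulrC.
  by rewrite -[leLHS](ger0_norm (ltW (divr_gt0 D0 d0))) -sqrtr_sqr ler_wsqrtr.
have low1 : (1 - D / Num.sqrt n%:R @[n --> \oo] --> (1 : R))%classic.
  by have := cvgB (cvg_cst (1 : R)) lim; rewrite subr0; exact.
apply: (@squeeze_cvgr _ _ _ _ (fun n => 1 - D / Num.sqrt n%:R) (fun=> 1)) => //.
  near=> n; apply/andP; split; first by near: n.
  by have /andP[/ltW p0 p1] := hp n; exact: gnp_prob_le1.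
exact: cvg_cst.
Unshelve. all: by end_near.
Qed.
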